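(* Let $K$ be an algebraically closed field of arbitrary characteristic, and let $N\ge2$, $d\ge1$ and $N+1\le n\le\binom{d+N}{N}$ be integers with $(N,d,n)\ne(2,2,5)$. If $f_1,\ldots,f_n$ are general forms of degree $d$ in $K[X_0,\ldots,X_N]$ such that the ideal $(f_1,\ldots,f_n)$ is $\mathfrak{m}$-primary, then the syzygy bundle $\mathrm{Syz}(f_1,\ldots,f_n)$ on $\mathbb{P}^N$ is stable. If $(N,d,n)=(2,2,5)$ and $f_1,\ldots,f_5$ are general quadratic forms in $K[X_0,X_1,X_2]$ such that the ideal $(f_1,\ldots,f_5)$ is $\mathfrak{m}$-primary, then the syzygy bundle $\mathrm{Syz}(f_1,\ldots,f_5)$ on $\mathbb{P}^2$ is semistable.
   Context: $\mathbb{P}^N$ is projective $N$-space over $K$, $\mathcal{O}=\mathcal{O}_{\mathbb{P}^N}$, $R=K[X_0,\ldots,X_N]$, $R_d$ is its degree-$d$ homogeneous component, and $\mathfrak{m}=(X_0,\ldots,X_N)$. ''General'': a statement holds for general forms $f_1,\ldots,f_n$ of degree $d$ if there is a Zariski-open dense subset $U$ of $R_d\times\cdots\times R_d$ ($n$ factors) such that the statement holds for every $(f_1,\ldots,f_n)\in U$. Syzygy bundle: if $f_1,\ldots,f_n\in R_d$ and the ideal $(f_1,\ldots,f_n)$ is $\mathfrak{m}$-primary, then $\mathrm{Syz}(f_1,\ldots,f_n)$ is the kernel of the morphism $\mathcal{O}(-d)^n\to\mathcal{O}$, $(g_1,\ldots,g_n)\mapsto f_1g_1+\cdots+f_ng_n$;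 it is a vector bundle of rank $n-1$. Stability: for a torsion-free coherent sheaf $E$ on $\mathbb{P}^N$ of rank $r>0$, the slope is $\mu(E)=c_1(E)/r$. $E$ is semistable (in the sense of Mumford–Takemoto) if $\mu(F)\le\mu(E)$ for every coherent subsheaf $F\subset E$ with $0<\mathrm{rk}\,F<\mathrm{rk}\,E$, and stable if the inequality is always strict. *)

(* Defs.v *)
From HB Require Import structures.
From mathcomp Require Import all_boot all_order all_algebra.
From mathcomp Require Import mpoly.

Set Implicit Arguments.
Unset Strict Implicit.
Unset Printing Implicit Defensive.

Import Order.TTheory GRing.Theory Num.Theory.
Local Open Scope ring_scope.

(* Coherent sheaves on P^N are treated as in Serre's FAC: P^N is the variety of *)
(* closed points over the algebraically closed field K, and a sheaf is given by *)
(* its stalks.  A torsion-free sheaf embeds in the constant sheaf given by its  *)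
(* generic stalk, so all the sheaves below are families of submodules of        *)
(* Frac(R)^I, R = K[X_0, ..., X_N].                                             *)

Section ProjectiveSpace.

Variables (K : closedFieldType) (N : nat).

Local Notation R := {mpoly K[N.+1]}.
Local Notation FR := {fraction R}.

(* Homogeneous coordinates.  Everything below depends on a point only through   *)
(* the vanishing of homogeneous polynomials, hence only on the line it spans.   *)
Definition point := {v : 'rV[K]_N.+1 | v != 0}.

Definition at_point (G : R) (p : point) : K := G.@[fun i => sval p 0 i].

Definition frac_of (G : R) : FR := FracField.tofrac G.

(* The stalk O(e)_p: fractions F/G with F, G homogeneous, deg F - deg G = e and *)
(* G(p) <> 0.  For e = 0 it is the local ring O_p.                              *)
Definition twist_stalk (e : int) (p : point) (s : FR) : Prop :=
  exists (F G : R) (k l : nat),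
    [/\ F \is k.-homog, G \is l.-homog, k%:Z = l%:Z + e,
        at_point G p != 0 & s = frac_of F / frac_of G].

Definition sheaf (n : nat) := point -> 'rV[FR]_n -> Prop.

Definition subsheaf n (F E : sheaf n) : Prop := forall p s, F p s -> E p s.

(* F is a coherent subsheaf of O(e)^n.  Since O(e)^n is coherent, it suffices   *)
(* that F be of finite type: near each point, on some D_+(G), its stalks are    *)
(* generated by finitely many sections t_1, ..., t_k.  A section is determined  *)
(* by its germ in Frac(R)^n.                                                    *)
Definition coherent (e : int) n (F : sheaf n) : Prop :=
  (forall p s, F p s -> forall i, twist_stalk e p (s 0 i)) /\
  (forall p, exists (b : nat) (G : R) (k : nat) (t : 'M[FR]_(k, n)),
     [/\ G \is b.-homog, at_point G p != 0 &
         forall q, at_point G q != 0 -> forall s,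
           F q s <-> exists c : 'rV[FR]_k,
             (forall j, twist_stalk 0 q (c 0 j)) /\ s = c *m t]).

Definition stalk_independent (p : point) r n (M : 'M[FR]_(r, n)) : Prop :=
  forall c : 'rV[FR]_r,
    (forall j, twist_stalk 0 p (c 0 j)) -> c *m M = 0 -> c = 0.

Definition rows_in n (F : sheaf n) (p : point) r (M : 'M[FR]_(r, n)) : Prop :=
  forall i, F p (row i M).

(* The rank of each stalk F_p over the domain O_p (for F coherent it does not   *)
(* depend on p).                                                                *)
Definition has_rank n (F : sheaf n) (r : nat) : Prop :=
  forall p : point,
    (exists M : 'M[FR]_(r, n), rows_in F p M /\ stalk_independent p M) /\
    (forall M : 'M[FR]_(r.+1, n), rows_in F p M -> ~ stalk_independent p M).

(* s_1 /\ ... /\ s_r in the r-th exterior power of Frac(R)^n, where s_i is the  *)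
(* i-th row of M, through its coordinates indexed by r-tuples of columns.       *)
Definition wedge r n (M : 'M[FR]_(r, n)) : {ffun {ffun 'I_r -> 'I_n} -> FR} :=
  [ffun I : {ffun 'I_r -> 'I_n} => \det (colsub I M)].

(* The stalk at p of (Lambda^r F)/torsion.                                      *)
Definition ext_stalk r n (F : sheaf n) (p : point)
    (eta : {ffun {ffun 'I_r -> 'I_n} -> FR}) : Prop :=
  exists (k : nat) (c : 'I_k -> FR) (M : 'I_k -> 'M[FR]_(r, n)),
    [/\ forall j, twist_stalk 0 p (c j),
        forall j, rows_in F p (M j) &
        forall I, eta I = \sum_j c j * wedge (M j) I].

(* The bidual of a finitely generated O_p-submodule G of Frac(R)^T whose        *)
(* elements have homogeneous coordinates of a fixed degree: linear forms on G   *)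
(* with values in O_p extend to Frac(R)^T, and eta lies in G^** iff they all    *)
(* take values in O_p at eta.  Vectors outside the span of G are excluded since *)
(* a form vanishing on G can be rescaled by any element of Frac(R).             *)
Definition bidual (T : finType) (p : point) (G : {ffun T -> FR} -> Prop)
    (eta : {ffun T -> FR}) : Prop :=
  forall lambda : T -> FR,
    (forall xi, G xi -> twist_stalk 0 p (\sum_t lambda t * xi t)) ->
    twist_stalk 0 p (\sum_t lambda t * eta t).

(* The determinant (Lambda^r F)^** of a torsion-free coherent F of rank r.      *)
Definition det_stalk r n (F : sheaf n) (p : point) :=
  bidual p (@ext_stalk r n F p).

(* c_1(F) = c_1(det F) = a, that is, det F is isomorphic to O(a), for F         *)
(* torsion-free coherent of rank r.  Looking at generic stalks, an isomorphism  *)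
(* from O(a) to det F is multiplication by a fixed vector omega.                *)
Definition has_c1 n (F : sheaf n) (r : nat) (a : int) : Prop :=
  exists omega : {ffun {ffun 'I_r -> 'I_n} -> FR},
    omega != 0 /\
    forall p eta,
      det_stalk F p eta <->
      exists phi, twist_stalk a p phi /\ forall I, eta I = phi * omega I.

Definition slope (r : nat) (a : int) : rat := a%:~R / r%:R.

(* Mumford-Takemoto (semi)stability of a coherent subsheaf E of O(e)^n; cmp is  *)
(* the comparison between slopes.                                               *)
Definition slope_condition (cmp : rel rat) (e : int) n (E : sheaf n) : Prop :=
  coherent e E /\
  exists (r : nat) (a : int),
    [/\ (0 < r)%N, has_rank E r, has_c1 E r a &
        forall (F : sheaf n) (r' : nat) (a' : int),
          coherent e F -> subsheaf F E -> has_rank F r' -> has_c1 F r' a' ->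
          (0 < r' < r)%N -> cmp (slope r' a') (slope r a)].

Definition stable e n (E : sheaf n) := slope_condition (fun x y => x < y) e E.
Definition semistable e n (E : sheaf n) :=
  slope_condition (fun x y => x <= y) e E.

(* R_d x ... x R_d (n factors).                                                 *)
Definition forms (n d : nat) := {ffun 'I_n -> dhomog N.+1 K d}.

Definition form n d (f : forms n d) (i : 'I_n) : R := mpoly_of_dhomog (f i).

Definition in_ideal n d (f : forms n d) (g : R) : Prop :=
  exists h : 'I_n -> R, g = \sum_i h i * form f i.

Definition in_irrelevant (g : R) : Prop :=
  exists h : 'I_N.+1 -> R, g = \sum_i h i * 'X_i.

Definition primary_ideal (I : R -> Prop) : Prop :=
  ~ I 1 /\ forall x y, I (x * y) -> I x \/ exists k, I (y ^+ k).

Definition m_primary n d (f : forms n d) : Prop :=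
  primary_ideal (in_ideal f) /\
  forall g, (exists k, in_ideal f (g ^+ k)) <-> in_irrelevant g.

(* Kernel of O(-d)^n -> O, (g_1, ..., g_n) |-> f_1 g_1 + ... + f_n g_n.         *)
Definition Syz n d (f : forms n d) : sheaf n := fun p s =>
  (forall i, twist_stalk (- d%:Z) p (s 0 i)) /\
  \sum_i frac_of (form f i) * s 0 i = 0.

End ProjectiveSpace.

(* Polynomial functions on a finite-dimensional vector space, hence its Zariski *)
(* topology, do not depend on the chosen basis.                                 *)
Definition zariski_open (K : fieldType) (V : vectType K) (U : V -> Prop) :=
  exists S : {mpoly K[\dim {:V}]} -> Prop,
    forall v, U v <->
      exists P, S P /\ P.@[fun i => coord (vbasis {:V}) i v] != 0.

Definition zariski_dense (K : fieldType) (V : vectType K) (U : V -> Prop) :=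
  forall W : V -> Prop, zariski_open W -> (exists v, W v) ->
    exists v, U v /\ W v.

Definition for_general (K : closedFieldType) (N n d : nat)
    (P : forms K N n d -> Prop) : Prop :=
  exists U : forms K N n d -> Prop,
    [/\ zariski_open U, zariski_dense U & forall f, U f -> P f].

(* Main.v *)
(* A subsheaf F of Syz(f) of rank r and degree a gives, through det F, a global   *)
(* section of Lambda^r Syz(f) (-a): a nonzero vector w of forms w_I of degree     *)
(* m = - a - d r, indexed by r-tuples I of columns, which satisfies the Pluecker  *)
(* relations and is annihilated by contraction with f.  For fixed r and m, the f  *)
(* admitting such a w form a closed set, by elimination theory.  There are        *)
(* finitely many pairs (r, m) violating the slope inequality, so one f without    *)
(* destabilizing w makes the general one stable.                                  *)
(*   For f take distinct monomials.  The coefficients of the w_I f^I at a leading *)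
(* monomial form a Pluecker vector of a matroid without coloops, whose            *)
(* circuits bound m from below by degrees of gcds of the f_i; this yields         *)
(* Brenner's criterion, d (|C| - 1) < (d - deg gcd C) (n - 1) for 2 <= |C| < n.   *)
(* Explicit families of monomials satisfy it for all (N, d, n) except (2, 2, 5),  *)
(* where only the non-strict inequality can be reached.                           *)

(* With n forms the slope of Syz(f) is -d - d/(n-1) ([syz_rank], [syz_c1]), and a subsheaf of rank r
   with vector w of degree m has slope -d - m/r ([subsheaf_plucker_form]). Stability therefore
   follows if no w <> 0 exists with 0 < r < n-1 and m(n-1) <= d r, semistability if none exists with
   m(n-1) < d r ([syz_slope_condition]). Sheaves play no further part.

   The conditions on w are homogeneous equations in its coefficients, which depend polynomially on
   f. [elimination], a consequence of [projective_nullstellensatz], turns their unsolvability at one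
   f0 into the nonvanishing at f0 of a polynomial Delta such that they stay unsolvable wherever
   Delta <> 0 ([no_plucker_form_open]). The product of the finitely many Delta defines the open
   dense set ([general_no_plucker_form]).

   For monomial f0, [leading_part] replaces w by a vector c of scalars, whose nonzero coordinates
   are the bases of a matroid. A basis is cut into blocks, each belonging to a circuit of a
   successive contraction ([circuit_decomposition]). Since one element of each block may be
   exchanged freely ([swap_basis]), the degrees of the gcds g_b of the blocks satisfy d |B| <= m +
   sum of deg g_b ([plucker_form_blocks]). Summing Brenner's inequality over the blocks gives d r <
   m(n-1), or <= in the weak form ([brenner_lt], [brenner_le]).

   The monomials come from [exists_spread]: in three variables, points on two sides of the triangle
   of exponents, then whole rows; in more variables, whole layers; finitely many small cases by
   computation. *)
Require Import Defs.
From Stdlib Require Import Classical.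
From mathcomp Require Import all_boot all_order all_algebra.
From mathcomp Require Import mpoly zify ring.

Set Implicit Arguments.
Unset Strict Implicit.
Unset Printing Implicit Defensive.

Import Order.TTheory GRing.Theory Num.Theory.
Local Open Scope ring_scope.

(** * The projective Nullstellensatz *)

Section Univariate.

Variable n : nat.
Variable R : comNzRingType.

(** A polynomial in n + 1 variables is handled as a univariate one in the last variable; [multi]
    undoes the passage [muni]. *)
Definition multi (q : {poly {mpoly R[n]}}) : {mpoly R[n.+1]} :=
  (map_poly (@mwiden n R) q).['X_ord_max].

Lemma multi_is_additive : {morph multi : p q / p + q}.
Proof. by move=> p q; rewrite /multi rmorphD hornerD. Qed.

Lemma multiM : {morph multi : p q / p * q}.
Proof. by move=> p q; rewrite /multi rmorphM hornerM. Qed.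

Lemma multiC c : multi c%:P = mwiden c.
Proof. by rewrite /multi map_polyC hornerC. Qed.

Lemma multiX k : multi 'X^k = 'X_ord_max ^+ k.
Proof. by rewrite /multi map_polyXn hornerXn. Qed.

Lemma multi0 : multi 0 = 0.
Proof. by rewrite /multi map_poly0 horner0. Qed.

Lemma multi_sum (I : Type) (r : seq I) (F : I -> {poly {mpoly R[n]}}) :
  multi (\sum_(i <- r) F i) = \sum_(i <- r) multi (F i).
Proof. exact: (big_morph multi multi_is_additive multi0). Qed.

Lemma mnm_split (m : 'X_{1..n.+1}) :
  (mnmwiden [multinom m (widen_ord (leqnSn n) i) | i < n]
    + U_(ord_max) *+ m ord_max)%MM = m.
Proof.
apply/mnmP => i; rewrite mnmDE mulmnE mnm1E.
case: (unliftP ord_max i) => [j ->|->].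
  have -> : lift ord_max j = widen_ord (leqnSn n) j.
    by apply: val_inj; exact: lift_max.
  rewrite mnmwiden_widen mnmE.
  have -> : (ord_max == widen_ord (leqnSn n) j) = false.
    by apply/eqP => /(congr1 val) /= E; move: (ltn_ord j); rewrite -E ltnn.
  by rewrite mul0n addn0.
by rewrite mnmwiden_ordmax eqxx mul1n.
Qed.

Lemma muniK : cancel (@muni n R) multi.
Proof.
move=> p; rewrite muniE multi_sum [RHS]mpolyE; apply: eq_bigr => m _.
rewrite -mul_polyC multiM multiC multiX mwidenZ mwidenX -scalerAl.
congr (_ *: _); rewrite mpolyXn -mpolyXD; congr 'X_[_].
exact: mnm_split.
Qed.

Lemma coef_muni (p : {mpoly R[n.+1]}) i (m : 'X_{1..n}) :
  ((muni p)`_i)@_m = p@_(mnmwiden m + U_(ord_max) *+ i)%MM.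
Proof.
rewrite muniE coef_sum raddf_sum /= [in RHS](mpolyE p) raddf_sum /=.
apply: eq_bigr => k _.
rewrite coefZ coefXn mcoeffZ mcoeffX.
have -> : (k == mnmwiden m + U_(ord_max) *+ i)%MM =
   ([multinom k (widen_ord (leqnSn n) j) | j < n]%MM == m) && (i == k ord_max).
  apply/eqP/andP => [->|[/eqP <- /eqP ->]]; last by rewrite mnm_split.
  split.
    apply/eqP/mnmP => j; rewrite mnmE mnmDE mnmwiden_widen mulmnE mnm1E.
    have -> : (ord_max == widen_ord (leqnSn n) j) = false.
      by apply/eqP => /(congr1 val) /= E; move: (ltn_ord j); rewrite -E ltnn.
    by rewrite mul0n addn0.
  by rewrite mnmDE mnmwiden_ordmax mulmnE mnm1E eqxx mul1n.
case: (i == k ord_max); rewrite ?mulr0 ?mulr1 ?andbT ?andbF ?mcoeff0 ?mulr0 //.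
  by rewrite mcoeffZ mcoeffX.
Qed.

Lemma meval_multi (a : 'I_n -> R) b (v : 'I_n.+1 -> R) q :
  (forall i, v (widen_ord (leqnSn n) i) = a i) -> v ord_max = b ->
  (multi q).@[v] = (map_poly (meval a) q).[b].
Proof.
move=> va vb; rewrite -(coefK q) poly_def.
rewrite multi_sum raddf_sum [in RHS]rmorph_sum horner_sum /=.
apply: eq_bigr => i _.
rewrite -mul_polyC multiM multiC multiX !rmorphM !rmorphXn /= mevalXU vb.
rewrite map_polyC map_polyX hornerM hornerC hornerXn /=; congr (_ * _).
set p := q`_i; rewrite [X in mwiden X](mpolyE p) [X in X.@[a]](mpolyE p).
rewrite (raddf_sum (@mwiden n R)) !(raddf_sum (meval _)) /=.
apply: eq_bigr => m _; rewrite mwidenZ mwidenX !mevalZ !mevalX.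
rewrite big_ord_recr /= mnmwiden_ordmax expr0 mulr1; congr (_ * _).
by apply: eq_bigr => j _; rewrite mnmwiden_widen va.
Qed.

End Univariate.

Section HomogeneousParts.

Variables (n : nat) (R : comNzRingType).
Implicit Types p q : {mpoly R[n]}.

Lemma mcoeff_pihomog d p m :
  (pihomog mdeg d p)@_m = if mdeg m == d then p@_m else 0.
Proof.
rewrite pihomogE raddf_sum /= [in RHS](mpolyE p) raddf_sum /=.
rewrite big_mkcond /=.
case: ifP => md.
  apply: eq_bigr => k _; case: ifP => // kd; rewrite mcoeffZ mcoeffX.
  by case: eqP => [km|]; [rewrite km md in kd | rewrite mulr0].
apply: big1 => k _; case: ifP => // kd; rewrite mcoeffZ mcoeffX.
by case: eqP => [km|]; [rewrite -km kd in md | rewrite mulr0].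
Qed.

Lemma pihomog_mulr d k p q : q \is k.-homog ->
  pihomog mdeg (d + k) (p * q) = pihomog mdeg d p * q.
Proof.
move=> qk; have := pihomog_partitionE (leqnn (msize p)) => E.
rewrite {1}E mulr_suml raddf_sum /=.
have E' (i : 'I_(msize p)) : pihomog mdeg (d + k) (pihomog mdeg i p * q) =
    if val i == d then pihomog mdeg d p * q else 0.
  case: eqP => [->|/eqP ne].
    by apply: pihomog_dE; apply: dhomogM => //; apply: pihomogP.
  apply: (@pihomog_ne0 _ _ _ (i + k)%N); first by rewrite eqn_add2r.
  by apply: dhomogM => //; apply: pihomogP.
rewrite (eq_bigr _ (fun i _ => E' i)) -big_mkcond /=.
case: (ltnP d (msize p)) => dp; first by rewrite (big_pred1 (Ordinal dp)).
rewrite big_pred0; last first.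
  by move=> i; apply/negbTE; rewrite neq_ltn (leq_trans (ltn_ord i) dp).
have -> : pihomog mdeg d p = 0; last by rewrite mul0r.
apply/mpolyP => m; rewrite mcoeff_pihomog mcoeff0; case: eqP => // md.
by apply/eqP; rewrite mcoeff_eq0 msize_mdeg_ge // md.
Qed.

Lemma pihomog_mulr_lt d k p q : q \is k.-homog -> (d < k)%N ->
  pihomog mdeg d (p * q) = 0.
Proof.
move=> qk dk; have := pihomog_partitionE (leqnn (msize p)) => E.
rewrite {1}E mulr_suml raddf_sum /=; apply: big1 => i _.
apply: (@pihomog_ne0 _ _ _ (i + k)%N).
  by rewrite gtn_eqF // (leq_trans dk) // leq_addl.
by apply: dhomogM => //; apply: pihomogP.
Qed.

End HomogeneousParts.

Lemma mdeg_mnmwiden n (m : 'X_{1..n}) : mdeg (mnmwiden m) = mdeg m.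
Proof.
rewrite !mdegE big_ord_recr /= mnmwiden_ordmax addn0.
by apply: eq_bigr => i _; rewrite mnmwiden_widen.
Qed.

Lemma pihomog_mwiden n (R : comNzRingType) d (p : {mpoly R[n]}) :
  pihomog mdeg d (mwiden p) = mwiden (pihomog mdeg d p).
Proof.
rewrite [in RHS]pihomogE [in LHS](mpolyE p) !(raddf_sum (@mwiden n R)) raddf_sum /=.
rewrite [in RHS]big_mkcond /=.
apply: eq_bigr => m _; rewrite mwidenZ mwidenX linearZ_LR /= pihomogX /=.
rewrite mdeg_mnmwiden.
by case: ifP => _; rewrite ?scaler0.
Qed.

Record homog_ideal (K : fieldType) n (I : {mpoly K[n]} -> Prop) : Prop := {
  hideal0 : I 0;
  hidealD : forall p q, I p -> I q -> I (p + q);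
  hidealM : forall p q, I q -> I (p * q);
  hidealH : forall d p, I p -> I (pihomog mdeg d p) }.

Section Ideal.

Variables (R : comNzRingType) (J : R -> Prop).
Hypotheses (J0 : J 0) (JD : forall p q, J p -> J q -> J (p + q)).
Hypothesis (JM : forall p q, J q -> J (p * q)).

Lemma ideal_sum (T : Type) (r : seq T) (P : pred T) (F : T -> R) :
  (forall i, P i -> J (F i)) -> J (\sum_(i <- r | P i) F i).
Proof. by move=> JF; apply: (big_ind J). Qed.

Definition in_radical p := exists k, J (p ^+ k).

Lemma in_radicalD p q : in_radical p -> in_radical q -> in_radical (p + q).
Proof.
move=> [k Jk] [l Jl]; exists (k + l)%N; rewrite exprDn; apply: ideal_sum => i _.
rewrite -mulr_natl; apply: JM.
case: (leqP k (k + l - i)%N) => ik.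
  by rewrite -(subnK ik) exprD mulrAC; apply: JM.
have li : (l <= i)%N.
  rewrite leqNgt; apply/negP => il; move: ik; rewrite ltnNge -addnBA ?leq_addr //.
  exact: ltnW.
by rewrite -(subnK li) exprD mulrA; apply: JM.
Qed.

Lemma in_radicalM p q : in_radical q -> in_radical (p * q).
Proof. by move=> [k Jk]; exists k; rewrite exprMn; apply: JM. Qed.

Lemma in_radical0 : in_radical 0.
Proof. by exists 1%N; rewrite expr1. Qed.

Lemma in_radical_exp p k : in_radical (p ^+ k) -> in_radical p.
Proof. by move=> [l Jl]; exists (k * l)%N; rewrite exprM. Qed.

End Ideal.

Lemma in_radical_sum (R : comNzRingType) (J : R -> Prop) (J0 : J 0)
    (JD : forall p q, J p -> J q -> J (p + q))
    (JM : forall p q, J q -> J (p * q))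
    (T : Type) (r : seq T) (P : pred T) (F : T -> R) :
  (forall i, P i -> in_radical J (F i)) -> in_radical J (\sum_(i <- r | P i) F i).
Proof.
move=> JF; apply: (big_ind (in_radical J)) => //; first exact: in_radical0.
by move=> x y; apply: in_radicalD.
Qed.

(** Division with remainder: a nonzero element of least size divides the whole ideal, and being no
    unit it has a root. *)
Lemma poly_ideal_root (K : closedFieldType) (L : {poly K} -> Prop) (h0 : {poly K}) :
  (forall p q, L p -> L q -> L (p + q)) ->
  (forall p q, L q -> L (p * q)) -> L h0 -> h0 != 0 -> ~ L 1 ->
  exists b, forall h, L h -> h.[b] = 0.
Proof.
move=> LD LM + + L1; have [m] := ubnP (size h0).
elim: m h0 => [//|m IH] h; rewrite ltnS => sh Lh hn0.
case: (classic (exists h', L h' /\ h' %% h != 0)) => [[h' [Lh' nz]]|nd].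
  apply: (IH (h' %% h)) => //; last first.
    have -> : h' %% h = h' + (- (h' %/ h)) * h.
      by rewrite {2}(divp_eq h' h) mulNr addrAC subrr add0r.
    by apply: LD => //; apply: LM.
  by rewrite (leq_trans _ sh) // ltn_modp.
have dv h' : L h' -> h %| h'.
  move=> Lh'; rewrite /dvdp; apply/eqP; apply: NNPP => /eqP nz.
  by apply: nd; exists h'.
have sh1 : size h != 1%N.
  apply/negP => /size_poly1P [c cn0 hc]; apply: L1.
  have -> : (1 : {poly K}) = c^-1%:P * h by rewrite hc -polyCM mulVf.
  exact: LM.
have [b rb] := closed_rootP h sh1.
exists b => h' /dv /dvdpP [q ->].
by rewrite hornerM (eqP rb) mulr0.
Qed.

Section ProjectiveNullstellensatz.

Variable K : closedFieldType.

(* If q = 1 at a, then modulo (g, q) multiplication by 1 - q is the identity of   *)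
(* the free module with basis 1, X, ..., X^(d-1); its matrix B vanishes at a, so  *)
(* det (1 - B) is in the ideal and takes the value 1 at a.                        *)
Lemma monic_ideal_contraction n (J : {poly {mpoly K[n]}} -> Prop)
    (a : 'I_n -> K) g q :
  J 0 -> (forall p q, J p -> J q -> J (p + q)) ->
  (forall p q, J q -> J (p * q)) ->
  g \is monic -> J g -> J q -> map_poly (meval a) q = 1 ->
  exists c, J c%:P /\ c.@[a] = 1.
Proof.
move=> J0 JD JM gm Jg Jq q1.
case E : (size g).-1 => [|d].
  have sg : size g = 1%N.
    by rewrite -E prednK // lt0n size_poly_eq0 monic_neq0.
  exists 1; rewrite meval1; split=> //.
  have /eqP/size_poly1P [c _ gc] := sg; move: gm; rewrite gc monicE lead_coefC.
  by move=> /eqP c1; rewrite -c1 -gc.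
have sg : size g = d.+2.
  by rewrite -E prednK // lt0n size_poly_eq0 monic_neq0.
pose r (i : 'I_d.+1) := Pdiv.Ring.rmodp ('X^i * (1 - q)) g.
pose s (i : 'I_d.+1) := Pdiv.Ring.rdivp ('X^i * (1 - q)) g.
have rE (i : 'I_d.+1) : 'X^i * (1 - q) = s i * g + r i by apply: Pdiv.RingMonic.rdivp_eq.
have sr (i : 'I_d.+1) : (size (r i) <= d.+1)%N.
  by rewrite -ltnS -sg Pdiv.Ring.ltn_rmodpN0 // monic_neq0.
pose B : 'M[{mpoly K[n]}]_d.+1 := \matrix_(i, j) (r i)`_j.
(* At a, where q = 1, the division reads 0 = s g + r with g still monic of degree d + 1; comparing
   degrees gives s = 0, then r = 0. *)
have ra (i : 'I_d.+1) : map_poly (meval a) (r i) = 0.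
  have := congr1 (map_poly (meval a)) (rE i).
  rewrite rmorphM rmorphB rmorph1 /= q1 subrr mulr0 rmorphD rmorphM /=.
  move/eqP; rewrite eq_sym addr_eq0 => /eqP E1.
  have gam : map_poly (meval a) g \is monic by apply: monic_map.
  apply/eqP; rewrite -oppr_eq0 -E1; apply/eqP.
  case: (eqVneq (map_poly (meval a) (s i)) 0) => [->|nz]; first by rewrite mul0r.
  have := congr1 (fun p : {poly K} => size p) E1; rewrite size_Mmonic // size_polyN.
  have -> : size (map_poly (meval a) g) = d.+2.
    by rewrite size_map_poly_id0 ?sg // (monicP gm) rmorph1 oner_neq0.
  rewrite addnS /= => E2.
  have : (size (map_poly (meval a) (r i)) <= d.+1)%N.
    by apply: leq_trans (size_poly _ _) (sr i).
  by rewrite -E2 -[X in (_ <= X)%N]add0n leq_add2r leqn0 size_poly_eq0 (negbTE nz).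
exists (\det (1%:M - B)); split; last first.
  rewrite -det_map_mx map_mxB map_mx1.
  have -> : map_mx (meval a) B = 0.
    apply/matrixP => i j; rewrite !mxE.
    by have := congr1 (fun p : {poly K} => p`_j) (ra i); rewrite coef_map coef0.
  by rewrite subr0 det1.
pose C : 'M[{poly {mpoly K[n]}}]_d.+1 := map_mx polyC (1%:M - B).
have JC (i : 'I_d.+1) : J (\sum_j C i j * 'X^j).
  have -> : \sum_j C i j * 'X^j = 'X^i * q + s i * g.
    have -> : \sum_j C i j * 'X^j = 'X^i - r i.
      under eq_bigr do rewrite !mxE polyCB mulrBl.
      rewrite sumrB; congr (_ - _).
        rewrite (bigD1 i) //= eqxx mul1r big1 ?addr0 // => j ji.
        by rewrite eq_sym (negbTE ji) mul0r.
      have rp : r i = \poly_(j < d.+1) (r i)`_j.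
        apply/polyP => j; rewrite coef_poly; case: ltnP => // dj.
        by rewrite nth_default // (leq_trans (sr i)).
      rewrite [RHS]rp poly_def; apply: eq_bigr => j _.
      by rewrite mul_polyC.
    by apply/eqP; rewrite subr_eq -addrA -rE mulrBr mulr1 addrC subrK.
  by apply: JD; apply: JM.
(* Cramer's rule: the first row of adj(C) C, paired with the column of powers of X, is det(C) times
   1. *)
have -> : (\det (1%:M - B))%:P = \sum_j (\adj C) ord0 j * \sum_(k < d.+1) C j k * 'X^k.
  have := mul_adj_mx C; move/(congr1 (fun M : 'M_d.+1 =>
    \sum_(k < d.+1) M ord0 k * 'X^k)).
  rewrite /= [RHS](bigD1 ord0) //= [X in _ = _ + X]big1 => [|k k0]; last first.
    by rewrite !mxE eq_sym (negbTE k0) mulr0n mul0r.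
  rewrite addr0 [X in _ = X * _]mxE eqxx mulr1n expr0 mulr1 det_map_mx => <-.
  under eq_bigr do rewrite !mxE mulr_suml.
  rewrite exchange_big /=; apply: eq_bigr => j _.
  by rewrite mulr_sumr; apply: eq_bigr => k _; rewrite mulrA.
by apply: (ideal_sum J0 JD) => j _; apply: JM.
Qed.

(** The coefficient of the i-th power of the last variable is a form of degree d - i: a constant for
    i = d, and 0 beyond. *)
Lemma homog_monic n (f : {mpoly K[n.+1]}) d :
  f \is d.-homog -> f@_(U_(ord_max) *+ d)%MM = 1 -> muni f \is monic.
Proof.
move=> fd f1.
have cE i m : ((muni f)`_i)@_m = if (mdeg m + i == d)%N then
     f@_(mnmwiden m + U_(ord_max) *+ i)%MM else 0.
  rewrite coef_muni; case: eqP => // /eqP ne; apply: dhomog_nemf_coeff fd _.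
  by rewrite /= mdegD mdeg_mnmwiden mdegMn mdeg1 mul1n.
have c0 i : (d < i)%N -> (muni f)`_i = 0.
  move=> di; apply/mpolyP => m; rewrite cE mcoeff0 gtn_eqF //.
  by rewrite (leq_trans di) // leq_addl.
have cd : (muni f)`_d = 1.
  apply/mpolyP => m; rewrite cE -[X in _ == X]add0n eqn_add2r mdeg_eq0 mcoeff1.
  case: eqP => // ->; rewrite -f1; congr (_@__); apply/mnmP => i.
  by rewrite mnmDE mnmwiden0 mnm0E.
have sz : size (muni f) = d.+1.
  apply/eqP; rewrite eqn_leq; apply/andP; split.
    by apply/leq_sizeP => i; apply: c0.
  by rewrite ltnNge; apply/negP => /leq_sizeP /(_ d (leqnn d)) /eqP; rewrite cd oner_eq0.
by rewrite monicE lead_coefE sz /= cd.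
Qed.

Lemma meval_last_point n d (f : {mpoly K[n.+1]}) : f \is d.-homog ->
  f.@[fun i => (i == ord_max)%:R] = f@_(U_(ord_max) *+ d)%MM.
Proof.
move=> fd; rewrite {1}(mpolyE f) [in RHS](mpolyE f) !raddf_sum /=.
apply: eq_big_seq => m mf; rewrite mevalZ mcoeffZ mevalX mcoeffX; congr (_ * _).
have md : mdeg m = d by move/dhomogP: fd; apply.
case: eqP => [->|ne].
  rewrite big1 // => i _; rewrite mulmnE mnm1E eq_sym.
  by case: eqP => _; rewrite ?expr1n // mul0n expr0.
apply/eqP/prodf_eq0; apply: NNPP => nz; apply: ne.
have z (i : 'I_n.+1) : i != ord_max -> m i = 0%N.
  move=> io; apply/eqP; rewrite -leqn0 leqNgt; apply/negP => mi; apply: nz.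
  by exists i => //; rewrite (negbTE io) expr0n eqn0Ngt mi.
apply/mnmP => i; rewrite mulmnE mnm1E eq_sym; case: (eqVneq i ord_max) => [->|/z -> //].
rewrite mul1n -md mdegE (bigD1 ord_max) //= big1 ?addn0 // => j /z ->.
Qed.

(* Projection from the point (0, ..., 0, 1), which is not a common zero: the      *)
(* ideal contains a form monic in the last variable.                              *)
Theorem projective_nullstellensatz n (I : {mpoly K[n]} -> Prop) :
  homog_ideal I ->
  (forall v : 'I_n -> K, (forall p, I p -> p.@[v] = 0) -> forall i, v i = 0) ->
  forall i, exists k, I ('X_i ^+ k).
Proof.
elim: n I => [|n IH] I hI noz; first by case.
have [I0 ID IM IH'] := hI.
have [f [d [If fd f1]]] : exists f d, [/\ I f, f \is d.-homog &
    f@_(U_(ord_max) *+ d)%MM = 1].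
  pose v (i : 'I_n.+1) : K := (i == ord_max)%:R.
  have [p [Ip pv]] : exists p, I p /\ p.@[v] != 0.
    apply: NNPP => nex.
    have /noz /(_ ord_max) /eqP : forall p, I p -> p.@[v] = 0.
      by move=> p Ip; apply/eqP; apply/negP => /negP nz; apply: nex; exists p.
    by rewrite /v eqxx oner_eq0.
  have [d dv] : exists d, (pihomog mdeg d p).@[v] != 0.
    apply: NNPP => nex; move/eqP: pv; apply.
    rewrite (pihomog_partitionE (leqnn (msize p))) raddf_sum /=.
    apply: big1 => d _; apply/eqP; apply/negP => /negP nz; apply: nex.
    by exists (val d).
  exists ((pihomog mdeg d p).@[v]^-1 *: pihomog mdeg d p), d; split.
  - by rewrite -mul_mpolyC; apply: IM; apply: IH'.
  - by apply: dhomogZ; apply: pihomogP.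
  - by rewrite mcoeffZ -meval_last_point ?pihomogP // mulVf.
pose J q := I (multi q).
have J0 : J 0 by rewrite /J multi0.
have JD p q : J p -> J q -> J (p + q) by rewrite /J multi_is_additive; apply: ID.
have JM p q : J q -> J (p * q) by rewrite /J multiM; apply: IM.
pose I' (p : {mpoly K[n]}) := I (mwiden p).
have hI' : homog_ideal I'.
  split; rewrite /I'.
  - by rewrite mwiden0.
  - by move=> p q; rewrite mwidenD; apply: ID.
  - by move=> p q; rewrite mwidenM; apply: IM.
  - by move=> k p; rewrite -pihomog_mwiden; apply: IH'.
pose g := muni f.
have gm : g \is monic by apply: homog_monic fd f1.
have Jg : J g by rewrite /J /g muniK.
have radn (i : 'I_n) : in_radical I 'X_(widen_ord (leqnSn n) i).
  suff [k Ik] : exists k, I' ('X_i ^+ k).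
    exists k; move: Ik; rewrite /I' rmorphXn /=.
    by rewrite mwidenX mnmwiden1.
  (* A zero a of I' extends to a zero (a, b) of I, with b a common root of the specializations at a.
     If these contained 1, [monic_ideal_contraction] would put into I' an element of value 1 at
     a. *)
  apply: IH => // a za j.
  pose L h := exists q, J q /\ map_poly (meval a) q = h.
  have [b rb] : exists b, forall h, L h -> h.[b] = 0.
    apply: (@poly_ideal_root _ _ (map_poly (meval a) g)).
    - move=> _ _ [p [Jp <-]] [q [Jq <-]]; exists (p + q); split; first exact: JD.
      by rewrite rmorphD.
    - move=> h _ [q [Jq <-]]; exists (map_poly (@mpolyC n K) h * q).
      split; first exact: JM.
      rewrite rmorphM /= -map_poly_comp; congr (_ * _).
      by apply: map_poly_id => x _; rewrite /= mevalC.
    - by exists g.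
    - by rewrite monic_neq0 // monic_map.
    move=> [q [Jq q1]].
    have [c [Jc ca]] := monic_ideal_contraction J0 JD JM gm Jg Jq q1.
    have /za : I' c by move: Jc; rewrite /J multiC.
    by move/eqP; rewrite ca oner_eq0.
  pose v (i : 'I_n.+1) := if unlift ord_max i is Some k then a k else b.
  have vw k : v (widen_ord (leqnSn n) k) = a k.
    have -> : widen_ord (leqnSn n) k = lift ord_max k.
      by apply: val_inj; rewrite -[RHS]/(val (lift _ _)); symmetry; exact: lift_max.
    by rewrite /v liftK.
  have vb : v ord_max = b by rewrite /v unlift_none.
  rewrite -vw; apply: noz => p Ip.
  rewrite -(muniK p) (meval_multi (muni p) vw vb); apply: rb.
  exists (muni p); split; last by [].
  by rewrite /J muniK.
have radC (p : {mpoly K[n]}) : p@_0%MM = 0 -> in_radical I (mwiden p).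
  move=> p0; rewrite (mpolyE p) raddf_sum /= big_seq.
  apply: in_radical_sum => // m mp.
  have m0 : m != 0%MM by apply: contraTneq mp => ->; rewrite mcoeff_msupp p0 eqxx.
  have [i mi] : exists i, (0 < m i)%N.
    apply: NNPP => nex; move/eqP: m0; apply; apply/mnmP => i; rewrite mnm0E.
    by apply/eqP; rewrite -leqn0 leqNgt; apply/negP => mi; apply: nex; exists i.
  have -> : m = ((m - U_(i)) + U_(i))%MM by rewrite submK // lep1mP -lt0n.
  rewrite mpolyXD mwidenZ mwidenM -mul_mpolyC mulrA.
  by apply: in_radicalM => //; rewrite mwidenX mnmwiden1.
have sg : size g = d.+1.
  apply/eqP; rewrite eqn_leq; apply/andP; split.
    apply/leq_sizeP => i di; apply/mpolyP => m; rewrite coef_muni mcoeff0.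
    apply: dhomog_nemf_coeff fd _ => /=.
    by rewrite mdegD mdegMn mdeg1 mul1n gtn_eqF // (leq_trans di) // leq_addl.
  rewrite ltnNge; apply/negP => /leq_sizeP /(_ d (leqnn d)) /mpolyP /(_ 0%MM).
  move/eqP; rewrite coef_muni mcoeff0 mnmwiden0 add0m f1 oner_eq0 //.
(* The monic form f expresses the d-th power of the last variable through coefficients of positive
   degree in the others, which lie in the radical by [radC]. *)
have radmax : in_radical I 'X_ord_max.
  apply: (@in_radical_exp _ _ _ d).
  have -> : 'X_ord_max ^+ d = multi g + - \sum_(i < d) mwiden g`_i * 'X_ord_max ^+ i.
    have -> : multi g = \sum_(i < d) mwiden g`_i * 'X_ord_max ^+ i + 'X_ord_max ^+ d.
      rewrite {1}(_ : g = \sum_(i < d.+1) g`_i *: 'X^i); last first.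
        by rewrite -poly_def -sg coefK.
      rewrite multi_sum big_ord_recr /=.
      have -> : g`_d = 1 by have /monicP := gm; rewrite lead_coefE sg.
      rewrite scale1r multiX; congr (_ + _); apply: eq_bigr => i _.
      by rewrite -mul_polyC multiM multiC multiX.
    by rewrite addrC addKr.
  apply: in_radicalD => //; first by exists 1%N; rewrite expr1.
  rewrite -mulN1r; apply: in_radicalM => //; apply: in_radical_sum => // i _.
  rewrite mulrC; apply: in_radicalM => //; apply: radC.
  rewrite coef_muni mnmwiden0 add0m; apply: dhomog_nemf_coeff fd _ => /=.
  by rewrite mdegMn mdeg1 mul1n ltn_eqF.
move=> i; case: (unliftP ord_max i) => [j ->|-> //].
have -> : lift ord_max j = widen_ord (leqnSn n) j; last exact: radn.
by apply: val_inj; exact: lift_max.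
Qed.

End ProjectiveNullstellensatz.

(** * Polynomial functions and elimination *)

Section PolynomialFunctions.

Variables (K : closedFieldType) (V : vectType K).

Definition polyfun (phi : V -> K) := exists P : {mpoly K[\dim {:V}]},
  forall v, phi v = P.@[fun i => coord (vbasis {:V}) i v].

Lemma polyfun_eq phi psi : phi =1 psi -> polyfun phi -> polyfun psi.
Proof. by move=> e [P h]; exists P => v; rewrite -e. Qed.

Lemma polyfunC c : polyfun (fun=> c).
Proof. by exists c%:MP => v; rewrite mevalC. Qed.

Lemma polyfunD phi psi : polyfun phi -> polyfun psi ->
  polyfun (fun v => phi v + psi v).
Proof. by move=> [P h] [Q k]; exists (P + Q) => v; rewrite mevalD h k. Qed.

Lemma polyfunM phi psi : polyfun phi -> polyfun psi ->
  polyfun (fun v => phi v * psi v).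
Proof. by move=> [P h] [Q k]; exists (P * Q) => v; rewrite mevalM h k. Qed.

Lemma polyfun_sum (T : Type) (r : seq T) (P : pred T) (phi : T -> V -> K) :
  (forall t, polyfun (phi t)) -> polyfun (fun v => \sum_(t <- r | P t) phi t v).
Proof.
move=> h; elim: r => [|t r IH].
  by apply: polyfun_eq (polyfunC 0) => v; rewrite big_nil.
have [Pt|Pt] := boolP (P t).
  by apply: polyfun_eq (polyfunD (h t) IH) => v; rewrite big_cons Pt.
by apply: polyfun_eq IH => v; rewrite big_cons (negbTE Pt).
Qed.

Lemma polyfun_prod (T : Type) (r : seq T) (P : pred T) (phi : T -> V -> K) :
  (forall t, polyfun (phi t)) -> polyfun (fun v => \prod_(t <- r | P t) phi t v).
Proof.
move=> h; elim: r => [|t r IH].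
  by apply: polyfun_eq (polyfunC 1) => v; rewrite big_nil.
have [Pt|Pt] := boolP (P t).
  by apply: polyfun_eq (polyfunM (h t) IH) => v; rewrite big_cons Pt.
by apply: polyfun_eq IH => v; rewrite big_cons (negbTE Pt).
Qed.

Lemma polyfun_det m (A : V -> 'M[K]_m) : (forall i j, polyfun (fun v => A v i j)) ->
  polyfun (fun v => \det (A v)).
Proof.
move=> h; rewrite /determinant; apply: polyfun_sum => s.
by apply: polyfunM (polyfunC _) _; apply: polyfun_prod.
Qed.

Lemma polyfun_linear (phi : V -> K) :
  (forall a u v, phi (a *: u + v) = a * phi u + phi v) -> polyfun phi.
Proof.
move=> lin; pose c i := phi (vbasis {:V})`_i.
have phi0 : phi 0 = 0.
  have := lin 1 0 0; rewrite scale1r addr0 mul1r => /eqP.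
  by rewrite -subr_eq subrr eq_sym => /eqP.
have h v : phi v = \sum_i coord (vbasis {:V}) i v * c i.
  rewrite {1}(coord_vbasis (memvf v)).
  elim/big_rec2: _ => [//|i x y _ <-]; exact: lin.
exists (\sum_(i < \dim {:V}) c i *: 'X_i) => v; rewrite h raddf_sum /=.
by apply: eq_bigr => i _; rewrite mevalZ mevalXU mulrC.
Qed.

End PolynomialFunctions.

Section Elimination.

Variables (K : closedFieldType) (V : vectType K) (M : nat) (T : finType).
Variables (Q : T -> V -> {mpoly K[M]}) (deg : T -> nat).
Hypothesis Qhom : forall t v, Q t v \is (deg t).-homog.
Hypothesis Qpoly : forall t m, polyfun (fun v => (Q t v)@_m).

Lemma polyfun_coef_mul (p : {mpoly K[M]}) t m :
  polyfun (fun v => (p * Q t v)@_m).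
Proof.
apply: (@polyfun_eq _ _ (fun v => \sum_(k : 'X_{1..M < (mdeg m).+1, (mdeg m).+1} |
    m == (k.1 + k.2)%MM) p@_k.1 * (Q t v)@_k.2)).
  by move=> v; rewrite mcoeffM.
by apply: polyfun_sum => k; apply: polyfunM (polyfunC _ _) (Qpoly _ _).
Qed.

Lemma homog_ideal_span v : homog_ideal (fun p => exists h : T -> {mpoly K[M]},
  p = \sum_t h t * Q t v).
Proof.
split.
- by exists (fun=> 0); rewrite big1 // => t _; rewrite mul0r.
- move=> _ _ [h ->] [k ->]; exists (fun t => h t + k t).
  by rewrite -big_split; apply: eq_bigr => t _; rewrite mulrDl.
- move=> p _ [h ->]; exists (fun t => p * h t).
  by rewrite mulr_sumr; apply: eq_bigr => t _; rewrite mulrA.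
- move=> d _ [h ->]; exists (fun t => if (deg t <= d)%N then
    pihomog mdeg (d - deg t) (h t) else 0).
  rewrite raddf_sum /=; apply: eq_bigr => t _; case: leqP => td.
    by rewrite -{1}(subnK td) pihomog_mulr.
  by rewrite mul0r (pihomog_mulr_lt _ (Qhom t v)).
Qed.

(* When the only common zero at v0 is trivial, every monomial mu of some degree D *)
(* is a combination of the forms Q t v0.  The same combinations of the Q t v      *)
(* express the monomials of degree D through a matrix A v with A v0 = 1, and      *)
(* there is no nontrivial zero at v as long as det (A v) <> 0.                    *)
Lemma elimination v0 :
  (forall y : 'I_M -> K, (forall t, (Q t v0).@[y] = 0) -> forall i, y i = 0) ->
  exists Delta, [/\ polyfun Delta, Delta v0 != 0 & forall v, Delta v != 0 ->
    forall y : 'I_M -> K, (forall t, (Q t v).@[y] = 0) -> forall i, y i = 0].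
Proof.
move=> noz; have [M0|Mpos] := posnP M.
  exists (fun=> 1); split; [exact: polyfunC | exact: oner_neq0 |].
  by move=> v _ y _ i; have := ltn_ord i; rewrite [X in (_ < X)%N]M0.
pose I p := exists h : T -> {mpoly K[M]}, p = \sum_t h t * Q t v0.
have hI : homog_ideal I := homog_ideal_span v0.
have [k Ik] : exists k, forall i, I ('X_i ^+ k).
  have /fin_all_exists [k Ik] : forall i : 'I_M, exists k, I ('X_i ^+ k).
    apply: projective_nullstellensatz hI _ => y zy; apply: noz => t; apply: zy.
    exists (fun t' => (t' == t)%:R).
    rewrite (bigD1 t) //= eqxx mul1r big1 ?addr0 // => j /negbTE ->.
    by rewrite mul0r.
  exists (\max_i k i)%N => i; rewrite -(subnK (leq_bigmax i)) exprD.
  exact: (hidealM hI).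
(* A monomial of degree M k in M variables has an exponent at least k. *)
pose D := (M * k)%N.
have /fin_all_exists [h Ph] : forall mu : 'X_{1..M < D.+1},
    exists h : T -> {mpoly K[M]}, mdeg mu = D ->
    'X_[mu] = \sum_t h t * Q t v0 /\
    forall t v, h t * Q t v \is D.-homog.
  move=> mu; case: (eqVneq (mdeg mu) D) => [muD|]; last first.
    by move=> /eqP ne; exists (fun=> 0) => e; case: ne.
  have [i ki] : exists i, (k <= mu i)%N.
    apply: NNPP => nex.
    have : (mdeg mu < M * k)%N.
      rewrite mdegE -[X in (X * _)%N]card_ord -sum_nat_const.
      have lt i : (mu i < k)%N.
        by rewrite ltnNge; apply/negP => ki; apply: nex; exists i.
      rewrite (bigD1 (Ordinal Mpos)) //= [X in (_ < X)%N](bigD1 (Ordinal Mpos)) //=.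
      by rewrite -addSn leq_add ?lt // leq_sum // => i _; apply: ltnW.
    by rewrite muD ltnn.
  have [h0 E] : I 'X_[mu].
    have -> : bmnm mu = ((mu - U_(i) *+ k) + U_(i) *+ k)%MM.
      rewrite submK //; apply/mnm_lepP => j; rewrite mulmnE mnm1E.
      by case: eqP => [<-|_]; rewrite ?mul1n ?mul0n.
    rewrite mpolyXD -mpolyXn; exact: (hidealM hI).
  (* Keeping only the components of degree D - deg t preserves the identity at v0 and makes h t * Q
     t v a form of degree D for every v. *)
  exists (fun t => if (deg t <= D)%N then
    pihomog mdeg (D - deg t) (h0 t) else 0) => _; split.
    have hX : ('X_[mu] : {mpoly K[M]}) \is D.-homog.
      by rewrite dhomogX /= muD.
    rewrite -[LHS](pihomog_dE hX) E raddf_sum /=.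
    apply: eq_bigr => t _; case: leqP => td.
      by rewrite -{1}(subnK td) pihomog_mulr.
    by rewrite mul0r (pihomog_mulr_lt _ (Qhom t v0)).
  move=> t v; case: leqP => td; last by rewrite mul0r rpred0.
  by rewrite -[X in _ \is X.-homog](subnK td); apply: dhomogM => //; apply: pihomogP.
pose G (mu : 'X_{1..M < D.+1}) v := \sum_t h mu t * Q t v.
pose bm (i : 'I_#|{: 'X_{1..M < D.+1}}|) := enum_val i : 'X_{1..M < D.+1}.
(* Monomials of degree other than D get rows of the identity, so that A v is square on all monomials
   of degree at most D. *)
pose A v := \matrix_(i, j) (if mdeg (bm i) == D then (G (bm i) v)@_(bm j)
                            else (i == j)%:R).
exists (fun v => \det (A v)); split.
- apply: polyfun_det => i j; case E: (mdeg (bm i) == D).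
    apply: (@polyfun_eq _ _ (fun v => \sum_t (h (bm i) t * Q t v)@_(bm j))).
      by move=> v; rewrite mxE E raddf_sum.
    by apply: polyfun_sum => t; apply: polyfun_coef_mul.
  by apply: polyfun_eq (polyfunC _ (i == j)%:R) => v; rewrite mxE E.
- suff -> : A v0 = 1%:M by rewrite det1 oner_neq0.
  apply/matrixP => i j; rewrite !mxE; case: eqP => // /Ph [E _].
  rewrite /G -E mcoeffX -[i == j](inj_eq enum_val_inj) -/(bm i) -/(bm j).
  by rewrite bmeqP.
move=> v dn0 y zy i.
pose u := \col_j (if mdeg (bm j) == D then ('X_[bm j] : {mpoly K[M]}).@[y] else 0).
have Au : A v *m u = 0.
  apply/matrixP => a b; rewrite [RHS]mxE mxE.
  have [aD|aD] := eqVneq (mdeg (bm a)) D; last first.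
    apply: big1 => j _; rewrite !mxE (negbTE aD); case: eqP => [<-|_].
      by rewrite (negbTE aD) mulr0.
    by rewrite mul0r.
  have [_ Ghom] := Ph _ aD.
  transitivity ((G (bm a) v).@[y]); last first.
    rewrite /G raddf_sum big1 // => t _ /=.
    by rewrite mevalM zy mulr0.
  have Gd : G (bm a) v \is D.-homog by apply: rpred_sum => t _; apply: Ghom.
  have Gs : (msize (G (bm a) v) <= D.+1)%N.
    rewrite msizeE; apply/bigmax_leqP_seq => m mG _; rewrite ltnS.
    by move/dhomogP: Gd => /(_ m mG) /= ->.
  rewrite (mpolywE Gs) raddf_sum /= (reindex (fun j => bm j)) /=; last first.
    by exists enum_rank => j _; rewrite /bm ?enum_valK ?enum_rankK.
  apply: eq_bigr => j _; rewrite !mxE aD eqxx mevalZ; case: eqP => // /eqP jD.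
  by rewrite (dhomog_nemf_coeff Gd jD) !mul0r.
have u0 : u = 0.
  have : \det (A v) *: u = 0.
    by rewrite -mul_scalar_mx -mul_adj_mx -mulmxA Au mulmx0.
  by move/eqP; rewrite scaler_eq0 (negbTE dn0) => /eqP.
have muP : (mdeg (U_(i) *+ D)%MM < D.+1)%N by rewrite mdegMn mdeg1 mul1n.
have := congr1 (fun w : 'cV_ _ => w (enum_rank (BMultinom muP)) 0) u0.
rewrite !mxE /bm enum_rankK /= mdegMn mdeg1 mul1n eqxx -mpolyXn rmorphXn /=.
by rewrite mevalXU => /eqP; rewrite expf_eq0 => /andP[_ /eqP].
Qed.

End Elimination.

(** * Pluecker forms annihilated by a family of forms *)

Section Plucker.

Variables (n r : nat).
Implicit Types I J : {ffun 'I_r -> 'I_n}.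

Definition upd I a x : {ffun 'I_r -> 'I_n} :=
  [ffun b => if b == a then x else I b].

Lemma upd_same I a : upd I a (I a) = I.
Proof. by apply/ffunP => b; rewrite ffunE; case: eqP => [->|]. Qed.

(* w stands for a decomposable r-vector, through its coordinates on all r-tuples;  *)
(* being annihilated by f then means lying in the r-th exterior power of ker f.   *)
Definition plucker (S : comNzRingType) (w : {ffun 'I_r -> 'I_n} -> S) :=
  (forall I J a, w I * w J = \sum_k w (upd I a (J k)) * w (upd J k (I a))) /\
  (forall I, ~~ injectiveb I -> w I = 0).

Definition annihilated (S : comNzRingType) (f : 'I_n -> S)
    (w : {ffun 'I_r -> 'I_n} -> S) :=
  forall I a, \sum_i f i * w (upd I a i) = 0.

Definition no_plucker_form (K : closedFieldType) N (f : 'I_n -> {mpoly K[N]}) m :=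
  forall w : {ffun 'I_r -> 'I_n} -> {mpoly K[N]},
    (forall I, w I \is m.-homog) -> plucker w -> annihilated f w ->
    forall I, w I = 0.

End Plucker.

Section CoefficientwiseHomogeneous.

Variables (R : comNzRingType) (M N : nat).
Implicit Types p q : {mpoly {mpoly R[M]}[N]}.

(** The inner variables are the unknown coefficients of w, the outer ones the coordinates of
    projective space; e is the degree in the unknowns. *)
Definition coef_homog e p := forall k, p@_k \is e.-homog.

Lemma coef_homog_sum e (T : Type) (s : seq T) (P : pred T) F :
  (forall t, P t -> coef_homog e (F t)) -> coef_homog e (\sum_(t <- s | P t) F t).
Proof. by move=> h k; rewrite raddf_sum; apply: rpred_sum => t Pt; apply: h. Qed.

Lemma coef_homogM e e' p q :
  coef_homog e p -> coef_homog e' q -> coef_homog (e + e') (p * q).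
Proof.
by move=> hp hq k; rewrite mcoeffM; apply: rpred_sum => l _; apply: dhomogM.
Qed.

Lemma coef_homog_map (p : {mpoly R[N]}) : coef_homog 0 (map_mpoly (@mpolyC M R) p).
Proof.
move=> k; rewrite mcoeff_map_mpoly; apply/dhomogP => m.
by rewrite msuppC; case: ifP => // _; rewrite inE => /eqP ->; exact: mdeg0.
Qed.

End CoefficientwiseHomogeneous.

Lemma homog_eq0 (R : nzRingType) N d (p : {mpoly R[N]}) :
  p \is d.-homog -> (forall m : 'X_{1..N < d.+1}, p@_m = 0) -> p = 0.
Proof.
move=> pd h; apply/mpolyP => m; rewrite mcoeff0.
have [md|md] := eqVneq (mdeg m) d; last exact: dhomog_nemf_coeff pd md.
have mb : (mdeg m < d.+1)%N by rewrite md.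
exact: (h (BMultinom mb)).
Qed.

(** * Nonexistence of Pluecker forms is an open condition on f *)

Section PluckerOpen.

Variables (K : closedFieldType) (N n d r m : nat).
Local Notation B b := 'X_{1..N.+1 < b.+1}.
Local Notation idx := {ffun 'I_r -> 'I_n}.
Local Notation Y := (idx * B m)%type.
Local Notation nY := #|{: Y}|.

Definition unknown (I : idx) (mu : B m) : {mpoly K[nY]} := 'X_(enum_rank (I, mu)).

Definition generic_form (I : idx) : {mpoly {mpoly K[nY]}[N.+1]} :=
  \sum_(mu : B m | mdeg mu == m) unknown I mu *: 'X_[mu].

Definition form_of (y : 'I_nY -> K) (I : idx) : {mpoly K[N.+1]} :=
  \sum_(mu : B m | mdeg mu == m) y (enum_rank (I, mu)) *: 'X_[mu].

Definition plucker_expr (S : comNzRingType) (w : idx -> S) (t : idx * idx * 'I_r) :=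
  let: (A, J, a) := t in
  w A * w J - \sum_k w (upd A a (J k)) * w (upd J k (A a)).

Definition ann_expr (S : comNzRingType) (f : 'I_n -> S) (w : idx -> S)
    (t : idx * 'I_r) :=
  \sum_i f i * w (upd t.1 t.2 i).

Lemma generic_formE y I : map_mpoly (meval y) (generic_form I) = form_of y I.
Proof.
rewrite /generic_form raddf_sum; apply: eq_bigr => mu _ /=.
by rewrite map_mpolyZ map_mpolyX /unknown /= mevalXU.
Qed.

Lemma generic_plucker y t : map_mpoly (meval y) (plucker_expr generic_form t)
  = plucker_expr (form_of y) t.
Proof.
case: t => [[I J] a] /=; rewrite rmorphB rmorphM /= !generic_formE.
congr (_ - _); rewrite (big_morph _ (rmorphD _) (rmorph0 _)).
by apply: eq_bigr => k _; rewrite rmorphM /= !generic_formE.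
Qed.

Lemma generic_ann y (f : 'I_n -> {mpoly K[N.+1]}) t :
  map_mpoly (meval y)
    (ann_expr (fun i => map_mpoly (@mpolyC nY K) (f i)) generic_form t)
  = ann_expr f (form_of y) t.
Proof.
rewrite /ann_expr rmorph_sum /=; apply: eq_bigr => i _.
rewrite rmorphM /= generic_formE; congr (_ * _).
by apply/mpolyP => k; rewrite !mcoeff_map_mpoly /= mevalC.
Qed.

Lemma generic_coef_homog I : coef_homog 1 (generic_form I).
Proof.
apply: coef_homog_sum => mu _ k; rewrite mcoeffZ mcoeffX.
by case: eqP => _; rewrite ?mulr0 ?rpred0 // mulr1 dhomogX /= mdeg1.
Qed.

Lemma form_of_homog y I : form_of y I \is m.-homog.
Proof. by apply: rpred_sum => mu mm; apply: rpredZ; rewrite dhomogX. Qed.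

Lemma plucker_expr_homog (w : idx -> {mpoly K[N.+1]}) t :
  (forall I, w I \is m.-homog) -> plucker_expr w t \is (m + m).-homog.
Proof.
case: t => [[I J] a] h; apply: rpredB; first exact: dhomogM.
by apply: rpred_sum => k _; apply: dhomogM.
Qed.

Lemma ann_expr_homog (f : forms K N n d) (w : idx -> {mpoly K[N.+1]}) t :
  (forall I, w I \is m.-homog) -> ann_expr (Defs.form f) w t \is (d + m).-homog.
Proof.
by move=> h; apply: rpred_sum => i _; apply: dhomogM => //; apply: dhomog_is_dhomog.
Qed.

(** Three groups of equations: coefficients of w that must vanish (repeated index, or monomial of
    degree other than m), Pluecker relations, contraction with f. *)
Definition equation_index : finType :=
  (Y + (idx * idx * 'I_r * B (m + m)) + (idx * 'I_r * B (d + m)))%type.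

Definition equation (t : equation_index) (f : forms K N n d) : {mpoly K[nY]} :=
  match t with
  | inl (inl (A, mu)) =>
      if injectiveb A && (mdeg mu == m) then 0 else unknown A mu
  | inl (inr (s, nu)) => (plucker_expr generic_form s)@_nu
  | inr (s, nu) =>
      (ann_expr (fun i => map_mpoly (@mpolyC nY K) (Defs.form f i)) generic_form s)@_nu
  end.

Definition equation_deg (t : equation_index) : nat :=
  match t with inl (inr _) => 2 | _ => 1 end.

Lemma equation_homog t f : equation t f \is (equation_deg t).-homog.
Proof.
case: t => [[[I mu]|[[[I J] a] nu]]|[s nu]] /=.
- by case: ifP => _; rewrite ?rpred0 // dhomogX /= mdeg1.
- rewrite mcoeffB; apply: rpredB.
    exact: (coef_homogM (generic_coef_homog _) (generic_coef_homog _)).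
  rewrite raddf_sum; apply: rpred_sum => k _.
  exact: (coef_homogM (generic_coef_homog _) (generic_coef_homog _)).
- rewrite raddf_sum; apply: rpred_sum => i _.
  by rewrite -[1%N]add0n; apply: coef_homogM; [apply: coef_homog_map | apply: generic_coef_homog].
Qed.

Lemma equation_polyfun t k : polyfun (fun f => (equation t f)@_k).
Proof.
case: t => [[[I mu]|[s nu]]|[s nu]] /=; try exact: polyfunC.
apply: (@polyfun_eq _ _ (fun f : forms K N n d => \sum_i
   \sum_(l : 'X_{1..N.+1 < (mdeg nu).+1, (mdeg nu).+1} | bmnm nu == (l.1 + l.2)%MM)
     (Defs.form f i)@_l.1 * ((generic_form (upd s.1 s.2 i))@_l.2)@_k)).
  move=> f; rewrite /ann_expr !raddf_sum /=; apply: eq_bigr => i _.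
  rewrite mcoeffM raddf_sum /=; apply: eq_bigr => l _.
  by rewrite mcoeff_map_mpoly mcoeffCM.
do 2!apply: polyfun_sum => ?; apply: polyfunM (polyfunC _ _).
apply: polyfun_linear => a u v.
by rewrite /Defs.form !ffunE /= mcoeffD mcoeffZ.
Qed.

Lemma equation_zero y f : (forall t, (equation t f).@[y] = 0) <->
  [/\ forall (I : idx) (mu : B m), ~~ (injectiveb I && (mdeg mu == m)) -> y (enum_rank (I, mu)) = 0,
      plucker (form_of y) & annihilated (Defs.form f) (form_of y)].
Proof.
split=> [h|[h1 [h2 h2'] h3]].
  have h1 (I : idx) (mu : B m) : ~~ (injectiveb I && (mdeg mu == m)) -> y (enum_rank (I, mu)) = 0.
    by move=> /negbTE c; have := h (inl (inl (I, mu))); rewrite /= c /unknown mevalXU.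
  split=> //.
    split=> [I J a|I nI].
      apply/eqP; rewrite -subr_eq0; apply/eqP.
      apply: (homog_eq0 (plucker_expr_homog (I, J, a) (form_of_homog y))) => nu.
      have := h (inl (inr (I, J, a, nu))).
      by rewrite /equation -mcoeff_map_mpoly generic_plucker.
    by apply: big1 => mu _; rewrite h1 ?scale0r // (negbTE nI).
  move=> I a; apply: (homog_eq0 (ann_expr_homog f (I, a) (form_of_homog y))) => nu.
  have := h (inr (I, a, nu)).
  by rewrite /equation -mcoeff_map_mpoly generic_ann.
case=> [[[I mu]|[[[I J] a] nu]]|[[I a] nu]]; rewrite /equation.
- by case: ifP => c; rewrite ?meval0 // /unknown mevalXU h1 // c.
- by rewrite -mcoeff_map_mpoly generic_plucker /= (h2 I J a) subrr mcoeff0.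
- by rewrite -mcoeff_map_mpoly generic_ann /ann_expr h3 mcoeff0.
Qed.

(** A nonzero w is a point of the projective space of coefficient vectors, so the f admitting one
    form the projection of a closed set. *)
Lemma no_plucker_form_open (f0 : forms K N n d) :
  no_plucker_form r (Defs.form f0) m ->
  exists Delta, [/\ polyfun Delta, Delta f0 != 0 &
    forall f : forms K N n d, Delta f != 0 -> no_plucker_form r (Defs.form f) m].
Proof.
move=> np0; have [|Delta [D1 D2 D3]] :=
    @elimination _ _ _ _ equation _ equation_homog equation_polyfun f0.
  move=> y /equation_zero [h1 h2 h3] i.
  case E : (enum_val i) => [I mu]; have Ei : i = enum_rank (I, mu) by rewrite -E enum_valK.
  rewrite Ei; have [c|] := boolP (injectiveb I && (mdeg mu == m)); last exact: h1.
  have := np0 _ (form_of_homog y) h2 h3 I.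
  move/(congr1 (mcoeff mu)); rewrite mcoeff0 raddf_sum /=.
  have [_ mm] := andP c.
  rewrite (bigD1 mu) //= mcoeffZ mcoeffX eqxx mulr1 big1 ?addr0 // => nu /andP[_ ne].
  by rewrite mcoeffZ mcoeffX -bmeqP (negbTE ne) mulr0.
exists Delta; split=> // f Df w wh wp wa.
pose y (i : 'I_nY) := let: (A, mu) := enum_val i in (w A)@_(bmnm mu).
have wE I : form_of y I = w I.
  apply/mpolyP => k; rewrite /form_of raddf_sum /=.
  have [km|km] := eqVneq (mdeg k) m; last first.
    rewrite (dhomog_nemf_coeff (wh I) km); apply: big1 => mu mm.
    rewrite mcoeffZ mcoeffX; case: eqP => [e|_]; last by rewrite mulr0.
    by move: km; rewrite -e mm.
  have kb : (mdeg k < m.+1)%N by rewrite km.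
  rewrite (bigD1 (BMultinom kb)) /= ?km // mcoeffZ mcoeffX eqxx mulr1 big1 ?addr0.
    by rewrite /y enum_rankK.
  move=> mu /andP[_ ne]; rewrite mcoeffZ mcoeffX.
  by move: ne; rewrite bmeqP => /negbTE -> ; rewrite mulr0.
have z : forall t, (equation t f).@[y] = 0.
  apply/equation_zero; split.
  - move=> I mu c; rewrite /y enum_rankK; move: c; rewrite negb_and => /orP[ni|nm].
      by rewrite wp.2 // mcoeff0.
    exact: dhomog_nemf_coeff (wh I) nm.
  - split=> [I J a|I nI]; last by rewrite wE wp.2.
    by rewrite !wE (wp.1 I J a); apply: eq_bigr => k _; rewrite !wE.
  - by move=> I a; rewrite -[RHS](wa I a); apply: eq_bigr => i _; rewrite wE.
move=> I; rewrite -wE; apply: big1 => mu _.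
by rewrite (D3 f Df y z) scale0r.
Qed.

End PluckerOpen.

(** * Brenner's criterion for monomials *)

Lemma updE n r (I : {ffun 'I_r -> 'I_n}) a x b :
  upd I a x b = if b == a then x else I b.
Proof. by rewrite ffunE. Qed.

(** * From Pluecker forms to a scalar Pluecker vector *)

Section LeadingPart.

Variables (K : closedFieldType) (N n r m d : nat) (e : 'I_n -> 'X_{1..N}).
Hypothesis e_deg : forall i, mdeg (e i) = d.
Local Notation idx := {ffun 'I_r -> 'I_n}.
Variable w : idx -> {mpoly K[N]}.
Hypothesis w_homog : forall A, w A \is m.-homog.
Hypothesis w_plucker : plucker w.
Hypothesis w_ann : annihilated (fun i => 'X_[e i]) w.

Definition weight (A : idx) : 'X_{1..N} := (\sum_x e (A x))%MM.

Lemma weight_upd A a z : (weight (upd A a z) + e (A a) = weight A + e z)%MM.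
Proof.
rewrite /weight (bigD1 a) //= [in RHS](bigD1 a) //= updE eqxx.
rewrite (eq_bigr (fun x => e (A x))) => [|x xa]; last by rewrite updE (negbTE xa).
by rewrite addmC addmA [in RHS]addmC !addmA (addmC (e (A a))).
Qed.

(** Rescaling the i-th basis vector by f_i preserves the Pluecker relations and turns contraction
    with f into contraction with (1, ..., 1). *)
Definition weighted (A : idx) := w A * 'X_[weight A].

Lemma weighted_plucker : plucker weighted.
Proof.
split=> [A B a|A nA]; last by rewrite /weighted w_plucker.2 // mul0r.
rewrite /weighted mulrACA (w_plucker.1 A B a) -mpolyXD mulr_suml.
apply: eq_bigr => k _; rewrite [RHS]mulrACA -mpolyXD; congr (_ * 'X_[_]).
apply: (@addIm _ (e (A a) + e (B k))%MM).
rewrite [RHS](_ : _ = (weight (upd A a (B k)) + e (A a)) +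
  (weight (upd B k (A a)) + e (B k)))%MM.
  rewrite !weight_upd; apply/mnmP => i; rewrite !mnmDE; lia.
apply/mnmP => i; rewrite !mnmDE; lia.
Qed.

Lemma weighted_ann A a : \sum_i weighted (upd A a i) = 0.
Proof.
apply: (@mulIf _ 'X_[e (A a)]).
  by rewrite -msize_poly_eq0 msizeX.
rewrite mul0r mulr_suml.
transitivity ((\sum_i 'X_[e i] * w (upd A a i)) * 'X_[weight A]); last first.
  by rewrite w_ann mul0r.
rewrite mulr_suml; apply: eq_bigr => i _.
rewrite /weighted -[LHS]mulrA -[in LHS]mpolyXD weight_upd mpolyXD.
by rewrite mulrA mulrAC [w _ * _]mulrC mulrAC.
Qed.

Lemma weighted_homog A : weighted A \is (m + d * r).-homog.
Proof.
apply: dhomogM => //; rewrite dhomogX /= /weight mdeg_sum.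
by rewrite (eq_bigr (fun=> d)) // sum_nat_const card_ord mulnC.
Qed.

(** Let gam be the greatest leading monomial of the [weighted] coordinates. Linear relations pass to
    the coefficients at gam, quadratic ones to those at 2 gam, which are products of coefficients at
    gam. Finally X^gam can occur in a multiple of X^(weight A) only if the latter divides it. *)
Lemma leading_part A0 : w A0 != 0 -> exists (gam : 'X_{1..N}) (c : idx -> K),
  [/\ mdeg gam = (m + d * r)%N, plucker c, annihilated (fun=> 1) c,
      exists A, c A != 0 &
      forall A, c A != 0 -> (weight A <= gam)%MM].
Proof.
move=> w0.
have ww0 : weighted A0 != 0.
  by rewrite mulf_neq0 // -msize_poly_eq0 msizeX.
pose A1 := [arg max_(A > A0 | weighted A != 0) mlead (weighted A)]%O.
pose gam := mlead (weighted A1).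
have [A1n A1max] : weighted A1 != 0 /\
    forall A, weighted A != 0 -> (mlead (weighted A) <= gam)%O.
  by rewrite /gam /A1; case: arg_maxP.
have lead A : (mlead (weighted A) <= gam)%O.
  have [->|/A1max //] := eqVneq (weighted A) 0.
  by rewrite mlead0 le0m.
exists gam, (fun A => (weighted A)@_gam).
have cM A B : (weighted A * weighted B)@_(gam + gam)%MM =
    (weighted A)@_gam * (weighted B)@_gam.
  by apply: mleadcMW.
split.
- by have /dhomogP := weighted_homog A1; apply; apply: mlead_supp.
- split=> [A B a|A nA]; last by rewrite weighted_plucker.2 // mcoeff0.
  rewrite -cM (weighted_plucker.1 A B a) raddf_sum /=.
  by apply: eq_bigr => k _; rewrite cM.
- move=> A a; rewrite -[RHS](mcoeff0 K gam) -(weighted_ann A a) raddf_sum /=.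
  by apply: eq_bigr => i _; rewrite mul1r.
- by exists A1; rewrite mleadc_eq0.
move=> A; rewrite -mcoeff_msupp => /msuppM_le /allpairsP [[k l] /= [_ +]].
rewrite msuppX inE => /eqP -> ->; exact: lem_addl.
Qed.

End LeadingPart.

(** * Bases and circuits of the matroid of a Pluecker vector *)

Section Exchange.

Variables (K : fieldType) (n r : nat).
Local Notation idx := {ffun 'I_r -> 'I_n}.
Variable c : idx -> K.
Hypothesis c_plucker : plucker c.
Hypothesis c_ann : annihilated (fun=> 1) c.
Variable I0 : idx.
Hypothesis c_I0 : c I0 != 0.

Lemma plucker_noninj (A : idx) x y : x != y -> A x = A y -> c A = 0.
Proof.
move=> xy e; apply: c_plucker.2; apply/injectiveP => inj.
by move/eqP: xy; apply; apply: inj.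
Qed.

Lemma basis_injective : injective I0.
Proof.
move=> x y e; apply/eqP; apply: contraNT c_I0 => xy.
by rewrite (plucker_noninj xy e).
Qed.

(* The circuits through the basis I0 of successive contractions of the matroid:   *)
(* the next element is E x, and its fundamental circuit, after contracting the    *)
(* previous ones, consists of E x and of the I0 y with E y = E x.                 *)
Lemma circuit_decomposition : exists (E : 'I_r -> 'I_n) (lv : 'I_r -> nat),
  [/\ forall x, c (upd I0 x (E x)) != 0,
      forall x y, c (upd I0 x (E y)) != 0 -> (lv x <= lv y)%N,
      forall x y, E x != I0 y &
      forall x y, lv x = lv y -> E x = E y].
Proof.
(* D holds the positions already assigned to a circuit, and lv numbers the contractions in order. *)
pose inv (D : {set 'I_r}) (E : 'I_r -> 'I_n) (lv : 'I_r -> nat) :=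
  [/\ forall x, x \in D -> c (upd I0 x (E x)) != 0,
      forall x y, y \in D -> c (upd I0 x (E y)) != 0 -> x \in D /\ (lv x <= lv y)%N,
      forall x y, x \in D -> E x != I0 y &
      forall x y, x \in D -> y \in D -> lv x = lv y -> E x = E y].
have step D E lv : inv D E lv -> D != setT ->
    exists D' E' lv', inv D' E' lv' /\ (#|D| < #|D'|)%N.
  case=> i1 i2 i3 i4 DT.
  have [a aD] : exists a, a \notin D.
    apply: NNPP => nex; case/eqP: DT; apply/setP => x; rewrite inE.
    by apply/negPn/negP => xD; apply: nex; exists x.
  (* There are no coloops: the values of c over all replacements of I0 a sum to 0, and c I0 <> 0 is
     one of them. *)
  have [b [ba cb]] : exists b, b != I0 a /\ c (upd I0 a b) != 0.
    apply: NNPP => nex; have := c_ann I0 a.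
    rewrite (bigD1 (I0 a)) //= upd_same big1 => [|b ba].
      by rewrite addr0 mul1r => /eqP; rewrite (negbTE c_I0).
    apply/eqP; rewrite mul1r; apply/negPn/negP => cb; apply: nex; by exists b.
  have bI y : b != I0 y.
    have [-> //|ya] := eqVneq y a; apply: contraNneq cb => e.
    by apply/eqP; apply: (plucker_noninj ya); rewrite !updE eqxx (negbTE ya).
  (* The new block: the positions of the fundamental circuit of b outside D. *)
  pose S := [set x | (x \notin D) && (c (upd I0 x b) != 0)].
  pose L := (\max_(x in D) lv x).+1.
  have lvL x : x \in D -> (lv x < L)%N by move=> xD; rewrite ltnS; apply: (@leq_bigmax_cond _ (mem D) lv).
  have SD x : x \in S -> x \in D = false by rewrite inE => /andP[/negbTE].
  have Eb x : x \in D -> E x != b.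
    move=> xD; apply/eqP => e; case/negP: aD.
    by have [] := i2 a x xD; rewrite // e.
  exists (D :|: S), (fun x => if x \in D then E x else b),
    (fun x => if x \in D then lv x else L); split; last first.
    apply: proper_card; apply/properP; split; first exact: subsetUl.
    by exists a => //; rewrite !inE aD cb orbT.
  split.
  - move=> x; rewrite in_setU => /orP[xD|xS]; first by rewrite xD i1.
    by rewrite SD //; move: xS; rewrite inE => /andP[].
  - move=> x y; rewrite !in_setU; have [yD _|yD /= yS] := boolP (y \in D).
      by move=> cE; have [xD lxy] := i2 x y yD cE; rewrite xD.
    move=> cE; have [xD|xD] := boolP (x \in D); split=> //.
      by apply: ltnW; apply: lvL.
    by rewrite inE xD cE.
  - by move=> x y _; case: ifP => [xD|_]; [apply: i3 | apply: bI].
  - move=> x y _ _; case: ifP => xD; case: ifP => yD //; first exact: i4.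
      by move=> e; have := lvL x xD; rewrite e ltnn.
    by move=> e; have := lvL y yD; rewrite e ltnn.
have big k : (k <= r)%N -> exists D E lv, inv D E lv /\ (k <= #|D|)%N.
  elim: k => [_|k IH kr].
    exists set0, I0, (fun=> 0%N); split=> //.
    by split=> [x|x y|x y|x y]; rewrite in_set0.
  have [D [E [lv [i kD]]]] := IH (ltnW kr).
  have [DT|/(step _ _ _ i) [D' [E' [lv' [i' DD]]]]] := eqVneq D setT.
    by exists D, E, lv; split=> //; rewrite DT cardsT card_ord.
  by exists D', E', lv'; split=> //; apply: leq_ltn_trans DD.
have [D [E [lv [[i1 i2 i3 i4] rD]]]] := big r (leqnn r).
have DT x : x \in D.
  suff -> : D = setT by rewrite inE.
  by apply/eqP; rewrite eqEcard subsetT cardsT card_ord.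
exists E, lv; split=> [x|x y|x y|x y]; [exact: i1| |exact: i3|exact: i4].
by case/(i2 x y (DT y)).
Qed.

Variables (E : 'I_r -> 'I_n) (lv : 'I_r -> nat).
Hypotheses (c_E : forall x, c (upd I0 x (E x)) != 0)
  (c_lv : forall x y, c (upd I0 x (E y)) != 0 -> (lv x <= lv y)%N)
  (lv_E : forall x y, lv x = lv y -> E x = E y).

Definition swap (h : {set 'I_r}) : idx := [ffun x => if x \in h then E x else I0 x].

(** On h the exchange matrix c (upd I0 x (E y)) is triangular for the levels, with nonzero diagonal.
    The element of least level is exchanged last, and the Pluecker relation with I0 then has a
    single surviving term. *)
Lemma swap_basis (h : {set 'I_r}) : {in h &, injective E} -> c (swap h) != 0.
Proof.
have [k] := ubnP #|h|; elim: k h => // k IH h; rewrite ltnS => hk injE.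
have [->|[x0 x0h]] := set_0Vmem h.
  suff -> : swap set0 = I0 by [].
  by apply/ffunP => x; rewrite ffunE inE.
have [x xh' xmin] := @arg_minnP _ x0 (mem h) lv x0h.
have {xh'} xh : x \in h := xh'.
pose A := swap (h :\ x).
have cA : c A != 0.
  apply: IH; first by move: hk; rewrite (cardsD1 x h) xh.
  by move=> y z /setD1P[_ yh] /setD1P[_ zh]; apply: injE.
have -> : swap h = upd A x (E x).
  apply/ffunP => y; rewrite updE !ffunE !inE; case: eqP => [->|//].
  by rewrite xh.
have := c_plucker.1 (upd A x (E x)) I0 x.
rewrite (bigD1 x) //= big1 ?addr0 => [|j jx].
  have -> : upd (upd A x (E x)) x (I0 x) = A.
    apply/ffunP => y; rewrite !updE; case: eqP => [->|//].
    by rewrite ffunE !inE eqxx.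
  rewrite [X in upd I0 x X]updE eqxx => P.
  have : c A * c (upd I0 x (E x)) != 0 by rewrite mulf_neq0.
  by rewrite -P; apply: contraNneq => ->; rewrite mul0r.
(* Any other term needs lv j <= lv x, hence j outside h by minimality and injectivity of E; then I0
   j would occur twice. *)
rewrite [X in upd I0 j X]updE eqxx.
have [->|/c_lv lk] := eqVneq (c (upd I0 j (E x))) 0; first by rewrite mulr0.
have jh : j \notin h.
  apply/negP => jh; case/eqP: jx; apply: injE => //.
  by apply: lv_E; apply/eqP; rewrite eqn_leq lk xmin.
rewrite (@plucker_noninj _ j x) ?mul0r // !updE eqxx (negbTE jx).
by rewrite ffunE !inE (negbTE jh) andbF.
Qed.

End Exchange.

Lemma bigminn_le (T : finType) (P : pred T) (F : T -> nat) z x : P x ->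
  (\big[minn/z]_(i | P i) F i <= F x)%N.
Proof.
move=> Px; have : x \in index_enum T by rewrite mem_index_enum.
elim: (index_enum T) => // y s IH; rewrite inE big_cons => /orP[/eqP <-|/IH le].
  by rewrite Px geq_minl.
by case: ifP => _ //; rewrite geq_min le orbT.
Qed.

Section MonomialCriterion.

Variables (K : closedFieldType) (N n d : nat) (e : 'I_n -> 'X_{1..N}).
Hypothesis e_deg : forall i, mdeg (e i) = d.

(** Fix a variable X_j. In each block b take the element I0 x with least exponent of X_j, and
    exchange it for b when b has a larger one. By [swap_basis] this is a basis, so its weight is at
    most gam; the exchange has raised the exponent by e b j - g b j, with g b the gcd of b and its
    block. Summing over j gives the inequality. *)
Lemma plucker_form_blocks r m (w : {ffun 'I_r -> 'I_n} -> {mpoly K[N]}) A0 :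
  (forall A, w A \is m.-homog) -> plucker w -> annihilated (fun i => 'X_[e i]) w ->
  w A0 != 0 ->
  exists (I0 : 'I_r -> 'I_n) (E : 'I_r -> 'I_n) (g : 'I_n -> 'X_{1..N}),
  [/\ injective I0, forall x y, E x != I0 y,
      forall x, (g (E x) <= e (I0 x))%MM /\ (g (E x) <= e (E x))%MM &
      (d * #|E @: 'I_r| <= m + \sum_(b in E @: 'I_r) mdeg (g b))%N].
Proof.
move=> wh wp wa w0.
have [gam [c [gdeg cp ca [I0 cI0] cgam]]] := leading_part e_deg wh wp wa w0.
have [E [lv [cE clv EI0 lvE]]] := circuit_decomposition cp ca cI0.
have I0inj := basis_injective cp cI0.
have csw := swap_basis cp cI0 cE clv lvE.
have /fin_all_exists [X XP] : forall b : 'I_n, exists X : 'I_N -> 'I_r -> bool,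
    b \in E @: 'I_r -> forall j, exists x, [/\ E x = b,
      forall y, (X j y) = (y == x) & forall y, E y = b -> (e (I0 x) j <= e (I0 y) j)%N].
  move=> b; have [bE|] := boolP (b \in E @: 'I_r); last by exists (fun _ _ => false).
  have [x0 _ bx0] := imsetP bE.
  exists (fun j y => y == [arg min_(x < x0 | E x == b) e (I0 x) j]) => _ j.
  case: arg_minnP => [|x /eqP xb xmin]; first by rewrite bx0.
  by exists x; split=> // y /eqP; apply: xmin.
(* The default value of the minimum puts b itself into the gcd. *)
pose g (b : 'I_n) := [multinom (\big[minn/e b j]_(x | E x == b) e (I0 x) j) | j < N].
have gE b j x : E x = b -> X b j x -> g b j = minn (e b j) (e (I0 x) j).
  move=> xb Xx; have bE : b \in E @: 'I_r by rewrite -xb imset_f.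
  have [y [yb Xy ymin]] := XP b bE j; move: Xx; rewrite Xy => /eqP xy; subst y.
  rewrite mnmE; apply/eqP; rewrite eqn_leq; apply/andP; split.
    rewrite leq_min; apply/andP; split.
      by elim/big_rec: _ => // i k _ h; rewrite geq_min h orbT.
    by apply: bigminn_le; rewrite xb.
  elim/big_rec: _ => [|i k /eqP ib h]; first exact: geq_minl.
  by rewrite leq_min h andbT geq_min ymin // orbT.
exists I0, E, g; split=> //.
  move=> x; split; apply/mnm_lepP => j; rewrite mnmE.
    by apply: (bigminn_le (fun x => e (I0 x) j)).
  by elim/big_rec: _ => // i k _ h; rewrite geq_min h orbT.
suff main j : (\sum_(x < r) e (I0 x) j + \sum_(b in E @: 'I_r) e b j
    <= gam j + \sum_(b in E @: 'I_r) g b j)%N.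
  have : (d * r + d * #|E @: 'I_r| <= mdeg gam + \sum_(b in E @: 'I_r) mdeg (g b))%N.
    rewrite mdegE (eq_bigr _ (fun b _ => mdegE (g b))) exchange_big -big_split /=.
    apply: leq_trans (leq_sum _ (fun j _ => main j)).
    rewrite big_split /= exchange_big [X in (_ <= _ + X)%N]exchange_big /=.
    rewrite (eq_bigr (fun=> d)) => [|x _]; last by rewrite -mdegE.
    rewrite [X in (_ <= _ + X)%N](eq_bigr (fun=> d)) => [|x _]; last by rewrite -mdegE.
    by rewrite !sum_nat_const card_ord ![(_ * d)%N]mulnC.
  rewrite gdeg; lia.
pose h := [set x | X (E x) j x && (e (I0 x) j < e (E x) j)%N].
have hinj : {in h &, injective E}.
  move=> x y; rewrite !inE => /andP[Xx _] /andP[Xy _] xy.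
  have xE : E x \in E @: 'I_r by rewrite imset_f.
  have [z [_ Xz _]] := XP (E x) xE j.
  by move: Xx Xy; rewrite -xy !Xz => /eqP -> /eqP ->.
have /mnm_lepP /(_ j) := cgam _ (csw h hinj).
rewrite /weight mnm_sumE => le.
apply: leq_trans (leq_add le (leqnn _)).
rewrite (partition_big_imset E) /= [X in (_ <= X + _)%N](partition_big_imset E) /=.
rewrite -!big_split /=; apply: leq_sum => b bE.
have [x [xb Xx xmin]] := XP b bE j.
rewrite (bigD1 x) ?xb //= [X in (_ <= X + _)%N](bigD1 x) ?xb //=.
rewrite (gE b j x xb) ?Xx // addnAC [X in (_ <= X)%N]addnAC.
have -> : (\sum_(i | (E i == b) && (i != x)) e (swap I0 E h i) j =
           \sum_(i | (E i == b) && (i != x)) e (I0 i) j)%N.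
  apply: eq_bigr => i /andP[/eqP ib ix].
  by rewrite ffunE inE ib Xx (negbTE ix).
rewrite leq_add2r ffunE inE xb Xx eqxx /=; case: ltnP => /= lt.
  by rewrite addnC.
by [].
Qed.

Lemma sum_block_card r (E : 'I_r -> 'I_n) :
  (\sum_(b in E @: 'I_r) #|[set x | E x == b]| = r)%N.
Proof.
rewrite -[RHS](card_ord r) -sum1_card (partition_big_imset E) /=.
by apply: eq_bigr => b _; rewrite sum1dep_card.
Qed.

(* Brenner's criterion: g is a common divisor of the monomials indexed by C. *)
Definition brenner (cmp : rel nat) := forall (C : {set 'I_n}) (g : 'X_{1..N}),
  (2 <= #|C| < n)%N -> (forall i, i \in C -> (g <= e i)%MM) ->
  cmp (d * #|C|.-1 + mdeg g * n.-1)%N (d * n.-1)%N.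

(** The criterion is applied to a block together with its b: since b is outside the basis, this
    family has s b + 1 <= r + 1 < n elements. *)
Lemma brenner_blocks (cmp : rel nat) r m (w : {ffun 'I_r -> 'I_n} -> {mpoly K[N]}) A0 :
  brenner cmp -> (0 < r < n.-1)%N ->
  (forall A, w A \is m.-homog) -> plucker w -> annihilated (fun i => 'X_[e i]) w ->
  w A0 != 0 ->
  exists (B : {set 'I_n}) (s g : 'I_n -> nat), [/\ B != set0,
    (\sum_(b in B) s b = r)%N, (d * #|B| <= m + \sum_(b in B) g b)%N &
    forall b, b \in B -> cmp (d * s b + g b * n.-1)%N (d * n.-1)%N].
Proof.
move=> br /andP[r0 rn] wh wp wa w0.
have [I0 [E [g [I0inj EI0 gE dB]]]] := plucker_form_blocks wh wp wa w0.
exists (E @: 'I_r), (fun b => #|[set x | E x == b]|), (fun b => mdeg (g b)).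
split=> //; first by apply/set0Pn; exists (E (Ordinal r0)); rewrite imset_f.
  exact: sum_block_card.
move=> b bE; pose S := [set x | E x == b].
have bS : b \notin I0 @: S.
  apply/negP => /imsetP [x]; rewrite inE => /eqP xb e1.
  by have := EI0 x x; rewrite xb e1 eqxx.
have cC : #|b |: I0 @: S| = #|S|.+1 by rewrite cardsU1 bS card_imset.
have S0 : (0 < #|S|)%N.
  by have [x _ bx] := imsetP bE; apply/card_gt0P; exists x; rewrite inE bx.
have Sr : (#|S| <= r)%N by rewrite -[X in (_ <= X)%N](card_ord r) max_card.
have := br (b |: I0 @: S) (g b); rewrite cC; apply; first by lia.
move=> i /setU1P [->|/imsetP [x]].
  by have [x _ ->] := imsetP bE; have [] := gE x.
by rewrite inE => /eqP <- ->; have [] := gE x.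
Qed.

(** Summed over the blocks, the criterion gives d r + (n-1) sum g_b < d |B| (n-1) <= (n-1) (m + sum
    g_b). *)
Lemma brenner_lt r m : brenner ltn -> (0 < r < n.-1)%N -> (m * n.-1 <= d * r)%N ->
  no_plucker_form r (fun i => 'X_[K, e i]) m.
Proof.
move=> br rn mr w wh wp wa A; apply/eqP; apply: contraLR mr => w0.
have [B [s [g [B0 sr dB cB]]]] := brenner_blocks br rn wh wp wa w0.
have : (\sum_(b in B) (d * s b + g b * n.-1) < \sum_(b in B) d * n.-1)%N.
  have [b bB] := set0Pn _ B0.
  rewrite (bigD1 b) //= [X in (_ < X)%N](bigD1 b) //= -addSn.
  apply: leq_add; first exact: (cB b bB).
  by apply: leq_sum => i /andP[iB _]; apply: ltnW; apply: cB.
rewrite big_split /= -big_distrr /= sr -big_distrl /= sum_nat_const.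
have := leq_mul dB (leqnn n.-1); rewrite mulnDl mulnA [(#|B| * d)%N]mulnC.
set x := (d * #|B| * _)%N; set y := ((\sum_(b in B) g b) * _)%N.
move: x y (d * r)%N (m * n.-1)%N => x y u v; lia.
Qed.

Lemma brenner_le r m : brenner leq -> (0 < r < n.-1)%N -> (m * n.-1 < d * r)%N ->
  no_plucker_form r (fun i => 'X_[K, e i]) m.
Proof.
move=> br rn mr w wh wp wa A; apply/eqP; apply: contraLR mr => w0.
have [B [s [g [B0 sr dB cB]]]] := brenner_blocks br rn wh wp wa w0.
have : (\sum_(b in B) (d * s b + g b * n.-1) <= \sum_(b in B) d * n.-1)%N.
  by apply: leq_sum => i; apply: cB.
rewrite big_split /= -big_distrr /= sr -big_distrl /= sum_nat_const.
have := leq_mul dB (leqnn n.-1); rewrite mulnDl mulnA [(#|B| * d)%N]mulnC.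
set x := (d * #|B| * _)%N; set y := ((\sum_(b in B) g b) * _)%N.
move: x y (d * r)%N (m * n.-1)%N => x y u v; lia.
Qed.

End MonomialCriterion.

(** * Families of monomials satisfying the criterion *)

Local Open Scope nat_scope.

Definition dvd_exp (g x : seq nat) := all2 leq g x.

(* Brenner's criterion for monomials given as exponent lists; common divisors g of *)
(* degree 0 or d impose nothing on a proper subfamily of distinct monomials.       *)
Definition spread (cmp : rel nat) v d (L : seq (seq nat)) :=
  [/\ uniq L, all (fun x => (size x == v) && (sumn x == d)) L &
      forall g, size g = v -> 0 < sumn g < d -> 2 <= count (dvd_exp g) L ->
        cmp (d * (count (dvd_exp g) L).-1 + sumn g * (size L).-1) (d * (size L).-1)].

Lemma dvd_exp_sumn g x : dvd_exp g x -> sumn g <= sumn x.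
Proof.
elim: g x => [|a g IH] [|b x] //= /andP[ab gx]; exact: leq_add ab (IH _ gx).
Qed.

Lemma dvd_exp_eq g x : dvd_exp g x -> sumn x <= sumn g -> x = g.
Proof.
elim: g x => [|a g IH] [|b x] //= /andP[ab gx] h.
have := dvd_exp_sumn gx => h2; rewrite (IH x gx); last by lia.
by congr (_ :: _); lia.
Qed.

Lemma count_ord (T : Type) (x0 : T) (p : pred T) (L : seq T) :
  count p L = #|[set i : 'I_(size L) | p (nth x0 L i)]|.
Proof.
rewrite -sum1dep_card -sum1_count (big_nth x0) big_mkord; exact: eq_bigl.
Qed.

(** Exponent lists are padded with zeros, so only v of the N variables occur. A divisor of degree 0
    leaves the condition |C| < n, and one of degree at least d has at most one multiple in L. *)
Lemma spread_brenner (cmp : rel nat) N v d (L : seq (seq nat)) :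
  (forall a b, a < b -> cmp a b) -> (forall a b c, a <= b -> cmp b c -> cmp a c) ->
  v <= N -> 0 < d -> spread cmp v d L ->
  exists e : 'I_(size L) -> 'X_{1..N}, (forall i, mdeg (e i) = d) /\ brenner d e cmp.
Proof.
move=> clt cle vN d0 [uL aL sL].
pose x (i : 'I_(size L)) := nth [::] L i.
have [xs xd] : (forall i, size (x i) = v) /\ (forall i, sumn (x i) = d).
  by split=> i; have /andP[/eqP ? /eqP ?] := allP aL _ (mem_nth [::] (ltn_ord i)).
pose e i := [multinom nth 0 (x i) j | j < N].
have head_sum (F : nat -> nat) : (forall j, v <= j < N -> F j = 0) ->
    \sum_(j < N) F j = \sum_(0 <= j < v) F j.
  move=> F0; rewrite -(big_mkord xpredT F) (big_cat_nat (n := v)) //=.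
  by rewrite [X in _ + X]big_nat_cond [X in _ + X]big1 ?addn0 // => k /andP[/F0].
exists e; split=> [i|C g /andP[C2 Cn] gC].
  rewrite mdegE (eq_bigr (fun j : 'I_N => nth 0 (x i) j)) => [|j _]; last by rewrite mnmE.
  rewrite (head_sum (fun j => nth 0 (x i) j)).
    by rewrite -{1}(xs i) -[RHS](xd i) sumnE [RHS](big_nth 0).
  by move=> j /andP[vj _]; rewrite nth_default // xs.
pose gf j := if insub j is Some k then g (k : 'I_N) else 0.
have gfE (j : 'I_N) : gf j = g j by rewrite /gf valK.
pose g' := mkseq gf v.
have [i0 i0C] : exists i, i \in C by apply/card_gt0P; lia.
have gdeg : mdeg g = sumn g'.
  rewrite mdegE (eq_bigr (fun j : 'I_N => gf j)) => [|j _]; last by rewrite gfE.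
  rewrite (head_sum gf); first by rewrite sumnE big_map /index_iota subn0.
  move=> j /andP[vj jN]; rewrite (gfE (Ordinal jN)).
  have /mnm_lepP /(_ (Ordinal jN)) := gC i0 i0C.
  by rewrite mnmE nth_default ?xs //; lia.
have Cc : #|C| <= count (dvd_exp g') L.
  rewrite (count_ord [::]); apply: subset_leq_card; apply/subsetP => i /gC /mnm_lepP le.
  rewrite inE /dvd_exp all2E size_mkseq xs eqxx /=; apply/(all_nthP (0, 0)) => j.
  rewrite size_zip size_mkseq xs minnn => jv.
  rewrite nth_zip ?size_mkseq ?xs //= nth_mkseq //.
  have jN : j < N by apply: leq_trans vN.
  by have := le (Ordinal jN); rewrite mnmE -gfE.
rewrite gdeg; have [g0|gp] := posnP (sumn g').
  by apply: clt; rewrite g0 mul0n addn0 ltn_mul2l d0; lia.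
have [gd|gd] := ltnP (sumn g') d; last first.
  have : count (dvd_exp g') L <= 1.
    rewrite -size_filter.
    apply: (@uniq_leq_size _ _ [:: g']); first exact: filter_uniq.
    move=> y; rewrite mem_filter inE => /andP[gy yL]; apply/eqP; apply: dvd_exp_eq => //.
    by have /andP[_ /eqP ->] := allP aL _ yL.
  by lia.
apply: cle (sL g' _ _ _); rewrite ?size_mkseq ?gp //; last exact: leq_trans Cc.
by rewrite leq_add2r leq_mul2l; apply/orP; right; lia.
Qed.

Lemma size3P (g : seq nat) : size g = 3 -> exists a b c, g = [:: a; b; c].
Proof. by case: g => [|a [|b [|c []]]] // _; exists a, b, c. Qed.

Lemma count0P (T : Type) (p : pred T) s : (forall x, p x = false) -> count p s = 0.
Proof. by move=> h; rewrite (eq_count (a2 := pred0)) ?count_pred0. Qed.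

Lemma count_iota_le (P : pred nat) m k lo u :
  (forall i, m <= i < m + k -> P i -> lo <= i < lo + u) -> count P (iota m k) <= u.
Proof.
move=> h; rewrite -size_filter -[u](size_iota lo); apply: uniq_leq_size.
  exact: filter_uniq (iota_uniq _ _).
by move=> i; rewrite mem_filter !mem_iota => /andP[Pi ik]; apply: h.
Qed.

Lemma count_parity_gap (P : pred nat) (b : bool) m k :
  (forall i, P i -> odd i = b) -> 0 < count P (iota m k) ->
  exists i j, [/\ m <= i, j < m + k, P i, P j & i + 2 * (count P (iota m k)).-1 <= j].
Proof.
move=> Pb; elim: k => // k IH.
have -> : iota m k.+1 = iota m k ++ [:: m + k] by rewrite -addn1 iotaD.
rewrite count_cat /= addn0.
have [Pm|Pm] := boolP (P (m + k)); last first.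
  rewrite addn0 => /IH [i [j [mi jm Pi Pj ij]]].
  by exists i, j; split=> //; lia.
have [c0|cp] := posnP (count P (iota m k)).
  by move=> _; exists (m + k), (m + k); rewrite c0; split=> //; lia.
have [i [j [mi jm Pi Pj ij]]] := IH cp => _.
exists i, (m + k); split=> //; first by lia.
by have := Pb _ Pj; have := Pb _ Pm; lia.
Qed.

Lemma count_parity_le (P : pred nat) (b : bool) m k lo hi :
  (forall i, P i -> odd i = b) -> (forall i, m <= i < m + k -> P i -> lo <= i <= hi) ->
  count P (iota m k) <= (hi - lo)./2.+1.
Proof.
move=> Pb h; have [->//|cp] := posnP (count P (iota m k)).
have [i [j [mi jm Pi Pj ij]]] := count_parity_gap Pb cp.
have /andP[_ jh] : lo <= j <= hi by apply: h => //; lia.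
have /andP[li _] : lo <= i <= hi by apply: h => //; lia.
by move: (count _ _) cp ij => c cp ij; lia.
Qed.

(** Locates the n-th point in a row by row enumeration: k full rows, then q points of row k. *)
Lemma prefix_sum (s : nat -> nat) M n : 0 < n <= \sum_(i < M) s i ->
  exists k q, [/\ k < M, 0 < q <= s k & n = \sum_(i < k) s i + q].
Proof.
elim: M => [|M IH]; first by rewrite big_ord0; lia.
rewrite big_ord_recr /= => /andP[n0 nM].
have [le|lt] := leqP n (\sum_(i < M) s i).
  by have [|k [q [kM qs ->]]] := IH; [lia|exists k, q; split=> //; lia].
exists M, (n - \sum_(i < M) s i); split; [exact: leqnn| |by rewrite subnKC // ltnW].
by rewrite subn_gt0 lt leq_subLR.
Qed.

(** * Three variables: at most 2 d monomials, with d not dividing n - 1 *)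

Section TwoSides.

Variables d n : nat.
Hypotheses (n3 : 3 <= n) (n2d : n <= 2 * d) (ndvd : ~~ (d %| n.-1)).

(** The cap matters only at i = n - 1, where the other argument is d + 1. *)
Definition side_row i := minn d ((i * d) %/ n.-1).+1.

Definition side_point i :=
  if odd i then [:: side_row i; 0; d - side_row i] else [:: 0; side_row i; d - side_row i].

(* A vertex of the triangle of monomials, then points alternating between the two *)
(* sides through it, with heights about d / (n - 1) apart.                        *)
Definition two_sides := [:: 0; 0; d] :: [seq side_point i | i <- iota 1 n.-1].

Lemma side_row_floor i : i < n.-1 -> side_row i = ((i * d) %/ n.-1).+1.
Proof.
move=> ni; apply/minn_idPr; rewrite ltn_divLR; last by lia.
by rewrite mulnC ltn_mul2l; lia.
Qed.

Lemma side_row_last : side_row n.-1 = d.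
Proof.
by apply/minn_idPl; rewrite mulKn //; lia.
Qed.

Lemma side_row_bounds i : 0 < side_row i <= d.
Proof. by rewrite /side_row leq_min; lia. Qed.

(** Points of one side have indices of equal parity, so c + 1 of them span 2 c indices and a height
    of about 2 c d / (n - 1). Rounding loses less than one unit, which the factor 2 makes up for. *)
Lemma side_row_gap i j c e : 0 < i -> i + 2 * c <= j -> 0 < c -> j <= n.-1 -> 0 < e ->
  side_row j <= side_row i + e -> c * d < e * n.-1.
Proof.
move=> i0 ij c0 jn e0 H; move: H; rewrite [side_row i]side_row_floor; last by lia.
move=> H; have m0 : 0 < n.-1 by lia.
have h1 := divn_eq (i * d) n.-1; have h2 := ltn_pmod (i * d) m0.
move: h1 h2; set a := (i * d) %/ n.-1; set b := (i * d) %% n.-1 => h1 h2.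
have cd : (i + 2 * c) * d <= j * d by rewrite leq_mul2r ij orbT.
have e1 : 1 * n.-1 <= e * n.-1 by rewrite leq_mul2r e0 orbT.
rewrite mulnDl -mulnA in cd.
rewrite ltnNge; have [jl|jl] := ltnP j n.-1; apply/negP => ge.
  move: H; rewrite side_row_floor //.
  have h3 := divn_eq (j * d) n.-1; have h4 := ltn_pmod (j * d) m0.
  move: h3 h4; set a' := (j * d) %/ n.-1; set b' := (j * d) %% n.-1 => h3 h4 le.
  have : a' * n.-1 <= (a + e) * n.-1 by rewrite leq_mul2r; lia.
  by rewrite mulnDl; lia.
have je : j = n.-1 by lia.
move: H; rewrite je side_row_last => le.
have : d * n.-1 <= (a.+1 + e) * n.-1 by rewrite leq_mul2r le orbT.
rewrite je [n.-1 * d]mulnC in cd.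
rewrite mulnDl mulSn => h5.
(* The cap leaves a single doubtful case, e = 1 and c d = n - 1, excluded since d does not divide n
   - 1. *)
have cn : c * d = n.-1 by lia.
by case/negP: ndvd; rewrite -cn dvdn_mull.
Qed.

Lemma side_row_lt i j : i + 2 <= j -> j <= n.-1 -> side_row i < side_row j.
Proof.
move=> ij jn; have m0 : 0 < n.-1 by lia.
rewrite [side_row i]side_row_floor; last by lia.
have h1 := leq_trunc_div (i * d) n.-1.
have ijd : (i + 2) * d <= j * d by rewrite leq_mul2r ij orbT.
rewrite mulnDl in ijd.
have [jl|jl] := ltnP j n.-1.
  rewrite side_row_floor // ltnS leq_divRL // mulSn; lia.
have -> : j = n.-1 by lia.
rewrite side_row_last.
have jn' : j = n.-1 by lia.
rewrite -ltnS in h1 |- *.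
suff : ((i * d) %/ n.-1).+2 * n.-1 < d.+1 * n.-1 by rewrite ltn_mul2r => /andP[].
rewrite !mulSn; rewrite jn' [n.-1 * d]mulnC in ijd; lia.
Qed.

Lemma side_point_inj i j : i < j -> j <= n.-1 -> side_point i <> side_point j.
Proof.
move=> ij jn; rewrite /side_point.
have := side_row_bounds i; have := side_row_bounds j.
have lt : i + 2 <= j -> side_row i < side_row j by move=> h; apply: side_row_lt.
case: ifP => oi; case: ifP => oj bi bj [] *; try lia.
Qed.

Lemma two_sides_spread : spread ltn 3 d two_sides /\ size two_sides = n.
Proof.
have sz : size two_sides = n by rewrite /= size_map size_iota; lia.
split=> //; split.
- rewrite /= map_inj_in_uniq ?iota_uniq ?andbT.
    apply/negP => /mapP [i _]; rewrite /side_point.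
    by have := side_row_bounds i; case: ifP => _ b [] *; lia.
  move=> i j; rewrite !mem_iota => hi hj e.
  have [ij|ij|//] := ltngtP i j.
    by exfalso; apply: (@side_point_inj i j ij _ e); lia.
  by exfalso; apply: (@side_point_inj j i ij _ (esym e)); lia.
- apply/andP; split; first by apply/eqP => /=; lia.
  apply/allP => _ /mapP [i _ ->].
  have := side_row_bounds i; rewrite /side_point.
  by case: ifP => _ h /=; apply/eqP; lia.
move=> g /size3P [a [b [c ->]]]; rewrite sz => gd.
rewrite /two_sides /= count_map andbT !addn0; set P := preim _ _.
have PE i : P i = if odd i then [&& a <= side_row i, b == 0 & c <= d - side_row i]
                  else [&& a == 0, b <= side_row i & c <= d - side_row i].
  by rewrite /P /= /side_point; case: ifP => _; rewrite /dvd_exp /= ?leqn0 andbT.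
(* A power of the third variable divides the vertex and the points of the rows up to d - c; with a
   or b positive only one side is left, with both positive nothing. *)
rewrite !leqn0; case: (posnP a) => [a0|ap]; case: (posnP b) => [b0|bp] /=.
- have -> : c <= d by rewrite a0 b0 /= in gd; lia.
  rewrite add1n /=; set N := count _ _ => _.
  have cN : N <= ((d - c) * n.-1).-1 %/ d.
    apply: (@count_iota_le _ _ _ 1) => i hi; rewrite PE a0 b0 /= => h.
    have rd : side_row i <= d - c.
      by have := side_row_bounds i; move: h; case: ifP => _ /=; lia.
    have il : i < n.-1.
      rewrite ltn_neqAle; apply/andP; split; last by lia.
      apply: contraTneq rd => ->; rewrite side_row_last; rewrite a0 b0 /= in gd; lia.
    move: rd; rewrite side_row_floor // ltn_divLR; last by lia.
    by move=> lt; rewrite add1n ltnS leq_divRL; rewrite a0 b0 /= in gd; lia.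
  move: cN; rewrite leq_divRL; last by rewrite a0 b0 /= in gd; lia.
  rewrite a0 b0 /= !add0n in gd *; move=> cN.
  have : 0 < (d - c) * n.-1 by rewrite muln_gt0; lia.
  have : (d - c) * n.-1 + c * n.-1 = d * n.-1 by rewrite -mulnDl subnK //; lia.
  lia.
- rewrite add0n => c2; rewrite a0 in PE *.
  have Pb i : P i -> odd i = false by rewrite PE; case: ifP => // _; rewrite (gtn_eqF bp) andbF.
  have [i [j [i1 jn Pi Pj ij]]] := count_parity_gap Pb (ltnW c2).
  have := Pj; have := Pi; rewrite !PE (Pb _ Pi) (Pb _ Pj) /= => /andP[bi ci] /andP[bj cj].
  rewrite /= !add0n addn0 in gd *.
  have := @side_row_gap i j (count P (iota 1 n.-1)).-1 (d - (b + c)).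
  have -> : (d - (b + c)) * n.-1 = d * n.-1 - (b + c) * n.-1 by rewrite mulnBl.
  have : (b + c) * n.-1 <= d * n.-1 by rewrite leq_mul2r; lia.
  have := side_row_bounds j.
  rewrite [d * _.-1]mulnC; lia.
- rewrite add0n => c2; rewrite b0 in PE *.
  have Pb i : P i -> odd i = true by rewrite PE; case: ifP => // _; rewrite (gtn_eqF ap).
  have [i [j [i1 jn Pi Pj ij]]] := count_parity_gap Pb (ltnW c2).
  have := Pj; have := Pi; rewrite !PE (Pb _ Pi) (Pb _ Pj) /= => /andP[bi ci] /andP[bj cj].
  rewrite /= !add0n addn0 in gd *.
  have := @side_row_gap i j (count P (iota 1 n.-1)).-1 (d - (a + c)).
  have -> : (d - (a + c)) * n.-1 = d * n.-1 - (a + c) * n.-1 by rewrite mulnBl.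
  have : (a + c) * n.-1 <= d * n.-1 by rewrite leq_mul2r; lia.
  have := side_row_bounds j.
  rewrite [d * _.-1]mulnC; lia.
rewrite count0P // => i; rewrite PE; case: ifP => _; first by rewrite (gtn_eqF bp) andbF.
by rewrite (gtn_eqF ap).
Qed.

End TwoSides.

(* When d divides n - 1 points on two sides do not suffice: for n = d + 1 and     *)
(* n = 2 d + 1 one of them is replaced by (2, d - 2, 0), on the third side.        *)
Section OneExtraPoint.

Variable d : nat.

Definition left_point t := [:: t; 0; d - t].
Definition right_point t := [:: 0; t; d - t].

(** The parity puts the point of height d at the vertex (d, 0, 0). *)
Definition zigzag_point t := if odd t == odd d then left_point t else right_point t.

Definition zigzag := [:: [:: 0; 0; d], [:: 2; d - 2; 0] &
  [seq zigzag_point t | t <- iota 2 d.-1]].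

Lemma zigzag_spread : 5 <= d -> spread ltn 3 d zigzag /\ size zigzag = d.+1.
Proof.
move=> d5; have sz : size zigzag = d.+1 by rewrite /= size_map size_iota; lia.
split=> //; split.
- rewrite /= map_inj_in_uniq ?iota_uniq ?andbT ?inE.
    rewrite negb_or; apply/andP; split.
      apply/andP; split; first by apply/eqP => - []; lia.
      apply/negP => /mapP [i]; rewrite mem_iota /zigzag_point.
      by case: ifP => _ b [] *; lia.
    apply/negP => /mapP [i]; rewrite mem_iota /zigzag_point.
    by case: ifP => _ b [] *; lia.
  move=> i j; rewrite !mem_iota /zigzag_point => hi hj.
  by case: ifP => _; case: ifP => _ [] *; lia.
- apply/andP; split; first by apply/eqP => /=; lia.
  apply/andP; split; first by apply/eqP => /=; lia.
  apply/allP => y /mapP [i]; rewrite mem_iota => hi ->.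
  by rewrite /zigzag_point; case: ifP => _ /=; apply/eqP; lia.
move=> g /size3P [a [b [c ->]]]; rewrite sz => gd.
rewrite /zigzag /= count_map andbT !addn0; set P := preim _ _.
have PE i : P i = if odd i == odd d then [&& a <= i, b == 0 & c <= d - i]
                  else [&& a == 0, b <= i & c <= d - i].
  by rewrite /P /= /zigzag_point; case: ifP => _; rewrite /dvd_exp /= ?leqn0 andbT.
rewrite /dvd_exp /= !leqn0 andbT; set N := count P _ => c2.
(* As n - 1 = d, the criterion says that g has at most d - deg g multiples. *)
suff : (([&& a == 0, b == 0 & c <= d] : nat) + ([&& a <= 2, b <= d - 2 & c == 0] + N)
   <= d - (a + b + c)).
  move: c2; set M := (_ + _) => M2 Md.
  have : d * M.-1 < d * (d - (a + b + c)) by rewrite ltn_mul2l; lia.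
  have : d * (d - (a + b + c)) + (a + b + c) * d = d * d.
    by rewrite [(_ + _ + _) * d]mulnC -mulnDr; congr (_ * _); move: gd => /=; lia.
  move: gd => /=; nia.
rewrite /= addn0 in gd; move: c2.
case: (posnP a) => [a0|ap]; case: (posnP b) => [b0|bp] /=.
- have : N <= (d - c).-1.
    apply: (@count_iota_le _ _ _ 2) => i hi; rewrite PE a0 b0 /=.
    by case: ifP => _ /=; lia.
  lia.
- have NP : N <= (d - c - (odd (d - c) == odd d) - b)./2.+1.
    apply: (@count_parity_le _ (~~ odd d)) => i.
      by rewrite PE; case: ifP => //; [rewrite (gtn_eqF bp) andbF | case: (odd i); case: (odd d)].
    move=> hi; rewrite PE; case: ifP => h1; first by rewrite (gtn_eqF bp) andbF.
    by rewrite a0 /=; case: eqP => h2; lia.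
  move=> c2; rewrite -divn2 in NP; lia.
- have NP : N <= (d - c - a)./2.+1.
    apply: (@count_parity_le _ (odd d)) => i.
      by rewrite PE; case: ifP => [/eqP //|]; rewrite (gtn_eqF ap).
    move=> hi; rewrite PE; case: ifP => h1; last by rewrite (gtn_eqF ap).
    by lia.
  move=> c2; rewrite -divn2 in NP; lia.
have -> : N = 0.
  apply: count0P => i; rewrite PE.
  by case: ifP => _; rewrite ?(gtn_eqF ap) // (gtn_eqF bp) andbF.
lia.
Qed.

Definition full_sides := [:: [:: 0; 0; d], [:: 2; d - 2; 0] &
  [seq left_point t | t <- iota 1 d] ++ [seq right_point t | t <- iota 2 d.-1]].

Lemma full_sides_spread : 4 <= d ->
  spread ltn 3 d full_sides /\ size full_sides = (2 * d).+1.
Proof.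
move=> d4; have sz : size full_sides = (2 * d).+1.
  by rewrite /= size_cat !size_map !size_iota; lia.
split=> //; split.
- rewrite /= cat_uniq !map_inj_in_uniq ?iota_uniq ?andbT ?inE /=; first last.
  + by move=> i j; rewrite !mem_iota => hi hj [] *; lia.
  + by move=> i j; rewrite !mem_iota => hi hj [] *; lia.
  rewrite !mem_cat !negb_or; apply/and3P; split.
  + by apply/andP; split; apply/negP => /mapP [i]; rewrite mem_iota => hi [] *; lia.
  + by apply/andP; split; apply/negP => /mapP [i]; rewrite mem_iota => hi [] *; lia.
  + apply/hasPn => _ /mapP [i hi ->]; apply/negP => /mapP [j]; move: hi.
    by rewrite !mem_iota => hi hj [] *; lia.
- apply/allP => y; rewrite !inE mem_cat => /or4P[/eqP ->|/eqP ->|/mapP [i]|/mapP [i]].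
  + by apply/eqP => /=; lia.
  + by apply/eqP => /=; lia.
  + by rewrite mem_iota => hi ->; apply/eqP => /=; lia.
  + by rewrite mem_iota => hi ->; apply/eqP => /=; lia.
move=> g /size3P [a [b [c ->]]]; rewrite sz => gd.
rewrite /full_sides /= count_cat !count_map andbT !addn0.
set P1 := preim left_point _; set P2 := preim right_point _.
have P1E i : P1 i = [&& a <= i, b == 0 & c <= d - i].
  by rewrite /P1 /dvd_exp /= leqn0 andbT.
have P2E i : P2 i = [&& a == 0, b <= i & c <= d - i].
  by rewrite /P2 /dvd_exp /= leqn0 andbT.
rewrite /dvd_exp /= !leqn0 andbT; set N1 := count P1 _; set N2 := count P2 _ => c2.
(* As n - 1 = 2 d, at most 2 (d - deg g) multiples are allowed. *)
suff : (([&& a == 0, b == 0 & c <= d] : nat) +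
   ([&& a <= 2, b <= d - 2 & c == 0] + (N1 + N2)) <= 2 * (d - (a + b + c))).
  move: c2; set M := (_ + _) => M2 Md.
  have : d * M.-1 < d * (2 * (d - (a + b + c))) by rewrite ltn_mul2l; lia.
  have : d * (2 * (d - (a + b + c))) + (a + b + c) * (2 * d) = d * (2 * d).
    have : d - (a + b + c) + (a + b + c) = d by move: gd => /=; lia.
    by move: (d - (a + b + c)) (a + b + c) => u s <-; nia.
  move: gd => /=; nia.
rewrite /= addn0 in gd; move: c2.
have N1a : b = 0 -> N1 <= (d - c - maxn a 1).+1.
  move=> b0; apply: (@count_iota_le _ _ _ (maxn a 1)) => i hi; rewrite P1E; lia.
have N2a : a = 0 -> N2 <= (d - c - maxn b 2).+1.
  move=> b0; apply: (@count_iota_le _ _ _ (maxn b 2)) => i hi; rewrite P2E; lia.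
have N1b : 0 < b -> N1 = 0.
  by move=> bp; apply: count0P => i; rewrite P1E (gtn_eqF bp) andbF.
have N2b : 0 < a -> N2 = 0 by move=> ap; apply: count0P => i; rewrite P2E (gtn_eqF ap).
(* For g of exponents (0, 0, d - 1) the bound is 2; it holds because the right side has no point of
   height 1. *)
have N2c : a = 0 -> b = 0 -> d - c = 1 -> N2 = 0.
  move=> a0 b0 dc; apply/eqP; rewrite -leqn0; apply: (@count_iota_le _ _ _ 0) => i hi.
  by rewrite P2E; lia.
lia.
Qed.

End OneExtraPoint.

Lemma count_allpairs (S T : Type) (U : Type) (p : pred U) (f : S -> T -> U)
    (s : seq S) (t : S -> seq T) :
  count p [seq f x y | x <- s, y <- t x] = \sum_(x <- s) count (fun y => p (f x y)) (t x).
Proof.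
by elim: s => [|x s IH]; rewrite ?big_nil // big_cons /= count_cat IH count_map.
Qed.

Lemma size_allpairs_sum (S T : Type) (U : Type) (f : S -> T -> U)
    (s : seq S) (t : S -> seq T) :
  size [seq f x y | x <- s, y <- t x] = \sum_(x <- s) size (t x).
Proof. by rewrite -(count_predT (allpairs_dep _ _ _)) count_allpairs; apply: eq_bigr => x _; rewrite count_predT. Qed.

Lemma leq_sum_shift (F G : nat -> nat) m c M : (forall j, j < c -> F j = 0) ->
  (forall i, i < m -> F (i + c) <= G i) -> (forall i, M <= i -> G i = 0) ->
  \sum_(0 <= j < m) F j <= \sum_(i < M) G i.
Proof.
move=> F0 FG G0.
have [mc|cm] := leqP m c.
  by rewrite big_nat_cond big1 // => j /andP[/andP[_ jm] _]; apply: F0; apply: leq_trans mc.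
rewrite (big_cat_nat (n := c)) ?(ltnW cm) //= big_nat_cond big1; last first.
  by move=> j /andP[/andP[_ jm] _]; apply: F0.
rewrite add0n -{1}[c]add0n big_addn big_mkord.
apply: (@leq_trans (\sum_(i < m - c) G i)).
  by apply: leq_sum => i _; apply: FG; apply: leq_trans (ltn_ord i) (leq_subr _ _).
rewrite -(big_mkord xpredT G) -[X in _ <= X](big_mkord xpredT G).
have [le|lt] := leqP (m - c) M; first by rewrite [X in _ <= X](big_cat_nat (n := m - c)) //= leq_addr.
rewrite (big_cat_nat (n := M)) ?(ltnW lt) //= [X in _ + X]big_nat_cond [X in _ + X]big1 ?addn0 //.
by move=> j /andP[/andP[Mj _] _]; apply: G0.
Qed.

(** * Three variables: more than 2 d + 1 monomials *)

Section RowByRow.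

Variables d k q : nat.
Hypotheses (kd : k < d) (q0 : 0 < q) (qd : q <= d - k - 1).

(** Row j has d - j - 1 points strictly between the two sides; row 0 lies on the third side. *)
Definition width j := if j < k then d - j - 1 else if j == k then q else 0.

(* Both sides, then the first interior points row by row; k is the last, partially *)
(* filled, row.                                                                    *)
Definition row_fill := [seq [:: d - j; 0; j] | j <- iota 0 d.+1] ++
  ([seq [:: 0; d - j; j] | j <- iota 0 d] ++
   [seq [:: a; d - j - a; j] | j <- iota 0 d, a <- iota 1 (width j)]).

Lemma width_le j : width j <= d - j - 1.
Proof. by rewrite /width; case: ifP => // _; case: eqP => // ->. Qed.

Lemma sum_width : \sum_(0 <= j < d) width j = \sum_(i < k) (d - i - 1) + q.
Proof.
rewrite (big_cat_nat (n := k)) ?(ltnW kd) //= [X in _ + X]big_ltn // /width ltnn eqxx.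
rewrite big_nat_cond [X in _ + (_ + X)]big_nat_cond [X in _ + (_ + X)]big1 ?addn0.
  rewrite -big_nat_cond big_mkord; congr (_ + _); apply: eq_bigr => i _.
  by rewrite ltn_ord.
by move=> i /andP[/andP[ki _] _]; rewrite ltnNge ltnW //= gtn_eqF.
Qed.

Lemma size_row_fill : size row_fill = (2 * d).+1 + (\sum_(i < k) (d - i - 1) + q).
Proof.
rewrite !size_cat !size_map !size_iota size_allpairs_sum.
rewrite (eq_bigr width) => [|j _]; last by rewrite size_iota.
by have := sum_width; rewrite /index_iota subn0 => ->; lia.
Qed.

Lemma sum_row_lengths (e m : nat) : m <= e ->
  2 * (\sum_(i < m) (e - i)) + m * m = m * (2 * e + 1).
Proof.
elim: m => [|m IH] me; first by rewrite big_ord0.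
by have := IH (ltnW me); rewrite big_ord_recr /=; lia.
Qed.

Lemma sum_interior_lengths m : m <= d ->
  2 * (\sum_(i < m) (d - i - 1)) + m * m + m = 2 * m * d.
Proof.
elim: m => [|m IH] md; first by rewrite big_ord0; lia.
by have := IH (ltnW md); rewrite big_ord_recr /=; lia.
Qed.

(** With e = d - deg g the criterion reads d (M - 1) < e (n - 1), M being the number of multiples of
    g; the factor of d on the left bounds M - 1. *)
Lemma row_fill_ineq e x : 0 < e < d -> x <= q -> x <= e - k ->
  d * (e + \sum_(i < k) (e - i) + x) < e * (2 * d + (\sum_(i < k) (d - i - 1) + q)).
Proof.
move=> ed xq xe; have [ke|ek] := leqP k e.
  have h1 := sum_row_lengths ke.
  have h2 : 2 * (\sum_(i < k) (d - i - 1)) + k * k + k = 2 * k * d.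
    exact: sum_interior_lengths (ltnW kd).
  move: h1 h2; move: (\sum_(i < k) (e - i)) (\sum_(i < k) (d - i - 1)) => S W h1 h2.
  have [s es] : exists s, e = k + s by exists (e - k); lia.
  have [t dt] : exists t, d = k + s + t by exists (d - e); lia.
  have [y qy] : exists y, q = x + y by exists (q - x); lia.
  have [z sz] : exists z, s = x + z by exists (s - x); lia.
  have hS : 2 * S = k * k + 2 * (k * s) + k by move: h1; rewrite es; lia.
  have hW : 2 * W + k = k * k + 2 * (k * s) + 2 * (k * t).
    by move: h2; rewrite dt; lia.
  (* Twice the difference of the two sides, as a polynomial with nonnegative coefficients in the
     slack variables. *)
  pose D := 2 * (k * s) + 2 * (s * s) + t * k + t * (k * k) + 2 * (e * y) + 2 * (t * z).
  have D0 : 0 < D.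
    rewrite /D; have [k0|kp] := posnP k.
      have : 0 < s * s by rewrite muln_gt0; lia.
      by lia.
    have : 0 < t * k by rewrite muln_gt0; lia.
    by lia.
  suff : e * (4 * d + (2 * W + k) + 2 * q) = d * (2 * e + 2 * S + 2 * x) + e * k + D by lia.
  rewrite hS hW /D qy dt es sz; lia.
(* Rows from e on contribute nothing on the left, so on the right the first e + 1 full rows
   suffice. *)
have h1 : 2 * (\sum_(i < k) (e - i)) = e * (e + 1).
  have hs := @sum_row_lengths e e (leqnn e).
  rewrite -(big_mkord xpredT (fun i => e - i)) in hs.
  rewrite -(big_mkord xpredT (fun i => e - i)) (big_cat_nat (n := e)) ?(ltnW ek) //=.
  rewrite [X in 2 * (_ + X)]big_nat_cond [X in 2 * (_ + X)]big1 ?addn0; first by lia.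
  by move=> i /andP[/andP[ei _] _]; lia.
have h2 : 2 * (\sum_(i < e.+1) (d - i - 1)) + e.+1 * e.+1 + e.+1 = 2 * e.+1 * d.
  by apply: sum_interior_lengths; lia.
have h3 : \sum_(i < e.+1) (d - i - 1) <= \sum_(i < k) (d - i - 1).
  rewrite -!(big_mkord xpredT (fun i => d - i - 1)).
  by rewrite [X in _ <= X](big_cat_nat (n := e.+1)) //= leq_addr.
have x0 : x = 0 by lia.
move: h1 h2 h3; rewrite x0 addn0.
move: (\sum_(i < k) (e - i)) (\sum_(i < k) (d - i - 1)) (\sum_(i < e.+1) (d - i - 1)).
move=> S W W' h1 h2 h3.
have [t dt] : exists t, d = e + 2 + t by exists (d - e - 2); lia.
have hW : 2 * W' + (e + 1) * (e + 2) = 2 * ((e + 1) * d) by lia.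
have le : e * W' <= e * W by rewrite leq_mul2l h3 orbT.
have e0 : 0 < e * (2 * e + 4 + 3 * t + e * t + 2 * q) by rewrite muln_gt0; lia.
suff : e * (4 * d + (2 * W' + (e + 1) * (e + 2)) + 2 * q) =
  d * (2 * e + 2 * S) + e * ((e + 1) * (e + 2)) +
  e * (2 * e + 4 + 3 * t + e * t + 2 * q) by lia.
rewrite hW h1 dt; lia.
Qed.

Lemma row_fill_spread : spread ltn 3 d row_fill.
Proof.
have d2 : 2 <= d by lia.
split.
- rewrite /row_fill cat_uniq; apply/and3P; split.
  + by rewrite map_inj_in_uniq ?iota_uniq // => i j; rewrite !mem_iota => hi hj [] *; lia.
  + apply/hasPn => y; rewrite mem_cat => /orP[/mapP [i]|/allpairsPdep [i [a [+ + ->]]]].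
      rewrite mem_iota => hi ->; apply/negP => /mapP [j].
      by rewrite mem_iota => hj [] *; lia.
    rewrite !mem_iota => hi ha; apply/negP => /mapP [j]; rewrite mem_iota => hj [] *.
    by have := width_le i; lia.
  rewrite cat_uniq; apply/and3P; split.
  + by rewrite map_inj_in_uniq ?iota_uniq // => i j; rewrite !mem_iota => hi hj [] *; lia.
  + apply/hasPn => y /allpairsPdep [i [a [+ + ->]]]; rewrite !mem_iota => hi ha.
    by apply/negP => /mapP [j]; rewrite mem_iota => hj [] *; lia.
  apply: allpairs_uniq_dep; first exact: iota_uniq.
    by move=> i _; apply: iota_uniq.
  move=> [i a] [j b] /allpairsPdep [i' [a' [hi ha [-> ->]]]].
  by move=> /allpairsPdep [j' [b' [hj hb [-> ->]]]] /= [-> _ ->].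
- apply/allP => y; rewrite /row_fill !mem_cat => /or3P[/mapP [i]|/mapP [i]|].
  + by rewrite mem_iota => hi ->; apply/eqP => /=; lia.
  + by rewrite mem_iota => hi ->; apply/eqP => /=; lia.
  move=> /allpairsPdep [i [a [+ + ->]]]; rewrite !mem_iota => hi ha.
  by have := width_le i => wi; apply/eqP => /=; lia.
move=> g /size3P [a [b [c ->]]]; rewrite size_row_fill => gd.
rewrite /row_fill !count_cat !count_map count_allpairs.
set N1 := count _ _; set N2 := count _ _; set N3 := \sum_(_ <- _) _ => _.
rewrite /= addn0 in gd.
pose e := d - (a + (b + c)).
have de : d = e + (a + (b + c)) by rewrite /e; lia.
set W := \sum_(i < k) (d - i - 1) + q.
suff main : d * (N1 + (N2 + N3)).-1 < e * (2 * d + W).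
  rewrite /= addn0 -/W.
  by rewrite [X in _ < X * _]de [X in _ < X]mulnDl ltn_add2r.
pose cnt j := count (fun x => dvd_exp [:: a; b; c] [:: x; d - j - x; j]) (iota 1 (width j)).
have N3E : N3 = \sum_(0 <= j < d) cnt j by rewrite /index_iota subn0.
have cntc j : j < c -> cnt j = 0.
  by move=> jc; apply: count0P => x; rewrite /dvd_exp /= [c <= j]leqNgt jc !andbF.
have cnt1 j : cnt j <= width j by rewrite -[X in _ <= X](size_iota 1) count_size.
have cnt2 j : 0 < a + b -> c <= j ->
    cnt j <= (e + c - j) + ((0 < a) && (0 < b) && (j <= e + c)).
  move=> ab cj; apply: (@count_iota_le _ _ _ (maxn 1 a)) => x hx.
  rewrite /dvd_exp /= andbT => /and3P[ax bx _]; have := width_le j; lia.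
have N1a : 0 < b -> N1 = 0.
  by move=> bp; apply: count0P => x; rewrite /= /dvd_exp /= leqn0 (gtn_eqF bp) andbF.
have N1b : N1 <= e.+1.
  have [b0|/N1a -> //] := posnP b.
  by apply: (@count_iota_le _ _ _ c) => i hi; rewrite /= /dvd_exp /=; lia.
have N2a : 0 < a -> N2 = 0.
  by move=> ap; apply: count0P => x; rewrite /= /dvd_exp /= leqn0 (gtn_eqF ap).
have N2b : N2 <= e + (0 < b).
  have [a0|/N2a -> //] := posnP a.
  by apply: (@count_iota_le _ _ _ c) => i hi; rewrite /= /dvd_exp /=; lia.
have [ab0|abp] := posnP (a + b).
  have N3b : N3 <= \sum_(c <= j < d) width j.
    rewrite N3E (big_cat_nat (n := c)) //=; last by lia.
    rewrite big_nat_cond big1 => [|j /andP[/andP[_ /cntc]] //].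
    by apply: leq_sum => j _; apply: cnt1.
  have WE : W = \sum_(0 <= j < c) width j + \sum_(c <= j < d) width j.
    by rewrite /W -sum_width -big_cat_nat //=; lia.
  set Y := \sum_(0 <= j < c) width j in WE.
  set Z := \sum_(c <= j < d) width j in N3b WE.
  have Zb : Z <= e * (e - 1).
    rewrite -[e in e * _](_ : d - c = e); last by lia.
    rewrite -sum_nat_const_nat /Z big_nat_cond [X in _ <= X]big_nat_cond.
    by apply: leq_sum => j hj; have := width_le j; lia.
  (* A comparison of mean widths: if c <= k, the c rows below row c have width at least e, the other
     e rows at most e - 1. *)
  have Yb : c * Z < e * Y.
    have [kc|ck] := ltnP k c.
      have -> : Z = 0.
        rewrite /Z big_nat_cond big1 // => j /andP[/andP[cj _] _].
        by rewrite /width ltnNge ltnW ?gtn_eqF //; lia.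
      rewrite muln0 muln_gt0; apply/andP; split; first by lia.
      rewrite /Y (big_cat_nat (n := k)) ?(ltnW kc) //= [X in _ + X]big_ltn //.
      by rewrite {2}/width ltnn eqxx; lia.
    have Y1 : c * e <= Y.
      rewrite -[c in c * _]subn0 -sum_nat_const_nat /Y big_nat_cond.
      rewrite [X in _ <= X]big_nat_cond; apply: leq_sum => j hj.
      by rewrite /width (_ : j < k); lia.
    apply: (@leq_trans (e * (c * e))); last by rewrite leq_mul2l Y1 orbT.
    apply: (@leq_ltn_trans (c * (e * (e - 1)))); first by rewrite leq_mul2l Zb orbT.
    have [e' ee] : exists e', e = e'.+1 by exists e.-1; lia.
    have cp : 0 < c by lia.
    have : 0 < c * e by rewrite muln_gt0 cp; lia.
    by rewrite ee subn1 /=; lia.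
  have dce : d = e + c by lia.
  have : d * (N1 + (N2 + N3)).-1 <= d * (2 * e + Z) by rewrite leq_mul2l; lia.
  move/leq_ltn_trans; apply; rewrite WE dce; lia.
(* Row i + c has at most as many multiples of g as row i would have with c = 0 and the same e. For
   a, b > 0 there may be one more per row, made up for by the absence of multiples on the sides. *)
pose G i := if i < k then (e - i) + ((0 < a) && (0 < b) && (i <= e))
  else if i == k then minn q ((e - k) + ((0 < a) && (0 < b) && (k <= e))) else 0.
have N3b : N3 <= \sum_(i < k.+1) G i.
  rewrite N3E; apply: (leq_sum_shift (c := c)) => // [i id|i ki].
    have h2 := cnt2 (i + c) abp (leq_addl _ _); rewrite subnDr leq_add2r in h2.
    have h1 := cnt1 (i + c).
    have w0 : k < i + c -> cnt (i + c) = 0.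
      move=> lt; have h := h1; rewrite /width ltnNge (ltnW lt) (gtn_eqF lt) /= in h.
      by apply/eqP; rewrite -leqn0.
    rewrite /G; case: (ltngtP i k) => [//|ki|ik]; first by rewrite w0 ?ltn_addr.
    have [c0|cp] := posnP c; last by rewrite w0 // ik -addn1 leq_add2l.
    by rewrite leq_min -ik h2 andbT; move: h1; rewrite c0 addn0 ik /width ltnn eqxx.
  by rewrite /G ltnNge ltnW //= gtn_eqF.
have [x [xq xe Nx]] : exists x, [/\ x <= q, x <= e - k &
    (N1 + (N2 + N3)).-1 <= e + \sum_(i < k) (e - i) + x].
  exists (minn q (e - k)); split; [exact: geq_minl|exact: geq_minr|].
  move: N3b; rewrite big_ord_recr /= {2}/G ltnn eqxx.
  have [ap|/negbTE abF] := boolP ((0 < a) && (0 < b)); last first.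
    rewrite /= addn0 (eq_bigr (fun i : 'I_k => e - i)) => [|i _]; last first.
      by rewrite /G ltn_ord abF addn0.
    lia.
  rewrite (eq_bigr (fun i : 'I_k => (e - i) + (i <= e))) => [|i _]; last first.
    by rewrite /G ltn_ord ap.
  rewrite big_split /=.
  have : \sum_(i < k) (i <= e) <= minn k e.+1.
    rewrite leq_min; apply/andP; split.
      rewrite -[X in _ <= X]card_ord -sum1_card; apply: leq_sum => i _; exact: leq_b1.
    rewrite -(big_mkord xpredT (fun i => nat_of_bool (i <= e))) /index_iota.
    rewrite (eq_bigr (fun i => if i <= e then 1 else 0)) => [|i _]; last by case: ifP.
    rewrite -big_mkcond sum1_count.
    exact: (@count_iota_le _ _ _ 0).
  have /andP[/N2a -> /N1a ->] := ap.
  move: (\sum_(i < k) (e - i)) (\sum_(i < k) (i <= e)) => S Z.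
  by have [ke|ke] := leqP k e; rewrite /= ?addn1 ?addn0; lia.
apply: (@leq_ltn_trans (d * (e + \sum_(i < k) (e - i) + x))).
  by rewrite leq_mul2l Nx orbT.
by apply: row_fill_ineq => //; lia.
Qed.

End RowByRow.

(** * More variables: filling layers of constant first exponent *)

Fixpoint mons u d : seq (seq nat) :=
  if u is u'.+1 then [seq j :: x | j <- iota 0 d.+1, x <- mons u' (d - j)] else [:: [:: d]].

Lemma monsS u d :
  mons u.+1 d = [seq j :: x | j <- iota 0 d.+1, x <- mons u (d - j)].
Proof. by []. Qed.

Lemma mem_mons u d x : (x \in mons u d) = (size x == u.+1) && (sumn x == d).
Proof.
elim: u d x => [|u IH] d x.
  rewrite inE; case: x => [|a [|b x]] //=; first by rewrite eqseq_cons eqxx andbT addn0.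
  by rewrite eqseq_cons andbF.
rewrite monsS.
apply/allpairsPdep/idP => [[j [y [+ + ->]]]|].
  by rewrite mem_iota IH => jd /andP[/eqP sy /eqP dy] /=; rewrite sy dy eqxx; apply/eqP; lia.
case: x => [//|j y] /andP[/eqP [sy] /eqP dy]; rewrite /= in dy.
exists j, y; split=> //.
  by rewrite mem_iota; lia.
by rewrite IH sy eqxx -dy addKn eqxx.
Qed.

Lemma uniq_mons u d : uniq (mons u d).
Proof.
elim: u d => [|u IH] d //; rewrite monsS; apply: allpairs_uniq_dep.
- exact: iota_uniq.
- by move=> j _; apply: IH.
by move=> [i x] [j y] /allpairsPdep [i' [x' [_ _ [-> ->]]]]
  /allpairsPdep [j' [y' [_ _ [-> ->]]]] /= [-> ->].
Qed.

Lemma sum_bin_diag u d : \sum_(i < d.+1) 'C(d - i + u, u) = 'C(d + u.+1, u.+1).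
Proof.
elim: d => [|d IH]; first by rewrite big_ord_recl big_ord0 subn0 !add0n !binn.
rewrite big_ord_recl /= subn0 (eq_bigr (fun i : 'I_d.+1 => 'C(d - i + u, u))).
  by rewrite IH [in RHS]addSn binS addnC addSnnS.
by move=> i _; rewrite /bump /= add1n subSS.
Qed.

Lemma size_mons u d : size (mons u d) = 'C(d + u, u).
Proof.
elim: u d => [|u IH] d; first by rewrite bin0.
rewrite monsS size_allpairs_sum (eq_bigr _ (fun j _ => IH (d - j))).
by rewrite -[iota 0 d.+1]/(index_iota 0 d.+1) big_mkord sum_bin_diag.
Qed.

(** Division by g is injective into the monomials of degree d - deg g. *)
Lemma count_dvd_mons u d g : 0 < u -> size g = u.+1 ->
  count (dvd_exp g) (mons u d) <= 'C(d + u - sumn g, u).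
Proof.
move=> u0 sg; have [gd|dg] := leqP (sumn g) d; last first.
  rewrite bin_small; last by lia.
  rewrite leqNgt -has_count; apply/hasPn => x.
  rewrite mem_mons => /andP[_ /eqP xd]; apply/negP => /dvd_exp_sumn; lia.
have -> : d + u - sumn g = d - sumn g + u by lia.
rewrite -size_mons -size_filter.
rewrite -(size_map (fun x => [seq p.1 + p.2 | p <- zip g x]) (mons u (d - sumn g))).
apply: uniq_leq_size; first exact: filter_uniq (uniq_mons _ _).
move=> x; rewrite mem_filter mem_mons => /and3P[gx /eqP sx /eqP xd].
apply/mapP; exists [seq p.1 - p.2 | p <- zip x g].
  rewrite mem_mons size_map size_zip sx sg minnn eqxx /= -xd.
  elim: (g) (x) gx {sg sx xd gd} => [|a g' IHg] [|b x'] //= /andP[ab gx].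
  by have := IHg _ gx; have := dvd_exp_sumn gx => h /eqP ->; apply/eqP; lia.
elim: (g) (x) gx {sg sx xd gd} => [|a g' IHg] [|b x'] //= /andP[ab gx].
by rewrite subnKC // -IHg.
Qed.

Section LayerInequality.

Variable a : nat.
Hypothesis a0 : 0 < a.

(** Monomials of degree e - i in a + 2 variables: layer i of those of degree e in a + 3 variables.
    [face] is the growth of this number with e. *)
Definition tri i e := 'C(e + a + 1 - i, a.+1).
Definition face i e := 'C(e + a + 1 - i, a).

Lemma triS i e : tri i e.+1 = tri i e + face i e.
Proof.
rewrite /tri /face; have [le|lt] := leqP i (e + a + 1).
  by rewrite !addSn subSn // binS.
by rewrite !bin_small //; lia.
Qed.

Lemma tri_face i e : a.+1 * tri i e = (e + 1 - i) * face i e.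
Proof. by rewrite /tri /face mul_bin_left; congr (_ * _); lia. Qed.

Lemma face_anti i e : face i.+1 e <= face i e.
Proof. by apply: leq_bin2l; lia. Qed.

Lemma face_mono i e : face i e <= face i e.+1.
Proof. by apply: leq_bin2l; lia. Qed.

Lemma face0_strict e : face 0 e < face 0 e.+1.
Proof.
rewrite /face !subn0 !addSn; case: a a0 => // b _.
by rewrite binS -[X in X < _]addn0 ltn_add2l bin_gt0; lia.
Qed.

Definition tris k e := \sum_(i < k) tri i e.
Definition faces k e := \sum_(i < k) face i e.

Lemma trisS k e : tris k e.+1 = tris k e + faces k e.
Proof. by rewrite /tris /faces -big_split; apply: eq_bigr => i _; apply: triS. Qed.

(** For i >= 1, [tri_face] bounds layer i + 1 by e times [face i], so all rests on k = 1, where the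
    binomials are explicit. For a = k = 1 both sides equal (e + 1)^2. *)
Lemma tris_faces k e : 0 < k -> 0 < e ->
  tris k.+1 e + ~~ ((a == 1) && (k == 1)) <= e * faces k e + 1.
Proof.
move=> + e0; case: k => // k _; elim: k => [|k IH].
  rewrite /tris /faces !big_ord_recr !big_ord0 /= !add0n andbT.
  have T1 : a.+1 * tri 1 e = e * 'C(e + a, a).
    by rewrite tri_face /face; congr (_ * 'C(_, _)); lia.
  have T0 : tri 0 e = tri 1 e + 'C(e + a, a).
    by rewrite /tri subn0 addn1 binS; congr ('C(_, _) + _); lia.
  have F0 : face 0 e = 'C(e + a, a) + 'C(e + a, a.-1).
    by rewrite /face subn0 addn1; case: a a0 => // b _; rewrite binS.
  have Y : a * 'C(e + a, a) = e.+1 * 'C(e + a, a.-1).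
    case: a a0 => // b _; rewrite mul_bin_left; congr (_ * _); lia.
  have X0 : 0 < 'C(e + a, a) by rewrite bin_gt0; lia.
  have Y0 : 0 < 'C(e + a, a.-1) by rewrite bin_gt0; lia.
  have Z1 : a = 1 -> 'C(e + a, a.-1) = 1 by move=> ->; rewrite bin0.
  rewrite T0 F0; move: T1 Y X0 Y0 Z1.
  move: ('C(e + a, a)) ('C(e + a, a.-1)) (tri 1 e) => X Z T T1 Y X0 Y0 Z1.
  case: eqP => /= [a1|an1].
    by rewrite (Z1 a1) a1 mul1n muln1 in T1 Y *; rewrite Y in T1 *; nia.
  have a2 : 2 <= a by lia.
  have [b ab] : exists b, a = b + 2 by exists (a - 2); lia.
  suff : a.+1 * (T + X + T + 1) <= a.+1 * (e * (X + Z) + 1) by rewrite leq_mul2l.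
  have -> : a.+1 * (T + X + T + 1) = 2 * (a.+1 * T) + a * X + X + a.+1 by lia.
  rewrite T1 Y; rewrite ab; nia.
rewrite /tris big_ord_recr /= -/(tris _ _) /faces big_ord_recr /= -/(faces _ _).
have f1 : a.+1 * tri k.+2 e <= (e - 1) * face k.+1 e.
  rewrite tri_face; apply: leq_mul; [by lia | exact: face_anti].
rewrite andbF /=; have [z|f0] := posnP (face k.+1 e).
  have := IH; rewrite z muln0 in f1 *.
  have -> : tri k.+2 e = 0 by move: f1; rewrite leqn0 muln_eq0 => /eqP.
  case: k z {f1} IH => [|k] z IH.
    move: z; rewrite /face; have : 0 < 'C(e + a + 1 - 1, a) by rewrite bin_gt0; lia.
    by lia.
  by rewrite /= andbF; lia.
have lt : tri k.+2 e < e * face k.+1 e.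
  have [e' ee] : exists e', e = e'.+1 by exists e.-1; lia.
  move: f1 f0; move: (tri k.+2 e) (face k.+1 e) => T F; rewrite ee subn1 /=.
  by rewrite !mulSn; move: (a * T) (e' * F) => X Z; lia.
by have := IH; rewrite mulnDr; lia.
Qed.

(** By [grow] and [tris_faces] the difference of the sides is at least the sum of four terms: t
    unless a = k = 1, e if t >= 2, e (q - x), and t (tri k e - x). The excluded case is the one
    where all four vanish. *)
Lemma layer_ineq k e t q x : 0 < k -> 0 < e -> 0 < t -> 0 < q -> x <= q -> x <= tri k e ->
  ~~ [&& a == 1, k == 1, t == 1, x == q & x == tri k e] ->
  (e + t) * (tris k e + x).-1 < e * (tris k (e + t) + q).-1.
Proof.
move=> k0 e0 t0 q0 xq xT exc.
have grow s : tris k e + s * faces k e + (2 <= s) <= tris k (e + s).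
  have fm s' : faces k e + (0 < s') <= faces k (e + s').
    case: s' => [|s']; first by rewrite addn0 addn0.
    have ff m m' : m <= m' -> faces k m <= faces k m'.
      move=> /subnK <-; elim: (m' - m) => // i IHi; apply: leq_trans IHi _.
      by rewrite addSn; apply: leq_sum => j _; apply: face_mono.
    rewrite addn1; apply: (@leq_trans (faces k e.+1)); last by apply: ff; lia.
    rewrite /faces; case: (k) k0 => // k' _; rewrite !big_ord_recl -addSn.
    by apply: leq_add; [apply: face0_strict | apply: leq_sum => j _; apply: face_mono].
  elim: s => [|s IHs]; first by rewrite mul0n !addn0.
  rewrite addnS trisS; apply: leq_trans (leq_add IHs (fm s)).
  by rewrite mulSn; case: s {IHs} => [|[|s]] /=; lia.
have Apos : 0 < tris k e.
  rewrite /tris; case: (k) k0 => // k' _; rewrite big_ord_recl.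
  by apply: ltn_addr; rewrite /tri /= subn0 bin_gt0; lia.
have := grow t; have := tris_faces k0 e0; move: Apos.
rewrite /tris big_ord_recr /= -!/(tris _ _).
move: (tris k (e + t)) (tris k e) (faces k e) (tri k e) xT exc => A' A F T xT exc Apos h1 h2.
have h3 : e * (A + t * F + (2 <= t)) <= e * A' by rewrite leq_mul2l h2 orbT.
have h4 : t * (A + T + ~~ ((a == 1) && (k == 1))) <= t * (e * F + 1) by rewrite leq_mul2l h1 orbT.
have [y qy] : exists y, q = x + y by exists (q - x); lia.
have [z Tz] : exists z, T = x + z by exists (T - x); lia.
have pos : 0 < t * ~~ ((a == 1) && (k == 1)) + e * (2 <= t) + e * y + t * z.
  move: exc; rewrite !negb_and; case/or4P => [a1|k1|t1|/orP[xq'|xT']].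
  - by rewrite a1 /=; lia.
  - by rewrite k1 orbT /=; lia.
  - have -> : (1 < t) = true by lia.
    lia.
  - have : 0 < e * y by rewrite muln_gt0; lia.
    lia.
  - have : 0 < t * z by rewrite muln_gt0; lia.
    lia.
have -> : (A + x).-1 = A + x - 1 by lia.
have -> : (A' + q).-1 = A' + q - 1 by lia.
have [w Aw] : exists w, A + x = w + 1 by exists (A + x - 1); lia.
have h5 : e * (A' + q - 1) + e = e * A' + e * q.
  rewrite -mulnDr -[X in _ + X]muln1 -mulnDr; congr (_ * _); lia.
rewrite Aw addnK; have : (e + t) * (w + 1) = (e + t) * (A + x) by rewrite Aw.
move: h3 h4 h5 pos; rewrite qy Tz !mulnDr !mulnDl; lia.
Qed.

End LayerInequality.

Section LayerFill.

Variables a d k q : nat.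
Hypotheses (a0 : 0 < a) (k0 : 0 < k) (kd : k <= d) (q0 : 0 < q) (qk : q <= tri a k d).
Hypothesis exc : ~~ [&& a == 1, k == 1, d == 2 & q == 1].

Definition layer_fill := [seq j :: x | j <- iota 0 k, x <- mons a.+1 (d - j)] ++
  [seq k :: x | x <- take q (mons a.+1 (d - k))].

Lemma tri_size j : j <= d -> size (mons a.+1 (d - j)) = tri a j d.
Proof. by move=> jd; rewrite size_mons /tri; congr ('C(_, _)); lia. Qed.

Lemma size_layer_fill : size layer_fill = tris a k d + q.
Proof.
rewrite size_cat size_allpairs_sum size_map size_takel; last by rewrite tri_size.
rewrite -{1}[k]subn0.
rewrite -/(index_iota 0 k) big_mkord; congr (_ + _); apply: eq_bigr => i _.
by rewrite tri_size //; have := ltn_ord i; lia.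
Qed.

Lemma mons1 m : mons 1 m = [seq [:: j; m - j] | j <- iota 0 m.+1].
Proof. by rewrite monsS; elim: (iota 0 m.+1) => // j s; rewrite /= => ->. Qed.

(** For m > 0 these two monomials have no common variable, which settles the exceptional case of
    [layer_ineq]. *)
Lemma corners_in_prefix m p : m < p -> [:: 0; 0; m] \in take p (mons 2 m) /\
  [:: 0; m; 0] \in take p (mons 2 m).
Proof.
move=> mp; rewrite monsS -[iota 0 m.+1]/(0 :: iota 1 m) allpairs_cons take_cat.
rewrite !subn0 size_map size_mons addn1 bin1 ltnNge mp !mem_cat.
suff h j : j <= m -> [:: 0; j; m - j] \in [seq 0 :: x | x <- mons 1 m].
  by have := h 0; have := h m; rewrite subn0 subnn => -> // -> .
move=> jm; apply/map_f; rewrite mons1; apply/mapP; exists j => //.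
by rewrite mem_iota.
Qed.

Lemma layer_fill_spread : spread ltn a.+3 d layer_fill.
Proof.
split.
- rewrite /layer_fill cat_uniq; apply/and3P; split.
  + apply: allpairs_uniq_dep; first exact: iota_uniq.
      by move=> j _; apply: uniq_mons.
    move=> [i x] [j y] /allpairsPdep [i' [x' [_ _ [-> ->]]]].
    by move=> /allpairsPdep [j' [y' [_ _ [-> ->]]]] /= [-> ->].
  + apply/hasPn => y /mapP [x _ ->]; apply/negP => /allpairsPdep [j [z [+ _ [e _]]]].
    by rewrite mem_iota -e; lia.
  + by rewrite map_inj_uniq ?take_uniq ?uniq_mons // => x y [].
- apply/allP => y; rewrite mem_cat => /orP[/allpairsPdep [j [z [+ + ->]]]|/mapP [x + ->]].
    rewrite mem_iota mem_mons => hj /andP[/eqP sz /eqP dz] /=; rewrite sz eqxx /=.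
    by apply/eqP; lia.
  move/mem_take; rewrite mem_mons => /andP[/eqP sz /eqP dz] /=; rewrite sz eqxx /=.
  by apply/eqP; lia.
case=> [//|g0 g] /= [sg] gd; rewrite size_layer_fill.
set s := sumn g in gd *.
pose e := d - (g0 + s).
have de : d = e + (g0 + s) by rewrite /e; lia.
rewrite count_cat count_map count_allpairs.
set N1 := \sum_(_ <- _) _; set N2 := count _ _ => _.
suff main : d * (N1 + N2).-1 < e * (tris a k d + q).-1.
  by rewrite [X in _ < X * _]de [X in _ < X]mulnDl ltn_add2r.
pose F j := if j < k then count (fun x => dvd_exp (g0 :: g) (j :: x)) (mons a.+1 (d - j))
            else if j == k then N2 else 0.
have N1F : N1 = \sum_(0 <= j < k) F j.
  rewrite /N1 /index_iota subn0 big_seq [RHS]big_seq; apply: eq_bigr => j.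
  by rewrite mem_iota add0n /F => /andP[_ ->].
have NF : N1 + N2 = \sum_(0 <= j < k.+1) F j.
  by rewrite big_nat_recr //= -N1F /F ltnn eqxx.
have N2c : N2 <= count (fun x => dvd_exp (g0 :: g) (k :: x)) (mons a.+1 (d - k)).
  rewrite -[X in _ <= count _ X](cat_take_drop q) count_cat.
  exact: leq_addr.
have cj j : j <= d -> g0 <= j ->
    count (fun x => dvd_exp (g0 :: g) (j :: x)) (mons a.+1 (d - j)) <= tri a (j - g0) e.
  move=> jd gj; rewrite (eq_count (a2 := dvd_exp g)); last first.
    by move=> x; rewrite /dvd_exp /= gj.
  apply: leq_trans (count_dvd_mons _ _ sg) _ => //.
  by rewrite /tri -/s; apply: leq_bin2l; lia.
have Fj i : i + g0 <= k -> F (i + g0) <= tri a i e.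
  move=> ik; rewrite -{2}[i](addnK g0) /F; case: ltngtP ik => // [ik _|ik _].
    by apply: cj; lia.
  by apply: leq_trans N2c _; rewrite -ik; apply: cj; lia.
have F0 j : j < g0 -> F j = 0.
  have z j' : j' < g0 -> forall x, dvd_exp (g0 :: g) (j' :: x) = false.
    by move=> jg x; rewrite /dvd_exp /= leqNgt jg.
  move=> jg; rewrite /F; case: ifP => _; first by rewrite count0P // => x; apply: z.
  case: eqP => // jk; rewrite /N2 count0P // => x /=; apply: z.
  by rewrite -jk.
have [gz|gp] := posnP g0.
  rewrite gz add0n in de.
  have N1b : N1 <= tris a k e.
    rewrite N1F big_mkord; apply: leq_sum => i _.
    by have := Fj i; rewrite gz addn0; apply; apply: ltnW.
  have N2b : N2 <= tri a k e.
    by have := Fj k; rewrite gz addn0 /F ltnn eqxx; apply.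
  have N2q : N2 <= q.
    by apply: leq_trans (count_size _ _) _; rewrite size_take_min geq_minl.
  apply: (@leq_ltn_trans (d * (tris a k e + N2).-1)).
    by rewrite leq_mul2l; apply/orP; right; lia.
  rewrite de; apply: layer_ineq => //; try by lia.
  (* In the exceptional case g is one of the last three variables and divides all q monomials of
     layer 1; unless e = 1, the case ruled out by [exc], two of them are coprime. *)
  apply/negP => /and5P[/eqP a1 /eqP k1 /eqP s1 /eqP Nq /eqP NT].
  have qC : q = 'C(e.+1, 2).
    by rewrite -Nq NT /tri a1 k1; congr ('C(_, _)); lia.
  have e2 : 2 <= e.
    rewrite ltnNge; apply/negP => e1; case/negP: exc; rewrite a1 k1 /=.
    have e11 : e = 1 by lia.
    by rewrite qC e11 de s1 e11.
  have eq : e < q.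
    by rewrite qC bin2 /= -divn2 leq_divRL //; nia.
  have [c1 c2] := corners_in_prefix eq.
  have dk : d - k = e by lia.
  have all_dvd : all (dvd_exp g) (take q (mons 2 e)).
    rewrite all_count size_takel; last first.
      by rewrite size_mons addn2 qC; apply: leq_bin2l.
    by rewrite -{2}Nq /N2 a1 dk gz; apply/eqP; apply: eq_count => x; rewrite /= /dvd_exp.
  have := allP all_dvd _ c1; have := allP all_dvd _ c2.
  move: sg s1; rewrite a1 /s => /size3P [x [y [z ->]]] /=.
  by rewrite /dvd_exp /=; lia.
(* Division by g lowers the layers by g0 > 0, so at most k layers are hit and [layer_ineq] applies
   with x = 0. *)
have Nb : N1 + N2 <= tris a k e + 0.
  rewrite addn0 NF.
  have -> : tris a k e = \sum_(i < k) (if i < k then tri a i e else 0).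
    by apply: eq_bigr => i _; rewrite ltn_ord.
  apply: (@leq_sum_shift F (fun i => if i < k then tri a i e else 0) k.+1 g0 k) => // i ik;
    last by rewrite ltnNge ik.
  case: ltnP => ik'; last first.
    have lt : k < i + g0 by rewrite -addn1; apply: leq_add.
    by rewrite /F ltnNge (ltnW lt) (gtn_eqF lt).
  have [le|lt] := leqP (i + g0) k; first exact: Fj.
  by rewrite /F ltnNge (ltnW lt) (gtn_eqF lt).
apply: (@leq_ltn_trans (d * (tris a k e + 0).-1)).
  by rewrite leq_mul2l; apply/orP; right; lia.
rewrite de; apply: layer_ineq => //; try by lia.
Qed.

End LayerFill.

(** * Small cases by computation, and the choice of the family *)

Fixpoint grid v b : seq (seq nat) :=
  if v is v'.+1 then [seq j :: x | j <- iota 0 b, x <- grid v' b] else [:: [::]].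

Lemma mem_grid v b g : size g = v -> sumn g < b -> g \in grid v b.
Proof.
elim: v g => [|v IH] [|j g] //= [sg] gb.
apply/allpairsPdep; exists j, g; split=> //; first by rewrite mem_iota; lia.
by apply: IH => //; lia.
Qed.

Definition spread_check (cmp : rel nat) v d (L : seq (seq nat)) :=
  [&& uniq L, all (fun x => (size x == v) && (sumn x == d)) L &
  all (fun g => (0 < sumn g < d) ==> (2 <= count (dvd_exp g) L) ==>
        cmp (d * (count (dvd_exp g) L).-1 + sumn g * (size L).-1) (d * (size L).-1))
    (grid v d)].

Lemma spread_checkP (cmp : rel nat) v d L : spread_check cmp v d L -> spread cmp v d L.
Proof.
case/and3P => uL aL /allP h; split=> // g sg gd c2.
have gG : g \in grid v d by apply: mem_grid => //; case/andP: gd.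
by have := h g gG; rewrite gd c2.
Qed.

(** The first variable divides three of the five monomials, and 2 * 2 + 1 * 4 = 2 * 4 is an
    equality. *)
Lemma conics5_spread :
  spread leq 3 2 [:: [:: 2; 0; 0]; [:: 0; 2; 0]; [:: 0; 0; 2]; [:: 1; 1; 0]; [:: 1; 0; 1]].
Proof. exact: spread_checkP. Qed.

Lemma plane_spread d n : 0 < d -> 3 <= n <= 'C(d + 2, 2) -> (d, n) <> (2, 5) ->
  exists L, spread ltn 3 d L /\ size L = n.
Proof.
move=> d0 /andP[n3 nC] exc; have [big|small] := ltnP (2 * d).+1 n.
  have [|k [q [kd /andP[q0 qk] nq]]] := @prefix_sum (fun i => d - i - 1) d (n - (2 * d).+1).
    apply/andP; split; first by lia.
    have h : forall m, m <= d -> 2 * (\sum_(i < m) (d - i - 1)) + m * m + m = 2 * m * d.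
      elim=> [|m IH] md; first by rewrite big_ord0; lia.
      by have := IH (ltnW md); rewrite big_ord_recr /=; lia.
    move: nC; rewrite bin2 addn2 -divn2 leq_divRL //= => nC.
    apply: (@leq_trans (\sum_(i < d) (d - i - 1))); last by [].
    by move: (\sum_(i < d) _) (h d (leqnn d)) => S hS; lia.
  exists (row_fill d k q); split; first exact: row_fill_spread.
  by rewrite size_row_fill // -nq; lia.
have [dn|ndn] := boolP (d %| n.-1); last first.
  exists (two_sides d n); apply: two_sides_spread => //.
  have [//|n1] := leqP n (2 * d).
  by case/negP: ndn; rewrite (_ : n.-1 = 2 * d) ?dvdn_mull //; lia.
have [nd|nd] : n = d.+1 \/ n = (2 * d).+1.
  have /dvdnP [c nc] := dn; have : c <= 2.
    by rewrite -(leq_pmul2r d0); lia.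
  by case: c nc => [|[|[|c]]] //= nc _; lia.
- have [d5|] := leqP 5 d; first by exists (zigzag d); rewrite nd; apply: zigzag_spread.
  case: d nd d0 {nC exc small dn} => [|[|[|[|[|d]]]]] // nd _ _; rewrite nd in n3 *.
  + by [].
  + exists [:: [:: 2; 0; 0]; [:: 0; 2; 0]; [:: 0; 0; 2]]; split=> //.
    exact: spread_checkP.
  + exists [:: [:: 3; 0; 0]; [:: 0; 3; 0]; [:: 0; 0; 3]; [:: 1; 1; 1]]; split=> //.
    exact: spread_checkP.
  + exists [:: [:: 4; 0; 0]; [:: 0; 4; 0]; [:: 0; 0; 4]; [:: 2; 1; 1]; [:: 0; 2; 2]].
    by split=> //; exact: spread_checkP.
have [d4|] := leqP 4 d; first by exists (full_sides d); rewrite nd; apply: full_sides_spread.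
case: d nd d0 exc {nC small dn} => [|[|[|[|d]]]] // nd _ exc _; rewrite nd.
- exists [:: [:: 1; 0; 0]; [:: 0; 1; 0]; [:: 0; 0; 1]]; split=> //.
  exact: spread_checkP.
- by case: exc; rewrite nd.
exists [:: [:: 3; 0; 0]; [:: 0; 3; 0]; [:: 0; 0; 3]; [:: 1; 1; 1];
           [:: 2; 1; 0]; [:: 0; 2; 1]; [:: 1; 0; 2]].
by split=> //; exact: spread_checkP.
Qed.

(** The family uses M + 1 variables, with M least such that they have n monomials of degree d. By
    minimality n exceeds the size of layer 0, so the last layer reached has k > 0. *)
Lemma exists_spread N d n : 2 <= N -> 0 < d -> N.+1 <= n <= 'C(d + N, N) ->
  (N, d, n) <> (2, 2, 5) ->
  exists v L, [/\ v <= N.+1, spread ltn v d L & size L = n].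
Proof.
move=> N2 d0 /andP[Nn nC] exc.
have [le|gt] := leqP n 'C(d + 2, 2).
  case: (eqVneq (d, n) (2, 5)) => [[d2 n5]|/eqP ne]; last first.
    have rng : 3 <= n <= 'C(d + 2, 2) by rewrite le andbT; lia.
    have [L [sL zL]] := plane_spread d0 rng ne.
    by exists 3, L.
  have N3 : 3 <= N.
    by rewrite ltn_neqAle N2 andbT; apply: contra_not_neq exc => <-; rewrite d2 n5.
  exists 4, [:: [:: 2; 0; 0; 0]; [:: 0; 2; 0; 0]; [:: 0; 0; 2; 0]; [:: 0; 0; 0; 2];
                [:: 1; 1; 0; 0]].
  by rewrite d2 n5; split=> //; exact: spread_checkP.
have ex : exists M, n <= 'C(d + M, M) by exists N.
have [M nM minM] := ex_minnP ex.
have MN : M <= N by apply: minM.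
have M3 : 3 <= M.
  rewrite ltnNge; apply/negP => M2; move: nM; rewrite leqNgt => /negP; apply.
  apply: leq_trans gt; rewrite ltnS -(@bin_sub (d + M)) ?leq_addl // addnK.
  by rewrite -(@bin_sub (d + 2)) ?leq_addl // addnK; apply: leq_bin2l; lia.
have [a Ma] : exists a, M = a.+2 by exists (M - 2); lia.
have a0 : 0 < a by lia.
have lt : 'C(d + a.+1, a.+1) < n.
  by rewrite ltnNge; apply/negP => h; have := minM _ h; lia.
have tE i : i < d.+1 -> tri a i d = 'C(d - i + a.+1, a.+1).
  by move=> id; rewrite /tri; congr ('C(_, _)); lia.
have [|k [q [kd /andP[q0 qk] nq]]] := @prefix_sum (fun i => tri a i d) d.+1 n.
  rewrite (eq_bigr (fun i : 'I_d.+1 => 'C(d - i + a.+1, a.+1))) => [|i _].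
    by rewrite sum_bin_diag -Ma nM; lia.
  exact: tE.
have k0 : 0 < k.
  rewrite lt0n; apply: contraTneq lt => kz.
  by rewrite -leqNgt nq kz big_ord0 add0n -[d in X in _ <= X]subn0 -tE // -kz.
have [E|NE] := boolP [&& a == 1, k == 1, d == 2 & q == 1].
  have /and4P[/eqP a1 /eqP k1 /eqP d2 /eqP q1] := E.
  have n7 : n = 7 by rewrite nq k1 q1 a1 d2 big_ord_recl big_ord0.
  exists 4, [:: [:: 2; 0; 0; 0]; [:: 0; 2; 0; 0]; [:: 0; 0; 2; 0]; [:: 0; 0; 0; 2];
                [:: 1; 1; 0; 0]; [:: 0; 0; 1; 1]; [:: 1; 0; 1; 0]].
  rewrite d2 n7; split=> //; [lia | exact: spread_checkP].
exists a.+3, (layer_fill a d k q); split; first by lia.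
  by apply: layer_fill_spread.
by rewrite size_layer_fill // -nq.
Qed.

(** * Linear algebra over a subring of a field *)

Local Open Scope ring_scope.

Section SubringDependence.

Variables (F : fieldType) (S : F -> Prop).
Hypotheses (S0 : S 0) (S1 : S 1) (SD : forall x y, S x -> S y -> S (x + y))
  (SN : forall x, S x -> S (- x)) (SM : forall x y, S x -> S y -> S (x * y)).

Lemma subring_sum (T : Type) (s : seq T) (P : pred T) (G : T -> F) :
  (forall t, P t -> S (G t)) -> S (\sum_(t <- s | P t) G t).
Proof. by move=> h; apply: (big_ind S). Qed.

(** Gaussian elimination by cross multiplication, since pivots need not be invertible in S. *)
Lemma subring_dependence k r (C : 'M[F]_(r, k)) : (k < r)%N ->
  (forall i j, S (C i j)) ->
  exists c : 'rV[F]_r, [/\ forall j, S (c 0 j), c != 0 & c *m C = 0].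
Proof.
elim: k r C => [|k IH] r C kr SC.
  exists (const_mx 1); split=> [j||]; first by rewrite mxE.
    apply/eqP => /matrixP /(_ 0 (Ordinal kr)); rewrite !mxE => /eqP.
    by rewrite oner_eq0.
  by apply/matrixP => i [].
case: r C kr SC => // r C kr SC.
have [[i Ci]|nz] := classic (exists i, C i 0 != 0); last first.
  have [|j j'|c [Sc c0 cC]] := IH r.+1 (colsub (lift 0) C).
  - exact: ltnW.
  - by rewrite mxE.
  exists c; split=> //; apply/matrixP => x j; rewrite [RHS]mxE.
  have [z ->|->] := unliftP 0 j.
    have E := congr1 (fun M : 'M_(_, _) => M x z) cC; rewrite !mxE in E.
    by rewrite mxE -[RHS]E; apply: eq_bigr => y _; rewrite mxE.
  rewrite mxE big1 // => y _; suff -> : C y 0 = 0 by rewrite mulr0.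
  by apply/eqP/negPn/negP => Cy; apply: nz; exists y.
pose C' : 'M[F]_(r, k) := \matrix_(j, z)
  (C i 0 * C (lift i j) (lift 0 z) - C (lift i j) 0 * C i (lift 0 z)).
have [//|j z|c [Sc c0 cC]] := IH r C'.
  by rewrite mxE; apply: SD; [|apply: SN]; apply: SM.
pose b : 'rV[F]_r.+1 := \row_j (if unlift i j is Some z then c 0 z * C i 0
  else - \sum_z c 0 z * C (lift i z) 0).
have bl z : b 0 (lift i z) = c 0 z * C i 0 by rewrite mxE liftK.
have bi : b 0 i = - \sum_z c 0 z * C (lift i z) 0 by rewrite mxE unlift_none.
exists b; split.
- move=> j; have [z ->|->] := unliftP i j; first by rewrite bl; apply: SM.
  by rewrite bi; apply: SN; apply: subring_sum => z _; apply: SM.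
- apply: contraNneq c0 => b0; apply/eqP/matrixP => x z; rewrite ord1 mxE.
  have := bl z; rewrite b0 mxE => /esym/eqP; rewrite mulf_eq0 (negbTE Ci) orbF.
  by move/eqP.
apply/matrixP => x j; rewrite ord1 [RHS]mxE mxE.
have splits (G : 'I_r.+1 -> F) : \sum_y G y = G i + \sum_z G (lift i z).
  by rewrite (bigD1_ord i).
rewrite splits bi; have [z ->|->] := unliftP 0 j; last first.
  rewrite mulNr mulr_suml addrC; apply/eqP; rewrite subr_eq0; apply/eqP.
  by apply: eq_bigr => y _; rewrite bl mulrAC.
have E := congr1 (fun M : 'M_(_, _) => M 0 z) cC; rewrite !mxE in E.
rewrite -[RHS]E mulNr mulr_suml addrC -sumrB; apply: eq_bigr => y _.
by rewrite bl !mxE mulrBr !mulrA.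
Qed.

(** Ranks of stalks are defined by independence over O_p, whose fractions do not exhaust Frac(R). If
    M had deficient rank, a column basis scaled by u would be a matrix over S with fewer columns
    than rows, hence dependent over S. *)
Lemma subring_row_free r n (M : 'M[F]_(r, n)) u : u != 0 ->
  (forall i j, S (u * M i j)) ->
  (forall c : 'rV[F]_r, (forall j, S (c 0 j)) -> c *m M = 0 -> c = 0) ->
  exists A : {ffun 'I_r -> 'I_n}, \det (colsub A M) != 0.
Proof.
move=> u0 SM' indep.
have rf : row_free M.
  rewrite /row_free eqn_leq rank_leq_row /= leqNgt; apply/negP => lt.
  pose f := maxrankfun M^T.
  have rT : \rank M^T = \rank M by rewrite mxrank_tr.
  have [D MD] : exists D, M^T = D *m rowsub f M^T.
    by apply/submxP; rewrite eq_maxrowsub.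
  have [||c [Sc c0 cC]] := @subring_dependence _ _ (u *: colsub f M).
  - by rewrite rT.
  - by move=> i j; rewrite !mxE.
  case/eqP: c0; apply: indep => //.
  have -> : M = colsub f M *m D^T.
    apply: trmx_inj; rewrite trmx_mul trmxK {1}MD; congr (_ *m _).
    by apply/matrixP => i j; rewrite !mxE.
  rewrite mulmxA; suff -> : c *m colsub f M = 0 by rewrite mul0mx.
  by apply/eqP; move/eqP: cC; rewrite -scalemxAr scaler_eq0 (negbTE u0).
have rfT : row_full M^T by rewrite /row_full mxrank_tr.
exists (fullrankfun rfT).
have := fullrowsub_unit rfT; rewrite unitmxE unitfE -det_tr.
suff -> : (rowsub (fullrankfun rfT) M^T)^T =
  colsub (fullrankfun rfT) M by [].
by apply/matrixP => i j; rewrite !mxE.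
Qed.

End SubringDependence.

(** * Twisted stalks *)

Section TwistedStalks.

Variables (K : closedFieldType) (N : nat).
Local Notation R := {mpoly K[N.+1]}.
Local Notation FR := {fraction R}.
Local Notation frac := (@frac_of K N).
Implicit Types (p : point K N) (F G : R) (e : int) (s x y : FR).

Definition mk_point (v : 'rV[K]_N.+1) (v0 : v != 0) : point K N :=
  exist (fun v => is_true (v != 0)) v v0.

Lemma fracM F G : frac (F * G) = frac F * frac G.
Proof. exact: rmorphM. Qed.

Lemma fracD F G : frac (F + G) = frac F + frac G.
Proof. exact: rmorphD. Qed.

Lemma frac_sum (T : Type) (r : seq T) (P : pred T) (F : T -> R) :
  frac (\sum_(t <- r | P t) F t) = \sum_(t <- r | P t) frac (F t).
Proof. exact: rmorph_sum. Qed.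

Lemma frac0 : frac 0 = 0. Proof. exact: rmorph0. Qed.
Lemma frac1 : frac 1 = 1. Proof. exact: rmorph1. Qed.

Lemma frac_eq0 F : (frac F == 0) = (F == 0).
Proof. exact: tofrac_eq0. Qed.

Lemma frac_inj : injective frac.
Proof. by move=> F G /eqP; rewrite tofrac_eq => /eqP. Qed.

Lemma at_pointM p F G : at_point (F * G) p = at_point F p * at_point G p.
Proof. exact: mevalM. Qed.

Lemma at_point_neq0 p F : at_point F p != 0 -> F != 0.
Proof. by apply: contraNneq => ->; rewrite /at_point meval0. Qed.

Lemma point_coord p : exists i, at_point 'X_i p != 0.
Proof.
case: p => v v0; have [i vi] : exists i, v 0 i != 0.
  by apply/rV0Pn.
by exists i; rewrite /at_point mevalXU.
Qed.

Lemma stalkM e e' p x y : twist_stalk e p x -> twist_stalk e' p y ->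
  twist_stalk (e + e') p (x * y).
Proof.
move=> [F [G [k [l [Fk Gl kl Gp ->]]]]] [F' [G' [k' [l' [Fk' Gl' kl' Gp' ->]]]]].
exists (F * F'), (G * G'), (k + k')%N, (l + l')%N; split.
- exact: dhomogM.
- exact: dhomogM.
- by rewrite !PoszD kl kl' addrACA.
- by rewrite at_pointM mulf_neq0.
- by rewrite !fracM invfM mulrACA.
Qed.

Lemma stalkD e p x y : twist_stalk e p x -> twist_stalk e p y ->
  twist_stalk e p (x + y).
Proof.
move=> [F [G [k [l [Fk Gl kl Gp ->]]]]] [F' [G' [k' [l' [Fk' Gl' kl' Gp' ->]]]]].
exists (F * G' + F' * G), (G * G'), (k + l')%N, (l + l')%N; split.
- apply: rpredD; first exact: dhomogM.
  have -> : (k + l' = k' + l)%N by lia.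
  exact: dhomogM.
- exact: dhomogM.
- by rewrite !PoszD kl addrAC.
- by rewrite at_pointM mulf_neq0.
- rewrite fracD !fracM addf_div ?frac_eq0 //; exact: at_point_neq0 Gp || exact: at_point_neq0 Gp'.
Qed.

Lemma stalk_frac k p F : F \is k.-homog -> twist_stalk k p (frac F).
Proof.
move=> Fk; exists F, 1, k, 0%N; split=> //; first exact: dhomog1.
  by rewrite /at_point meval1 oner_neq0.
by rewrite frac1 divr1.
Qed.

Lemma stalk_fracV l p G : G \is l.-homog -> at_point G p != 0 ->
  twist_stalk (- l%:Z) p (frac G)^-1.
Proof.
move=> Gl Gp; exists 1, G, 0%N, l; split=> //; first exact: dhomog1.
  by rewrite subrr.
by rewrite frac1 mul1r.
Qed.

Lemma stalk_eq e e' p x : e = e' -> twist_stalk e p x -> twist_stalk e' p x.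
Proof. by move=> ->. Qed.

Lemma stalk1 p : twist_stalk 0 p 1.
Proof. by rewrite -frac1; apply: (@stalk_frac 0); apply: dhomog1. Qed.

Lemma stalkX e k p x : twist_stalk e p x -> twist_stalk (e *+ k) p (x ^+ k).
Proof.
move=> ex; elim: k => [|k IH]; first exact: stalk1.
by rewrite mulrS exprS; apply: stalkM.
Qed.

Lemma stalk_unit e p : exists u, [/\ u != 0, twist_stalk e p u & twist_stalk (- e) p u^-1].
Proof.
have [i Xi] := point_coord p.
have X1 : ('X_i : R) \is 1.-homog by rewrite dhomogX /= mdeg1.
have t1 := stalk_frac p X1; have tV := stalk_fracV X1 Xi.
have X0 : frac 'X_i != 0 by rewrite frac_eq0; apply: at_point_neq0 Xi.
case: e => k.
  exists (frac 'X_i ^+ k); rewrite expf_neq0 // -exprVn; split=> //.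
    by have := stalkX k t1; apply: stalk_eq; rewrite -[1%:Z *+ k]mulr_natr mul1r natz.
  by have := stalkX k tV; apply: stalk_eq; rewrite mulNrn -[1%:Z *+ k]mulr_natr mul1r natz.
exists ((frac 'X_i)^-1 ^+ k.+1); rewrite expf_neq0 ?invr_eq0 // NegzE opprK exprVn invrK.
split=> //.
  rewrite -exprVn; have := stalkX k.+1 tV.
  by apply: stalk_eq; rewrite mulNrn -[1%:Z *+ _]mulr_natr mul1r natz.
by have := stalkX k.+1 t1; apply: stalk_eq; rewrite -[1%:Z *+ _]mulr_natr mul1r natz.
Qed.

Lemma stalk0 e p : twist_stalk e p 0.
Proof.
have [u [_ eu _]] := stalk_unit e p.
have z : twist_stalk 0 p 0 by rewrite -frac0; apply: (@stalk_frac 0); apply: rpred0.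
by have := stalkM z eu; rewrite add0r mul0r.
Qed.

Lemma stalkN e p x : twist_stalk e p x -> twist_stalk e p (- x).
Proof.
move=> ex; rewrite -mulN1r -[e]add0r; apply: stalkM => //.
have -> : -1 = frac (-1) by rewrite [RHS]rmorphN1.
by apply: (@stalk_frac 0); rewrite -scaleN1r; apply: rpredZ; apply: dhomog1.
Qed.

Lemma stalk_sum e p (T : Type) (r : seq T) (P : pred T) (G : T -> FR) :
  (forall t, P t -> twist_stalk e p (G t)) ->
  twist_stalk e p (\sum_(t <- r | P t) G t).
Proof.
move=> h; apply: (big_ind (twist_stalk e p)) => //; first exact: stalk0.
by move=> x y; apply: stalkD.
Qed.

Lemma stalk_det e p r (A : 'M[FR]_r) : (forall i j, twist_stalk e p (A i j)) ->
  twist_stalk (e *+ r) p (\det A).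
Proof.
move=> h; apply: stalk_sum => s _.
have -> : e *+ r = 0 + e *+ r by rewrite add0r.
apply: stalkM.
  case: (perm.odd_perm s); rewrite ?expr0 ?expr1; last exact: stalk1.
  exact: stalkN (stalk1 p).
rewrite -[r in e *+ r]card_ord -sumr_const.
apply: (big_ind2 (fun (i : int) x => twist_stalk i p x)) => //; first exact: stalk1.
by move=> *; apply: stalkM.
Qed.

Lemma stalk0_not_coord p i : ~ twist_stalk 0 p (frac 'X_i).
Proof.
move=> [F [G [k [l [Fk Gl kl Gp XE]]]]].
have G0 := at_point_neq0 Gp.
have e : 'X_i * G = F.
  by apply: frac_inj; rewrite fracM XE mulfVK ?frac_eq0.
have kl' : k = l by apply/eqP; rewrite -eqz_nat kl addr0.
have X1 : ('X_i : R) \is 1.-homog by rewrite dhomogX /= mdeg1.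
have F0 : 'X_i * G != 0 by rewrite mulf_neq0 // -msize_poly_eq0 msizeX.
have := dhomog_uniq F0 (dhomogM X1 Gl); rewrite e => /(_ _ Fk).
by rewrite kl' add1n => /eqP; rewrite eq_sym ltn_eqF.
Qed.

Lemma homog_divisor k l (P F G : R) : F != 0 -> F \is k.-homog -> G \is l.-homog ->
  F = P * G -> exists2 m, k = (m + l)%N & P \is m.-homog.
Proof.
move=> F0 Fk Gl FE; have G0 : G != 0 by apply: contraNneq F0 => G0; rewrite FE G0 mulr0.
have [lk|kl] := leqP l k; last first.
  by case/eqP: F0; rewrite -(pihomog_dE Fk) FE (pihomog_mulr_lt _ Gl).
exists (k - l)%N; first by rewrite subnK.
suff -> : P = pihomog mdeg (k - l) P by apply: pihomogP.
apply: (mulIf G0); rewrite -(pihomog_mulr _ _ Gl) subnK // -FE.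
by rewrite (pihomog_dE Fk).
Qed.

Lemma monomial_coprime (P Q : R) (i j : 'I_N.+1) k l : i != j ->
  'X_j ^+ l * P = 'X_i ^+ k * Q -> exists P', P = 'X_i ^+ k * P'.
Proof.
move=> ij E.
have low (m : 'X_{1..N.+1}) : (m i < k)%N -> P@_m = 0.
  move=> mk; have := congr1 (mcoeff (U_(j) *+ l + m)%MM) E.
  rewrite mulrC !mpolyXn mcoeffMX => ->; apply/eqP; rewrite mcoeff_eq0.
  apply/negP => /msuppM_le /allpairsP [[a b] /= [+ _ e]].
  rewrite msuppX inE => /eqP ae; move: mk; rewrite ltnNge => /negP; apply.
  have := congr1 (fun z : 'X_{1..N.+1} => z i) e; rewrite ae !mnmDE !mulmnE !mnm1E.
  by rewrite eqxx eq_sym (negbTE ij) mul0n add0n mul1n => ->; apply: leq_addr.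
exists (\sum_(m <- msupp P) P@_m *: 'X_[m - U_(i) *+ k]).
rewrite [LHS](mpolyE P) mulr_sumr big_seq [RHS]big_seq; apply: eq_bigr => m mP.
rewrite -scalerAr mpolyXn -mpolyXD addmC submK //.
apply/mnm_lepP => z; rewrite mulmnE mnm1E; case: eqP => [<-|_]; last by rewrite mul0n.
rewrite mul1n leqNgt; apply/negP => /low /eqP.
by rewrite mcoeff_eq0 mP.
Qed.

(* The denominators of a section form a homogeneous ideal without nontrivial      *)
(* common zeros, hence contain powers of two of the variables.                    *)
Lemma global_section e s : (0 < N)%N -> (forall p, twist_stalk e p s) ->
  exists2 P, s = frac P & P != 0 -> exists2 m : nat, e = m & P \is m.-homog.
Proof.
move=> N0 h; have [->|s0] := eqVneq s 0.
  by exists 0; rewrite ?frac0 ?eqxx.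
have v1 : const_mx 1 != 0 :> 'rV[K]_N.+1.
  by apply/rV0Pn; exists ord0; rewrite mxE oner_neq0.
have [F0 [G0 [k0 [l0 [Fk Gl kl Gp sE]]]]] := h (mk_point v1).
have G0n := at_point_neq0 Gp.
have F0n : F0 != 0 by apply: contraNneq s0 => F00; rewrite sE F00 frac0 mul0r.
pose I H := exists P, H * F0 = P * G0.
have hI : homog_ideal I.
  split.
  - by exists 0; rewrite !mul0r.
  - by move=> H H' [P PE] [P' PE']; exists (P + P'); rewrite !mulrDl PE PE'.
  - by move=> H H' [P PE]; exists (H * P); rewrite -!mulrA PE.
  move=> c H [P PE]; have [le|lt] := leqP l0 (c + k0).
    exists (pihomog mdeg (c + k0 - l0) P).
    by rewrite -(pihomog_mulr _ _ Gl) -(pihomog_mulr _ _ Fk) PE subnK.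
  exists 0; rewrite -(pihomog_mulr _ _ Fk) PE (pihomog_mulr_lt _ Gl) //.
  by rewrite mul0r.
have /(projective_nullstellensatz hI) pow : forall v : 'I_N.+1 -> K,
    (forall P, I P -> P.@[v] = 0) -> forall i, v i = 0.
  move=> v vI i; apply/eqP/negPn/negP => vi.
  have vn : \row_j v j != 0 by apply/rV0Pn; exists i; rewrite mxE.
  have [F [G [k [l [_ _ _ Gv sE']]]]] := h (mk_point vn).
  have Gn := at_point_neq0 Gv.
  case/eqP: Gv; rewrite /at_point /= -(vI G).
    by apply: meval_eq => j; rewrite mxE.
  exists F; apply: frac_inj; rewrite !fracM; move: sE'; rewrite sE => /eqP.
  by rewrite eqr_div ?frac_eq0 // => /eqP E; rewrite mulrC E.
pose i1 : 'I_N.+1 := Ordinal (N0 : (1 < N.+1)%N).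
have [k [P PE]] := pow ord0; have [l [Q QE]] := pow i1.
(* X_0^k F0 = P G0 and X_1^l F0 = Q G0 give X_1^l P = X_0^k Q, so X_0^k divides P and G0 divides
   F0. *)
have [|P' PE'] := @monomial_coprime P Q ord0 i1 k l isT.
  by apply: (mulIf G0n); rewrite -!mulrA -PE -QE mulrCA.
have X0 : 'X_ord0 ^+ k != 0 :> R by rewrite expf_neq0 // -msize_poly_eq0 msizeX.
have FE : F0 = P' * G0 by apply: (mulfI X0); rewrite mulrA -PE'.
exists P'; first by rewrite sE FE fracM mulfK ?frac_eq0.
move=> _; have [m km Pm] := homog_divisor F0n Fk Gl FE.
exists m => //; apply: (addrI l0%:Z); rewrite -kl km PoszD addrC //.
Qed.

End TwistedStalks.

(** * Determinants of subsheaves *)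

Section DeterminantPlucker.

Variables (S : comNzRingType) (r n : nat) (M : 'M[S]_(r, n)).
Implicit Types I J : {ffun 'I_r -> 'I_n}.

Lemma cofactor_upd I a x s : cofactor (colsub (upd I a x) M) s a = cofactor (colsub I M) s a.
Proof.
congr (_ * \det _); apply/matrixP => i j; rewrite !mxE updE.
by rewrite eq_sym (negbTE (neq_lift _ _)).
Qed.

Lemma det_upd I a x :
  \det (colsub (upd I a x) M) = \sum_s M s x * cofactor (colsub I M) s a.
Proof.
rewrite (expand_det_col _ a); apply: eq_bigr => s _.
by rewrite cofactor_upd !mxE updE eqxx.
Qed.

Lemma det_plucker : plucker (fun I => \det (colsub I M)).
Proof.
split=> [I J a|I /injectivePn [x [y xy Ixy]]]; last first.
  rewrite -det_tr; apply: (@determinant_alternate _ _ _ x y) => // j.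
  by rewrite !mxE Ixy.
under eq_bigr do rewrite !det_upd mulr_suml.
rewrite exchange_big /=.
have E s t : \sum_k M s (J k) * cofactor (colsub J M) t k
    = (s == t)%:R * \det (colsub J M).
  have := congr1 (fun A : 'M_r => A s t) (mul_mx_adj (colsub J M)).
  rewrite !mxE mulr_natl => <-; apply: eq_bigr => k _.
  by rewrite !mxE.
rewrite (expand_det_col (colsub I M) a) mulr_suml; apply: eq_bigr => s _.
transitivity (\sum_t cofactor (colsub I M) s a * M t (I a) *
    (\sum_k M s (J k) * cofactor (colsub J M) t k)); last first.
  under eq_bigr do rewrite mulr_sumr.
  rewrite exchange_big /=; apply: eq_bigr => k _; rewrite mulr_sumr.
  by apply: eq_bigr => t _; rewrite mulrACA [X in X * _ = _]mulrC.
under eq_bigr do rewrite E.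
rewrite (bigD1 s) //= eqxx mul1r big1 ?addr0 => [|t ts]; last first.
  by rewrite eq_sym (negbTE ts) mul0r mulr0.
by rewrite mxE [X in X * _]mulrC.
Qed.

Lemma det_annihilated (f : 'I_n -> S) : (forall s, \sum_i f i * M s i = 0) ->
  annihilated f (fun I => \det (colsub I M)).
Proof.
move=> h I a; under eq_bigr do rewrite det_upd mulr_sumr.
rewrite exchange_big /=; apply: big1 => s _.
under eq_bigr do rewrite mulrA.
by rewrite -mulr_suml h mul0r.
Qed.

End DeterminantPlucker.

Lemma mulVf2K (F : fieldType) (x y z : F) : x != 0 -> y != 0 ->
  z = (y^-1 * x^-1) * (y * (x * z)).
Proof. by move=> x0 y0; rewrite mulrACA mulVf // mul1r mulKf. Qed.

Section Subsheaf.

Variables (K : closedFieldType) (N n d : nat) (f : forms K N n d).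
Local Notation R := {mpoly K[N.+1]}.
Local Notation FR := {fraction R}.

Lemma wedge_in_ext r (F : sheaf K N n) p (M : 'M[FR]_(r, n)) :
  rows_in F p M -> ext_stalk F p (wedge M).
Proof.
move=> FM; exists 1%N, (fun=> 1), (fun=> M); split=> // [j|A]; first exact: stalk1.
by rewrite big_ord1 mul1r.
Qed.

Lemma ext_in_det r (F : sheaf K N n) p eta :
  @ext_stalk _ _ r n F p eta -> det_stalk F p eta.
Proof. by move=> Fe lambda; apply. Qed.

(** The vector omega giving det F = O(a) has coordinates regular everywhere in degree -d r - a,
    hence forms. It is proportional to the wedge of independent sections of F, so it inherits their
    Pluecker relations and is annihilated by f. *)
Lemma subsheaf_plucker_form (F : sheaf K N n) r a : (0 < N)%N ->
  subsheaf F (Syz f) -> has_rank F r -> has_c1 F r a ->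
  exists (m : nat) (w : {ffun 'I_r -> 'I_n} -> R) A0,
  [/\ a = - (d * r + m)%N%:Z, forall A, w A \is m.-homog, plucker w,
      annihilated (Defs.form f) w & w A0 != 0].
Proof.
move=> N0 FS Frk [omega [omega0 Fdet]].
have v1 : const_mx 1 != 0 :> 'rV[K]_N.+1.
  by apply/rV0Pn; exists ord0; rewrite mxE oner_neq0.
pose p := mk_point v1.
have [[M [FM Mind]] _] := Frk p.
have [u [u0 du duV]] := stalk_unit d%:Z p.
have [A0 detA0] : exists A : {ffun 'I_r -> 'I_n}, \det (colsub A M) != 0.
  apply: (@subring_row_free _ (twist_stalk 0 p) _ _ _ _ _ _ _ M u u0 _ Mind).
  - exact: stalk0.
  - exact: stalk1.
  - exact: stalkD.
  - exact: stalkN.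
  - by move=> x y hx hy; have := stalkM hx hy; rewrite addr0.
  - move=> i j; have [h _] := FS p _ (FM i); have := stalkM du (h j).
    by rewrite subrr mxE.
have [phi [_ phiE]] : exists phi, twist_stalk a p phi /\
    forall A, wedge M A = phi * omega A.
  by apply/Fdet; apply: ext_in_det; apply: wedge_in_ext.
have phi0 : phi != 0.
  apply: contraNneq detA0 => p0; have := phiE A0.
  by rewrite /wedge ffunE => ->; rewrite p0 mul0r.
(* With y a unit of O(d r), y times the A-th coordinate is a linear form on Lambda^r F with values
   in O_q, so it is regular on the bidual, which contains x omega. *)
have omega_st q A : twist_stalk (- (d * r)%N%:Z - a) q (omega A).
  have [x [x0 ax axV]] := stalk_unit a q.
  have [y [y0 dy dyV]] := stalk_unit (d * r)%N%:Z q.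
  have det_q : det_stalk F q [ffun B => x * omega B].
    by apply/Fdet; exists x; split=> // B; rewrite ffunE.
  have := det_q (fun B => if B == A then y else 0).
  have pick (xi : {ffun {ffun 'I_r -> 'I_n} -> FR}) :
      \sum_t (if t == A then y else 0) * xi t = y * xi A.
    rewrite (bigD1 A) //= eqxx big1 ?addr0 // => B /negbTE ->.
    by rewrite mul0r.
  rewrite pick ffunE => st.
  have -> : omega A = (y^-1 * x^-1) * (y * (x * omega A)).
    exact: (mulVf2K (omega A) x0 y0).
  rewrite -[_ - a]addr0; apply: stalkM; first exact: stalkM.
  apply: st => xi [k [c [M' [c0 FM' xiE]]]]; rewrite pick.
  have -> : (0 : int) = (d * r)%N%:Z + (- d%:Z) *+ r.
    by rewrite mulNrn -[d%:Z *+ r]mulr_natr natz -PoszM subrr.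
  apply: stalkM => //; rewrite xiE; apply: stalk_sum => j _.
  rewrite -[_ *+ r]add0r; apply: stalkM => //; rewrite ffunE; apply: stalk_det => s t.
  by rewrite !mxE; have [h _] := FS q _ (FM' j s); have := h (A t); rewrite mxE.
have /fin_all_exists [w wP] : forall A, exists P : R, omega A = frac_of P /\
    (P != 0 -> exists2 m : nat, - (d * r)%N%:Z - a = m & P \is m.-homog).
  by move=> A; have [P e h] := global_section N0 (fun q => omega_st q A); exists P.
have [A1 oA1] : exists A, omega A != 0.
  apply: NNPP => nex; case/eqP: omega0; apply/ffunP => A; rewrite ffunE.
  by apply/eqP/negPn/negP => oA; apply: nex; exists A.
have w1 : w A1 != 0.
  by apply: contraNneq oA1 => z; rewrite (wP A1).1 z frac0.
have [m mE _] := (wP A1).2 w1.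
have dE (A : {ffun 'I_r -> 'I_n}) : \det (colsub A M) = phi * frac_of (w A).
  by have := phiE A; rewrite ffunE => ->; rewrite (wP A).1.
have [P1 P2] := det_plucker M.
exists m, w, A1; split=> //.
- by move: mE; lia.
- move=> A; have [->|wA] := eqVneq (w A) 0; first exact: rpred0.
  have [m' m'E h] := (wP A).2 wA; suff -> : m = m' by [].
  by apply/eqP; rewrite -eqz_nat -mE m'E.
- split=> [A B z|A nA].
    apply: frac_inj; apply: (mulfI (mulf_neq0 phi0 phi0)).
    rewrite fracM mulrACA -!dE (P1 A B z) frac_sum mulr_sumr; apply: eq_bigr => k _.
    by rewrite fracM mulrACA -!dE.
  apply/eqP; rewrite -frac_eq0; apply/eqP; apply: (mulfI phi0).
  by rewrite -dE P2 // mulr0.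
- move=> A z; apply/eqP; rewrite -frac_eq0; apply/eqP; apply: (mulfI phi0).
  have := @det_annihilated _ _ _ M (fun i => frac_of (Defs.form f i)) _ A z.
  rewrite mulr0 => <-; last first.
    move=> s; have [_ h] := FS p _ (FM s); rewrite -[RHS]h.
    by apply: eq_bigr => i _; rewrite mxE.
  rewrite frac_sum mulr_sumr; apply: eq_bigr => i _.
  by rewrite fracM mulrCA -dE.
Qed.

End Subsheaf.

(** * The syzygy bundle *)

Lemma m_primary_no_zero (K : closedFieldType) N n d (f : forms K N n d) :
  m_primary f -> forall p, exists i, at_point (Defs.form f i) p != 0.
Proof.
move=> [_ frad] p; apply: NNPP => nex.
have [j Xj] := point_coord p.
have [|k [h hE]] := (frad 'X_j).2.
  exists (fun i => (i == j)%:R); rewrite (bigD1 j) //= eqxx mul1r big1 ?addr0 //.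
  by move=> i /negbTE ->; rewrite mul0r.
have : at_point ('X_j ^+ k) p = 0.
  rewrite hE /at_point raddf_sum big1 //= => i _; rewrite mevalM.
  suff -> : (Defs.form f i).@[fun j => sval p 0 j] = 0 by rewrite mulr0.
  by apply/eqP/negPn/negP => z; apply: nex; exists i.
by rewrite /at_point rmorphXn /= => /eqP; rewrite expf_eq0 -/(at_point _ p) (negbTE Xj) andbF.
Qed.

(** * A basis of the syzygies where f_i does not vanish *)

Section LocalFrame.

Variables (F : fieldType) (n : nat) (f : 'I_n.+1 -> F) (i : 'I_n.+1).
Hypothesis fi : f i != 0.

(** The rows e_b / f_i - f_b e_i / f_i^2, for b other than i, have degree -d. *)
Definition frame : 'M[F]_(n, n.+1) := \matrix_(b, j)
  (if unlift i j is Some b' then (b' == b)%:R / f i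
   else - f (lift i b) / (f i * f i)).

Lemma frame_lift b b' : frame b (lift i b') = (b' == b)%:R / f i.
Proof. by rewrite mxE liftK. Qed.

Lemma frame_pivot b : frame b i = - f (lift i b) / (f i * f i).
Proof. by rewrite mxE unlift_none. Qed.

Lemma sum_split_pivot (G : 'I_n.+1 -> F) : \sum_j G j = G i + \sum_b G (lift i b).
Proof. by rewrite (bigD1_ord i). Qed.

Lemma frame_kernel b : \sum_j f j * frame b j = 0.
Proof.
rewrite sum_split_pivot frame_pivot (bigD1 b) //= frame_lift eqxx big1 ?addr0.
  by rewrite invfM [- _ * _]mulrCA mulVKf // mulNr mulrC mul1r addrC mulrC addrN.
by move=> c cb; rewrite frame_lift (negbTE cb) mul0r mulr0.
Qed.

Lemma frame_coords (s : 'rV[F]_n.+1) : \sum_j f j * s 0 j = 0 ->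
  s = (\row_b (f i * s 0 (lift i b))) *m frame.
Proof.
move=> s0; apply/matrixP => x j; rewrite ord1 mxE.
have [b ->|->] := unliftP i j.
  rewrite (bigD1 b) //= big1 ?addr0 => [|c cb].
    by rewrite frame_lift eqxx mxE mul1r mulrAC mulfV // mul1r.
  by rewrite frame_lift eq_sym (negbTE cb) mul0r mulr0.
have E : f i * s 0 i = - \sum_b f (lift i b) * s 0 (lift i b).
  by apply/eqP; rewrite -addr_eq0 -(sum_split_pivot (fun j => f j * s 0 j)) s0.
transitivity (- (\sum_b f (lift i b) * s 0 (lift i b)) / f i).
  by rewrite -E mulrC mulKf.
rewrite mulNr mulr_suml -sumrN; apply: eq_bigr => b _.
by rewrite frame_pivot mxE; move: (f i) (f _) (s 0 _) fi => u v w u0; field.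
Qed.

(** For injective A the determinant is, up to sign, the f_j missed by A. It is independent of the
    chart i, so it glues the wedges of the frames. *)
Definition omega_mx (A : 'I_n -> 'I_n.+1) : 'M[F]_n.+1 :=
  row_mx (\col_j f j) (\matrix_(j, a) (j == A a)%:R).

(* Multiplying on the left by the square matrix with rows e_i and the frame makes *)
(* omega_mx A block triangular, since the frame consists of syzygies.             *)
Lemma det_frame (A : 'I_n -> 'I_n.+1) :
  \det (colsub A frame) = (-1) ^+ i * (f i)^-1 ^+ n.+1 * \det (omega_mx A).
Proof.
pose B : 'M[F]_(1 + n, n.+1) := col_mx (delta_mx 0 i) frame.
have B0 j : B 0 j = (j == i)%:R.
  have -> : (0 : 'I_(1 + n)) = lshift n 0 by apply: val_inj.
  by rewrite col_mxEu mxE eqxx.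
have Bs (b : 'I_n) j : B (lift 0 b) j = frame b j.
  have -> : lift 0 b = rshift 1 b :> 'I_(1 + n) by apply: val_inj.
  by rewrite col_mxEd.
have detB : \det (B : 'M_n.+1) = (-1) ^+ i * (f i)^-1 ^+ n.
  rewrite (expand_det_row _ 0) (bigD1 i) //= big1 ?addr0 => [|j ji].
    rewrite B0 eqxx mul1r /cofactor add0n; congr (_ * _).
    have -> : row' 0 (col' i (B : 'M_n.+1)) = (f i)^-1%:M.
      apply/matrixP => b c; rewrite [LHS]mxE [LHS]mxE [RHS]mxE.
      by rewrite Bs frame_lift eq_sym mulrC mulr_natr.
    by rewrite det_scalar.
  by rewrite B0 (negbTE ji) mul0r.
have E : \det ((B : 'M_n.+1) *m omega_mx A) = f i * \det (colsub A frame).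
  have -> : (B : 'M_n.+1) *m omega_mx A = B *m row_mx (\col_j f j)
    (\matrix_(j, a) (j == A a)%:R) :> 'M_(1 + n) by [].
  rewrite /B mul_col_row.
  have -> : frame *m (\col_j f j) = 0.
    apply/matrixP => b x; rewrite !mxE -[RHS](frame_kernel b).
    by apply: eq_bigr => j _; rewrite [X in _ * X]mxE mulrC.
  have -> : frame *m \matrix_(j, a) (j == A a)%:R = colsub A frame.
    apply/matrixP => b a; rewrite !mxE (bigD1 (A a)) //= mxE eqxx mulr1 big1 ?addr0 ?mxE //.
    by move=> j /negbTE ja; rewrite mxE ja mulr0.
  rewrite (@det_ublock _ 1 n); congr (_ * _).
  rewrite det_mx11 mxE (bigD1 i) //= !mxE !eqxx mul1r big1 ?addr0 // => j ji.
  by rewrite [X in X * _]mxE (negbTE ji) andbF mul0r.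
apply: (mulfI fi); rewrite -E det_mulmx detB exprSr !mulrA; congr (_ * _).
by rewrite -[f i * _ * _]mulrA [f i * _]mulrC mulfK.
Qed.

Lemma det_frame_lift : \det (colsub (lift i) frame) = (f i)^-1 ^+ n.
Proof.
have -> : colsub (lift i) frame = (f i)^-1%:M; last by rewrite det_scalar.
by apply/matrixP => b c; rewrite [LHS]mxE frame_lift [RHS]mxE eq_sym mulrC mulr_natr.
Qed.

End LocalFrame.

Section FieldComputations.

Variable F : fieldType.

Lemma sum_pick (T : finType) (t : T) (a : F) (G : T -> F) :
  \sum_z (if z == t then a else 0) * G z = a * G t.
Proof.
rewrite (bigD1 t) //= eqxx big1 ?addr0 // => z /negbTE ->.
by rewrite mul0r.
Qed.

Lemma sum_pick2 (T : finType) (t u : T) (a b : F) (G : T -> F) :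
  \sum_z ((if z == t then a else 0) - (if z == u then b else 0)) * G z
  = a * G t - b * G u.
Proof. by under eq_bigr do rewrite mulrBl; rewrite sumrB !sum_pick. Qed.

Lemma signed_neq0 (x : F) a m : x != 0 -> (-1) ^+ a * x^-1 ^+ m != 0.
Proof. by move=> x0; rewrite mulf_neq0 ?signr_eq0 // expf_neq0 // invr_eq0. Qed.

Lemma signedV (x : F) a m : ((-1) ^+ a * x^-1 ^+ m)^-1 = (-1) ^+ a * x ^+ m.
Proof. by rewrite invfM exprVn invrK -exprVn invrN invr1. Qed.

Lemma scale_cancel (a b t u : F) m : u != 0 ->
  a * (t * b) - a * (u ^+ m * b) * (t * u^-1 ^+ m) = 0.
Proof.
move=> u0; have um0 : u ^+ m != 0 by rewrite expf_neq0.
by rewrite exprVn; move: (u ^+ m) um0 => v v0; field.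
Qed.

Lemma expfVK (t u : F) m : u != 0 -> u ^+ m * (t * u^-1 ^+ m) = t.
Proof. by move=> u0; rewrite exprVn mulrCA divff ?mulr1 // expf_neq0. Qed.

Lemma rescale (x a u e k w : F) : a - u * e * k * w != 0 ->
  x / (a - u * e * k * w) * a - x / (a - u * e * k * w) * (u * (k * w)) * e = x.
Proof. by move=> delta0; field. Qed.

End FieldComputations.

Lemma stalk_sign (K : closedFieldType) N (p : point K N) a : twist_stalk 0 p ((-1) ^+ a).
Proof.
rewrite -signr_odd; case: odd; rewrite ?expr0 ?expr1; last exact: stalk1.
exact: stalkN (stalk1 p).
Qed.

Section SyzygyBundle.

Variables (K : closedFieldType) (N n d : nat) (f : forms K N n.+1 d).
Hypothesis no_zero : forall p, exists i, at_point (Defs.form f i) p != 0.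
Local Notation FR := {fraction {mpoly K[N.+1]}}.

Definition frac_form (j : 'I_n.+1) : FR := frac_of (Defs.form f j).
Local Notation g := frac_form.
Local Notation frame := (@frame FR n g).
Local Notation omega := (fun I : 'I_n -> 'I_n.+1 => \det (omega_mx g I)).

Lemma form_homog j : Defs.form f j \is d.-homog.
Proof. exact: dhomog_is_dhomog. Qed.

Lemma frac_form_neq0 i q : at_point (Defs.form f i) q != 0 -> g i != 0.
Proof. by move=> fi; rewrite /frac_form frac_eq0; apply: at_point_neq0 fi. Qed.

Section OnChart.

Variables (i : 'I_n.+1) (q : point K N).
Hypothesis fi : at_point (Defs.form f i) q != 0.

Let gi : g i != 0 := frac_form_neq0 fi.

Lemma frac_formV : twist_stalk (- d%:Z) q (g i)^-1.
Proof. exact: (stalk_fracV (form_homog i) fi). Qed.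

Lemma frame_stalk b j : twist_stalk (- d%:Z) q (frame i b j).
Proof.
have [b' ->|->] := unliftP i j.
  rewrite (frame_lift g i b b'); have := frac_formV.
  case: (_ == _); first by rewrite mul1r.
  by move=> _; rewrite mul0r; apply: stalk0.
rewrite (frame_pivot g i b) mulNr; apply: stalkN; rewrite invfM.
apply: (@stalk_eq _ _ (d%:Z + (- d%:Z + - d%:Z))); first by rewrite addrA subrr add0r.
apply: stalkM; first exact: (stalk_frac q (form_homog _)).
exact: stalkM frac_formV frac_formV.
Qed.

Lemma frame_in_syz b : Syz f q (row b (frame i)).
Proof.
split=> [j|]; first by rewrite mxE; apply: frame_stalk.
rewrite -[RHS](frame_kernel gi b); apply: eq_bigr => j _.
by rewrite [X in _ * X]mxE.
Qed.

Lemma syz_local s : Syz f q s <->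
  exists c : 'rV[FR]_n, (forall b, twist_stalk 0 q (c 0 b)) /\ s = c *m frame i.
Proof.
split=> [[st ker]|[c [cst ->]]].
  exists (\row_b (g i * s 0 (lift i b))); split; last exact: (frame_coords gi ker).
  move=> b; rewrite mxE; apply: (@stalk_eq _ _ (d%:Z + - d%:Z)); first exact: subrr.
  by apply: stalkM => //; apply: (stalk_frac q (form_homog _)).
split=> [j|].
  rewrite mxE; apply: stalk_sum => b _; apply: (@stalk_eq _ _ (0 + - d%:Z)).
    exact: add0r.
  by apply: stalkM => //; apply: frame_stalk.
under eq_bigr do rewrite mxE mulr_sumr.
rewrite exchange_big big1 //= => b _.
transitivity (c 0 b * (\sum_j g j * frame i b j)); last by rewrite (frame_kernel gi b) mulr0.
by rewrite mulr_sumr; apply: eq_bigr => j _; rewrite mulrCA.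
Qed.

Lemma syz_rows r (M : 'M[FR]_(r, n.+1)) : rows_in (Syz f) q M ->
  exists C : 'M[FR]_(r, n), (forall a b, twist_stalk 0 q (C a b)) /\ M = C *m frame i.
Proof.
move=> SM; have /fin_all_exists [c cP] : forall a, exists c : 'rV[FR]_n,
    (forall b, twist_stalk 0 q (c 0 b)) /\ row a M = c *m frame i.
  by move=> a; apply/syz_local; apply: SM.
exists (\matrix_(a, b) c a 0 b); split=> [a b|]; first by rewrite mxE; apply: (cP a).1.
apply/row_matrixP => a; rewrite row_mul (cP a).2; congr (_ *m _).
by apply/rowP => b; rewrite !mxE.
Qed.

Definition frame_scale : FR := (-1) ^+ i * (g i)^-1 ^+ n.+1.

Lemma frame_scale_neq0 : frame_scale != 0.
Proof. exact: signed_neq0 gi. Qed.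

Lemma frame_scale_stalk : twist_stalk (- (n.+1 * d)%N%:Z) q frame_scale.
Proof.
apply: (@stalk_eq _ _ (0 + (- d%:Z) *+ n.+1)).
  by rewrite add0r mulNrn -[d%:Z *+ _]mulr_natr natz -PoszM mulnC.
exact: stalkM (stalk_sign q i) (stalkX n.+1 frac_formV).
Qed.

Lemma frame_scaleV_stalk : twist_stalk (n.+1 * d)%N%:Z q frame_scale^-1.
Proof.
rewrite /frame_scale (signedV (g i)).
apply: (@stalk_eq _ _ (0 + d%:Z *+ n.+1)).
  by rewrite add0r -[d%:Z *+ _]mulr_natr natz -PoszM mulnC.
exact: stalkM (stalk_sign q i) (stalkX n.+1 (stalk_frac q (form_homog i))).
Qed.

Lemma wedge_frame I : wedge (frame i) I = frame_scale * omega I.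
Proof. by rewrite ffunE; apply: det_frame. Qed.

Lemma ext_stalk_syz xi : @ext_stalk K N n _ (Syz f) q xi ->
  exists t, twist_stalk 0 q t /\ forall I, xi I = t * (frame_scale * omega I).
Proof.
move=> [k [c [M [cst SM xiE]]]].
have /fin_all_exists [C CP] := fun j => syz_rows (SM j).
exists (\sum_j c j * \det (C j)); split=> [|I].
  apply: stalk_sum => j _; apply: (@stalk_eq _ _ (0 + 0)); first exact: addr0.
  apply: stalkM => //; apply: (@stalk_eq _ _ (0 *+ n)); first exact: mul0rn.
  by apply: stalk_det; apply: (CP j).1.
rewrite xiE mulr_suml; apply: eq_bigr => j _; rewrite -wedge_frame !ffunE -mulrA.
congr (_ * _); rewrite (CP j).2 -det_mulmx; congr (\det _).
by apply/matrixP => a b; rewrite !mxE; apply: eq_bigr => z _; rewrite !mxE.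
Qed.

End OnChart.

Lemma syz_coherent : coherent (- d%:Z) (Syz f).
Proof.
split=> [p s [st _] //|p]; have [i fi] := no_zero p.
exists d, (Defs.form f i), n, (frame i); split=> //; first exact: form_homog.
by move=> q fq s; apply: syz_local.
Qed.

Lemma syz_rank : has_rank (Syz f) n.
Proof.
move=> p; have [i fi] := no_zero p; split.
  exists (frame i); split=> [b|c _ c0]; first exact: frame_in_syz.
  apply/rowP => b; rewrite [RHS]mxE.
  have := congr1 (fun s : 'rV_n.+1 => s 0 (lift i b)) c0.
  rewrite !mxE (bigD1 b) //= big1 ?addr0 => [|z zb].
    rewrite (frame_lift g i b b) eqxx mul1r => /eqP.
    by rewrite mulf_eq0 invr_eq0 (negbTE (frac_form_neq0 fi)) orbF => /eqP.
  by rewrite (frame_lift g i z b) eq_sym (negbTE zb) mul0r mulr0.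
move=> M SM ind; have [C [Cst ME]] := syz_rows fi SM.
have SMul x y : twist_stalk 0 p x -> twist_stalk 0 p y -> twist_stalk 0 p (x * y).
  by move=> hx hy; have := stalkM hx hy; rewrite addr0.
have [c [cst c0 cC]] := @subring_dependence _ _ (stalk0 0 p) (stalk1 p)
  (@stalkD K N 0 p) (@stalkN K N 0 p) SMul _ _ C (ltnSn n) Cst.
by case/eqP: c0; apply: ind => //; rewrite ME mulmxA cC mul0mx.
Qed.

(** On the chart of f_i the exterior power is generated by [frame_scale i] times omega, and
    [frame_scale i] generates O(-(n+1) d) there. It remains to see that the bidual adds nothing. *)
Lemma syz_c1 : has_c1 (Syz f) n (- (n.+1 * d)%N%:Z).
Proof.
pose L (i : 'I_n.+1) : {ffun 'I_n -> 'I_n.+1} := [ffun a => lift i a].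
have kL i p : at_point (Defs.form f i) p != 0 ->
    frame_scale i * omega (L i) = (g i)^-1 ^+ n.
  move=> fi; rewrite -(wedge_frame fi) ffunE -(det_frame_lift g i); congr (\det _).
  by apply/matrixP => a b; rewrite [LHS]mxE [RHS]mxE ffunE.
exists [ffun I : {ffun 'I_n -> 'I_n.+1} => omega I]; split.
  have v1 : const_mx 1 != 0 :> 'rV[K]_N.+1.
    by apply/rV0Pn; exists ord0; rewrite mxE oner_neq0.
  have [i fi] := no_zero (mk_point v1); apply/eqP => /ffunP /(_ (L i)).
  rewrite !ffunE => o0; have := kL _ _ fi; rewrite o0 mulr0 => /esym/eqP.
  by rewrite expf_eq0 invr_eq0 (negbTE (frac_form_neq0 fi)) andbF.
move=> p eta; have [i fi] := no_zero p; have gi := frac_form_neq0 fi.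
have {}kL := kL _ _ fi; have k0 := frame_scale_neq0 fi; set k := frame_scale i in kL k0.
split=> [det_eta|[phi [phist etaE]] lambda lst]; last first.
  have := lst _ (wedge_in_ext (frame_in_syz fi)).
  have -> : \sum_t lambda t * wedge (frame i) t = k * (\sum_t lambda t * omega t).
    by rewrite mulr_sumr; apply: eq_bigr => I _; rewrite (wedge_frame fi) mulrCA.
  have -> : \sum_t lambda t * eta t = phi * (\sum_t lambda t * omega t).
    by rewrite mulr_sumr; apply: eq_bigr => I _; rewrite etaE ffunE mulrCA.
  move: (\sum_t _) => x kx; have -> : phi * x = phi * k^-1 * (k * x).
    by rewrite -mulrA mulKf.
  apply: (@stalk_eq _ _ ((- (n.+1 * d)%N%:Z + (n.+1 * d)%N%:Z) + 0)).
    by rewrite addr0 addNr.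
  apply: stalkM; last exact: kx.
  apply: stalkM; first exact: phist.
  exact: frame_scaleV_stalk i p.
(* The coefficient of eta on the wedge of the frame, whose coordinate at L i is the inverse of g i
   ^+ n. *)
pose theta := g i ^+ n * eta (L i).
have theta_st : twist_stalk 0 p theta.
  have := det_eta (fun I => if I == L i then g i ^+ n else 0).
  rewrite sum_pick; apply=> xi /(ext_stalk_syz fi) [t [tst xiE]].
  rewrite sum_pick xiE kL (expfVK t n gi).
  exact: tst.
exists (theta * k); split=> [|I].
  apply: (@stalk_eq _ _ (0 + - (n.+1 * d)%N%:Z)); first exact: add0r.
  exact: stalkM theta_st (frame_scale_stalk fi).
rewrite ffunE; apply/eqP; rewrite -subr_eq0; apply/negPn/negP => delta0.
set delta := (X in X != 0) in delta0.
(* The linear form below vanishes on the exterior power, so the rescaled value  *)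
(* at eta would be regular at p whatever the scale.                              *)
apply: (@stalk0_not_coord K N p ord0); set X := frac_of _.
have := det_eta (fun J => (if J == I then X / delta else 0)
  - (if J == L i then X / delta * (g i ^+ n * (k * omega I)) else 0)).
rewrite sum_pick2.
have -> : X / delta * eta I - X / delta * (g i ^+ n * (k * omega I)) * eta (L i) = X.
  exact: (rescale X delta0).
apply=> xi /(ext_stalk_syz fi) [t [tst xiE]].
rewrite sum_pick2 !xiE -/k kL.
rewrite (scale_cancel (X / delta) (k * omega I) t n gi).
exact: stalk0.
Qed.

End SyzygyBundle.

(** * Generic forms *)

Section Genericity.

Variables (K : closedFieldType) (V : vectType K).

Lemma polyfun_open (phi : V -> K) : polyfun phi -> zariski_open (fun v => phi v != 0).
Proof.
move=> [P PE]; exists (eq P) => v; split=> [|[Q [<-]]]; last by rewrite PE.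
by move=> phiv; exists P; rewrite -PE.
Qed.

Lemma exists_common_nonroot (p q : {poly K}) : p != 0 -> q != 0 ->
  exists x, p.[x] != 0 /\ q.[x] != 0.
Proof.
move=> p0 q0; have [x] := closed_nonrootP (p * q) (mulf_neq0 p0 q0).
by rewrite /root hornerM mulf_eq0 negb_or => /andP[px qx]; exists x.
Qed.

Lemma polyfun_line (phi : V -> K) u v : polyfun phi ->
  exists p : {poly K}, forall x, p.[x] = phi (x *: u + v).
Proof.
move=> [P PE].
exists (mmap polyC (fun i => (coord (vbasis {:V}) i u)%:P * 'X + (coord (vbasis {:V}) i v)%:P) P).
move=> x; rewrite PE /meval /mmap -horner_evalE rmorph_sum; apply: eq_bigr => m _.
rewrite rmorphM /= /horner_eval hornerC; congr (_ * _).
rewrite /mmap1 -horner_evalE rmorph_prod; apply: eq_bigr => i _.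
rewrite rmorphXn /= /horner_eval; congr (_ ^+ _).
by rewrite !hornerE linearP /= mulrC.
Qed.

(** On the line through v0 and a point w of the other open set, both functions restrict to nonzero
    univariate polynomials, which have a common nonroot. *)
Lemma polyfun_dense (phi : V -> K) v0 : polyfun phi -> phi v0 != 0 ->
  zariski_dense (fun v => phi v != 0).
Proof.
move=> hphi phi0 W [S SW] [w /SW [P [SP Pw]]].
have [p pE] := polyfun_line (w - v0) v0 hphi.
have [q qE] : exists q : {poly K}, forall x,
    q.[x] = P.@[fun i => coord (vbasis {:V}) i (x *: (w - v0) + v0)].
  have hP : polyfun (fun v => P.@[fun i => coord (vbasis {:V}) i v]) by exists P.
  exact: (polyfun_line (w - v0) v0 hP).
have [||x [px qx]] := @exists_common_nonroot p q.
- by apply: contraNneq phi0 => p0; rewrite -[v0]add0r -(scale0r (w - v0)) -pE p0 horner0.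
- by apply: contraNneq Pw => q0; rewrite -[w](subrK v0) -[w - _]scale1r -qE q0 horner0.
exists (x *: (w - v0) + v0); split; first by rewrite -pE.
by apply/SW; exists P; rewrite -qE.
Qed.

End Genericity.

Lemma for_general_sub (K : closedFieldType) N n d (P Q : forms K N n d -> Prop) :
  (forall f, P f -> Q f) -> for_general P -> for_general Q.
Proof. by move=> PQ [U [Uo Ud UP]]; exists U; split=> // f /UP /PQ. Qed.

Lemma general_no_plucker_form (K : closedFieldType) N n d (f0 : forms K N n d)
    (good : nat -> nat -> bool) b c :
  (forall r m, good r m -> no_plucker_form r (Defs.form f0) m) ->
  for_general (fun f : forms K N n d => forall r m, (r < b)%N -> (m < c)%N ->
    good r m -> no_plucker_form r (Defs.form f) m).
Proof.
move=> good0; have /fin_all_exists [Delta DP] : forall rm : 'I_b * 'I_c,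
    exists Delta, [/\ polyfun Delta, Delta f0 != 0 & forall f : forms K N n d,
      Delta f != 0 -> good rm.1 rm.2 -> no_plucker_form rm.1 (Defs.form f) rm.2].
  case=> r m /=; have [g|_] := boolP (good r m); last first.
    by exists (fun=> 1); split=> //; [exact: polyfunC | exact: oner_neq0].
  have [Delta [D1 D2 D3]] := no_plucker_form_open (good0 _ _ g).
  by exists Delta; split=> // f /D3.
have Dpf : polyfun (fun f : forms K N n d => \prod_rm Delta rm f).
  by apply: polyfun_prod => rm; have [] := DP rm.
exists (fun f => \prod_rm Delta rm f != 0); split.
- exact: polyfun_open.
- apply: (polyfun_dense (v0 := f0)) => //.
  by apply/prodf_neq0 => rm _; have [] := DP rm.
move=> f /prodf_neq0 Df r m rb mc; have [_ _ h] := DP (Ordinal rb, Ordinal mc).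
exact: h (Df _ isT).
Qed.

Definition monomial_forms (K : closedFieldType) N n d (e : 'I_n -> 'X_{1..N.+1})
    (e_deg : forall i, 'X_[K, e i] \is d.-homog) : forms K N n d :=
  [ffun i => DHomog (e_deg i)].

(** The slopes are -d - m/r and -d - d/n. *)
Lemma slope_lt_syz r m n d : (0 < r)%N -> (0 < n)%N ->
  (slope r (- (d * r + m)%N%:Z) < slope n (- (n.+1 * d)%N%:Z)) = (d * r < m * n)%N.
Proof.
move=> r0 n0; rewrite /slope !mulrNz !mulNr ltrN2.
rewrite ltr_pdivrMr ?ltr0n // mulrAC ltr_pdivlMr ?ltr0n //.
rewrite -!natrM ltr_nat; lia.
Qed.

Lemma slope_le_syz r m n d : (0 < r)%N -> (0 < n)%N ->
  (slope r (- (d * r + m)%N%:Z) <= slope n (- (n.+1 * d)%N%:Z)) = (d * r <= m * n)%N.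
Proof.
move=> r0 n0; rewrite /slope !mulrNz !mulNr lerN2.
rewrite ler_pdivrMr ?ltr0n // mulrAC ler_pdivlMr ?ltr0n //.
rewrite -!natrM ler_nat; lia.
Qed.

Lemma syz_slope_condition (K : closedFieldType) N n d (f : forms K N n.+1 d) (cmp : rel rat) :
  (0 < N)%N -> (0 < n)%N -> m_primary f ->
  (forall r m, (0 < r < n)%N ->
     ~~ cmp (slope r (- (d * r + m)%N%:Z)) (slope n (- (n.+1 * d)%N%:Z)) ->
     no_plucker_form r (Defs.form f) m) ->
  slope_condition cmp (- d%:Z) (Syz f).
Proof.
move=> N0 n0 /m_primary_no_zero fp np; split; first exact: syz_coherent.
exists n, (- (n.+1 * d)%N%:Z); split=> //; [exact: syz_rank | exact: syz_c1 |].
move=> F r a _ FS Fr Fc rn.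
have [m [w [A0 [-> wh wp wa wA]]]] := subsheaf_plucker_form N0 FS Fr Fc.
apply/negPn/negP => ncmp; case/eqP: wA.
exact: (np _ _ rn ncmp w wh wp wa).
Qed.

Theorem theorem4p1 (K : closedFieldType) :
  (forall N d n : nat,
     (2 <= N)%N -> (1 <= d)%N -> (N.+1 <= n <= 'C(d + N, N))%N ->
     (N, d, n) <> (2%N, 2%N, 5%N) ->
     for_general (fun f : forms K N n d =>
       m_primary f -> stable (- d%:Z) (Syz f))) /\
  for_general (fun f : forms K 2 5 2 =>
    m_primary f -> semistable (- 2%:Z) (Syz f)).
Proof.
have monom_homog N n d (e : 'I_n -> 'X_{1..N.+1}) :
    (forall i, mdeg (e i) = d) -> forall i, 'X_[K, e i] \is d.-homog.
  by move=> ed i; rewrite dhomogX /= ed.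
split=> [N d n N2 d1 nb ne|].
  have [v [L [vN spL szL]]] := exists_spread N2 d1 nb ne.
  have [||e [ed br]] := @spread_brenner ltn N.+1 v d L _ _ vN d1 spL.
  - by [].
  - by move=> a b c; apply: leq_ltn_trans.
  subst n; case: (size L) e ed br nb => [|n] e ed br nb; first by lia.
  pose f0 := monomial_forms (monom_homog _ _ _ e ed).
  (* Finitely many pairs suffice: r < n and m n <= d r force m <= d. *)
  apply: for_general_sub (general_no_plucker_form (f0 := f0)
    (good := fun r m => (0 < r < n)%N && (m * n <= d * r)%N) n d.+1 _).
    move=> f np fp; apply: syz_slope_condition => // [||r m rn]; [lia | lia |].
    rewrite slope_lt_syz -?leqNgt; [|lia|lia] => mr; apply: np; [lia | | by rewrite rn].
    by rewrite ltnS -(@leq_pmul2r n) ?(leq_trans mr) ?leq_mul2l; lia.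
  move=> r m /andP[rn mr] w wh wp wa.
  apply: (brenner_lt ed br rn mr) => //.
  by move=> I a; rewrite -[RHS](wa I a); apply: eq_bigr => i _; rewrite /Defs.form ffunE.
have [||e [ed br]] := @spread_brenner leq 3 3 2 _ _ _ (leqnn 3) isT conics5_spread.
- by move=> a b /ltnW.
- by move=> a b c; apply: leq_trans.
pose f0 := monomial_forms (monom_homog _ _ _ e ed).
apply: for_general_sub (general_no_plucker_form (f0 := f0)
  (good := fun r m => (0 < r < 4)%N && (m * 4 < 2 * r)%N) 4 3 _).
  move=> f np fp; apply: syz_slope_condition => // r m rn.
  rewrite slope_le_syz -?ltnNge; [|lia|lia] => mr; apply: np; [lia | lia | by rewrite rn].
move=> r m /andP[rn mr] w wh wp wa.
apply: (brenner_le ed br rn mr) => //.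
by move=> I a; rewrite -[RHS](wa I a); apply: eq_bigr => i _; rewrite /Defs.form ffunE.
Qed.
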